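(* For $n\in\mathbb{N}$ let $M_n$ be the random symmetric $n\times n$ matrix whose entries on and above the diagonal are independent Rademacher random variables. There is an absolute constant $c>0$ such that for every $\varepsilon>0$ there is $n_0=n_0(\varepsilon)$ such that for all integers $n\ge n_0$, $$\Pr\left(|\operatorname{per} M_n|\le n^{n/2-\varepsilon n}\right)\le n^{-c}.$$
   Context: A Rademacher random variable takes the values $+1$ and $-1$ with probability $1/2$ each. The entries of $M_n$ below the diagonal are determined by symmetry. The permanent of an $n\times n$ matrix $M=(x_{i,j})$ is $\operatorname{per}(M)=\sum_{\pi\in S_n}\prod_{i=1}^n x_{i,\pi(i)}$. *)

(* Defs.v *)
From HB Require Import structures.
From mathcomp Require Import all_boot all_order all_algebra all_fingroup.
From mathcomp Require Import all_classical all_reals all_analysis.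

Set Implicit Arguments.
Unset Strict Implicit.
Unset Printing Implicit Defensive.

Import Order.TTheory GRing.Theory Num.Theory.
Import numFieldNormedType.Exports.

Local Open Scope classical_set_scope.
Local Open Scope ring_scope.

Definition permanent (R : comNzRingType) (n : nat) (A : 'M[R]_n) : R :=
  \sum_(s : 'S_n) \prod_(i < n) A i (s i).

Section random_matrices.
Context (d : measure_display) (T : measurableType d) (R : realType).
Variable P : probability T R.

Definition rademacher (X : {RV P >-> R}) : Prop :=
  P (X @^-1` [set 1]) = (2^-1)%:E /\ P (X @^-1` [set (- 1)]) = (2^-1)%:E.

(* Mutual independence of the subfamily (X i)_(i in D): the product rule is
   required for every J \subset D, not only for D itself. *)
Definition mutually_independent (I : finType) (D : {set I})
    (X : I -> {RV P >-> R}) : Prop :=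
  forall (J : {set I}) (B : I -> set R),
    J \subset D -> (forall i, measurable (B i)) ->
    (P (\bigcap_(i in [set` J]) (X i @^-1` B i)) =
     \prod_(i in J) P (X i @^-1` B i))%E.

Definition rademacher_symmetric n (M : 'I_n -> 'I_n -> {RV P >-> R}) : Prop :=
  [/\ forall i j w, M i j w = M j i w,
      forall i j : 'I_n, (i <= j)%N -> rademacher (M i j) &
      mutually_independent [set p : 'I_n * 'I_n | (p.1 <= p.2)%N]%SET
        (fun p => M p.1 p.2)].

End random_matrices.

(* Main.v *)
(** Follow large minors (permanents of submatrices) while the matrix is revealed.

    Adding a row [r] to a minor on the first [r] rows is a signed sum of smaller minors with
    fresh signs. By a vector Littlewood-Offord inequality the sum of the squares of the minors
    over a structured family of column sets grows by a factor of order [n], except with a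
    probability so small that only [n / J] rows can fail, and a failing row costs only a
    power of [n]. After [n - O(n / J)] rows, some minor is thus of size [n ^ (n / 2 - O(n / J))].

    A minor with rows [T] and columns [B] becomes principal by revealing [O(n / J)] new
    vertices (row and column together): two columns or one diagonal entry give a coefficient
    which is comparable to the minor, hence a constant probability of progress.

    From a principal minor missing a set [Z] of vertices, two new vertices can be exchanged
    with two elements of [Z]: the coefficient of one monomial in the four new entries is twice
    the minor. Hence [Z] can be moved to a set of size [2 u], with [u] of order [log n], inside
    any one of many disjoint target sets, simultaneously for most of them. In the [2 u] last
    steps the large minors form a system of quadratic forms in the new vertex, and a constant
    proportion of them survives except with probability [2 ^ - u], a power of [n]. The last
    minor is the whole permanent. *)

From mathcomp Require Import all_boot all_order all_algebra all_fingroup.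
From mathcomp Require Import ring lra zify.

Set Implicit Arguments.
Unset Strict Implicit.
Unset Printing Implicit Defensive.

Import Order.TTheory GRing.Theory Num.Theory.

Local Open Scope ring_scope.

(** * Random signs *)

(** A single attempt succeeds only with constant probability, whereas the total failure must be a
    negative power of [n]. The conversion can afford to skip a vertex that does not help, and the
    exchanges choose among many disjoint pairs of [Z]. Neither is possible once only about [log n]
    vertices are missing: every remaining vertex must be used and no choice is left. Hence many
    disjoint sets are followed at once there, and a second-moment argument is needed for a whole
    system of quadratic forms.

    The exponent [c] does not depend on [eps]. The precision enters only through [J]: a row fails
    with probability [2 ^ - (2 * J)], which beats the at most [2 ^ n] choices of failing rows once
    about [n / J] of them fail. The endgame is governed by [u] alone, about [log2 n / 64], and its
    errors are of order [u * (15 / 16) ^ u]. *)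

Section Expectation.
Context (R : realFieldType) (J : finType).
Local Notation bits := {ffun J -> bool}.
Implicit Types (f g : bits -> R) (E F : pred bits) (S T : {set J}) (x y z : bits).

Definition Ex f : R := (\sum_x f x) / #|{: bits}|%:R.
Definition pr E : R := Ex (fun x => (E x)%:R).

Lemma card_bits_gt0 : 0 < #|{: bits}|%:R :> R.
Proof. by rewrite ltr0n; apply/card_gt0P; exists [ffun=> true]. Qed.

Lemma eq_Ex f g : f =1 g -> Ex f = Ex g.
Proof. by move=> fg; congr (_ / _); apply: eq_bigr. Qed.

Lemma ExD f g : Ex (fun x => f x + g x) = Ex f + Ex g.
Proof. by rewrite /Ex big_split mulrDl. Qed.

Lemma ExZ c f : Ex (fun x => c * f x) = c * Ex f.
Proof. by rewrite /Ex -mulr_sumr mulrA. Qed.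

Lemma ExN f : Ex (fun x => - f x) = - Ex f.
Proof. by rewrite /Ex sumrN mulNr. Qed.

Lemma Ex_cst c : Ex (fun=> c) = c.
Proof.
rewrite /Ex sumr_const -(mulr_natr c) mulfK //.
by rewrite gt_eqF // card_bits_gt0.
Qed.

Lemma Ex_le f g : (forall x, f x <= g x) -> Ex f <= Ex g.
Proof.
move=> fg; rewrite /Ex ler_pM2r ?invr_gt0 ?card_bits_gt0 //.
exact: ler_sum.
Qed.

Lemma Ex_ge0 f : (forall x, 0 <= f x) -> 0 <= Ex f.
Proof. by move=> f0; rewrite -(Ex_cst 0); apply: Ex_le. Qed.

Lemma Ex_sum (I : Type) (r : seq I) (P : pred I) (f : I -> bits -> R) :
  Ex (fun x => \sum_(i <- r | P i) f i x) = \sum_(i <- r | P i) Ex (f i).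
Proof. by rewrite /Ex exchange_big /= mulr_suml. Qed.

Lemma Ex_sqr_le f : (Ex f) ^+ 2 <= Ex (fun x => f x ^+ 2).
Proof.
have := @Ex_ge0 (fun x => (f x - Ex f) ^+ 2) (fun x => sqr_ge0 _).
rewrite (eq_Ex (g := fun x => f x ^+ 2 + ((- 2 * Ex f) * f x + Ex f ^+ 2))); last first.
  by move=> x; ring.
rewrite ExD ExD ExZ Ex_cst; nra.
Qed.

Lemma pr_ge0 E : 0 <= pr E.
Proof. by apply: Ex_ge0 => x; rewrite ler0n. Qed.

Lemma pr_le1 E : pr E <= 1.
Proof. by rewrite -[leRHS](Ex_cst 1); apply: Ex_le => x; case: (E x). Qed.

Lemma pr_le E F : (forall x, E x -> F x) -> pr E <= pr F.
Proof.
move=> EF; apply: Ex_le => x; have := EF x.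
by case: (E x); case: (F x) => // /(_ isT).
Qed.

Lemma pr_eq0 E : (forall x, ~~ E x) -> pr E = 0.
Proof.
move=> E0; rewrite -[RHS](Ex_cst 0); apply: eq_Ex => x.
by rewrite (negbTE (E0 x)).
Qed.

Lemma pr_predC E : pr (fun x => ~~ E x) = 1 - pr E.
Proof.
rewrite -{1}[1](Ex_cst 1) /pr -ExN -ExD; apply: eq_Ex => x.
by case: (E x) => /=; ring.
Qed.

Lemma markov f c : (forall x, 0 <= f x) -> 0 < c ->
  pr (fun x => c <= f x) <= Ex f / c.
Proof.
move=> f0 c0; rewrite ler_pdivlMr // mulrC -ExZ; apply: Ex_le => x.
by case: (lerP c (f x)) => [cf|_]; rewrite ?mulr1 ?mulr0.
Qed.

Lemma pr_union (I : finType) (A : {set I}) (E : I -> pred bits) :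
  pr (fun x => [exists i in A, E i x]) <= \sum_(i in A) pr (E i).
Proof.
rewrite -Ex_sum; apply: Ex_le => x.
case: existsP => [[i /andP[iA Ei]]|_]; last by apply: sumr_ge0.
by rewrite (bigD1 i) //= Ei lerDl; apply: sumr_ge0.
Qed.

(** Conditioning is encoded as resampling: fixing [x] and averaging over [y] is the conditional
    expectation given the bits outside [S], all on one sample space. *)
Definition mix (S : {set J}) (x y : bits) : bits :=
  [ffun j => if j \in S then y j else x j].

Lemma mix_mix S x y z : mix S (mix S x y) z = mix S x z.
Proof. by apply/ffunP => j; rewrite !ffunE; case: (j \in S). Qed.

Lemma mixx S x : mix S x x = x.
Proof. by apply/ffunP => j; rewrite !ffunE; case: (j \in S). Qed.

Lemma mixT x y : mix setT x y = y.
Proof. by apply/ffunP => j; rewrite !ffunE inE. Qed.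

(* [(x, y) |-> (mix S y x, mix S x y)] is an involution. *)
Lemma Ex_mix S f : Ex (fun x => Ex (fun y => f (mix S x y))) = Ex f.
Proof.
rewrite -[RHS]Ex_cst /Ex -mulr_suml; congr (_ / _).
rewrite -!mulr_suml; congr (_ / _).
rewrite !pair_big /=.
pose h (p : bits * bits) := (mix S p.2 p.1, mix S p.1 p.2).
have hK : involutive h.
  move=> [x y]; rewrite /h /=; congr pair; apply/ffunP => j;
    by rewrite !ffunE; case: (j \in S).
by rewrite [RHS](reindex_inj (inv_inj hK)) /=; apply: eq_bigr => p _.
Qed.

(* The conditional probability of [E], the bits outside [S] being those of [x]. *)
Definition cpr S x E : R := pr (fun y => E (mix S x y)).

Lemma cpr_tower S S' x f : S' \subset S ->
  Ex (fun y => f (mix S x y)) =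
  Ex (fun y => Ex (fun z => f (mix S' (mix S x y) z))).
Proof.
move=> sS; rewrite -(Ex_mix S'); apply: eq_Ex => y; apply: eq_Ex => z.
congr f; apply/ffunP => j; rewrite !ffunE.
by case: ifP => // jS; case: ifP => // /(subsetP sS); rewrite jS.
Qed.

Lemma pr_cpr S E : pr E = Ex (fun x => cpr S x E).
Proof. by rewrite /cpr /pr -(Ex_mix S). Qed.

(** Glues two phases: either the first misses [E], or the second, started from a state satisfying
    [E] with the bits of [S'] still hidden, ends in [F]. Only states that agree with [x] on what is
    already revealed matter for [q]. *)
Lemma cpr_step S S' x E F p q : S' \subset S -> 0 <= q ->
  cpr S x (fun y => ~~ E y) <= p ->
  (forall y, (forall j, j \notin S -> y j = x j) -> E y -> cpr S' y F <= q) ->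
  cpr S x F <= p + q.
Proof.
move=> sS q0 Ep Eq; rewrite /cpr /pr (cpr_tower x (fun y => (F y)%:R) sS).
apply: le_trans (lerD Ep (lexx q)).
rewrite -[q in leRHS]Ex_cst -ExD; apply: Ex_le => y.
case: (boolP (E (mix S x y))) => Exy /=; last first.
  by apply: (le_trans (pr_le1 _)); rewrite lerDl.
rewrite add0r; apply: Eq => // j jS; by rewrite ffunE (negbTE jS).
Qed.

Lemma pr_step S E F p q : 0 <= q ->
  pr (fun y => ~~ E y) <= p -> (forall y, E y -> cpr S y F <= q) -> pr F <= p + q.
Proof.
move=> q0 Ep Eq; have := @cpr_step setT S [ffun=> true] E F p q (subsetT _) q0.
rewrite /cpr /pr.
under [X in X <= p -> _]eq_Ex do rewrite mixT.
under [X in _ -> _ -> X <= _]eq_Ex do rewrite mixT.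
by apply=> // y _; apply: Eq.
Qed.

Definition sg (x : bits) j : R := (-1) ^+ x j.

Lemma sg_sqr x j : sg x j * sg x j = 1.
Proof. by rewrite /sg; case: (x j); rewrite ?expr1 ?expr0; ring. Qed.

Lemma norm_sg x j : `|sg x j| = 1.
Proof. by rewrite /sg normrX normrN1 expr1n. Qed.

Definition flip j (x : bits) : bits := [ffun i => x i (+) (i == j)].

Lemma flipK j : involutive (flip j).
Proof. by move=> x; apply/ffunP => i; rewrite !ffunE -addbA addbb addbF. Qed.

Lemma sg_flip j x i : sg (flip j x) i = if i == j then - sg x i else sg x i.
Proof.
rewrite /sg ffunE; case: (i == j); rewrite ?addbF // addbT.
by case: (x i) => /=; rewrite ?expr1 ?expr0 ?opprK.
Qed.

Lemma Ex_flip j f : Ex (fun x => f (flip j x)) = Ex f.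
Proof. by rewrite /Ex [in RHS](reindex_inj (inv_inj (flipK j))). Qed.

Lemma Ex_odd j f : (forall x, f (flip j x) = - f x) -> Ex f = 0.
Proof.
move=> fo; have : Ex f = - Ex f by rewrite -ExN -(Ex_flip j); exact: eq_Ex.
lra.
Qed.

Lemma pr_agree (T : {set J}) (s : bits) :
  pr (fun y => [forall j in T, y j == s j]) = (2 ^- #|T|).
Proof.
have -> : pr (fun y => [forall j in T, y j == s j])
    = #|family (fun j => if j \in T then pred1 (s j) else predT)|%:R / #|{: bits}|%:R.
  rewrite /pr /Ex -natr_sum; congr (_%:R / _); rewrite -sum1_card [RHS]big_mkcond /=.
  apply: eq_bigr => y _; suff -> : [forall j in T, y j == s j] =
    (y \in family (fun j => if j \in T then pred1 (s j) else predT)) by case: ifP.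
  apply/forall_inP/familyP => [ys j|ys j jT].
    by case: ifPn => // jT; rewrite inE ys.
  by have := ys j; rewrite jT inE.
rewrite card_family card_ffun card_bool.
have -> : foldr muln 1%N [seq #|(if j \in T then pred1 (s j) else predT)| | j : J]
   = (2 ^ (#|J| - #|T|))%N.
  rewrite foldrE big_map big_enum /= (bigID (mem T)) /= big1 ?mul1n => [|j ->]; last exact: card1.
  rewrite (eq_bigr (fun=> 2%N)) => [|j /negbTE ->]; last by rewrite -card_bool; exact: eq_card.
  by rewrite prod_nat_const -(cardC (mem T)) addKn; congr (_ ^ _)%N; apply: eq_card.
rewrite natrX natrX; have TJ : (#|T| <= #|J|)%N by exact: max_card.
rewrite -{2}(subnK TJ) exprD invfM mulrA divff ?mul1r //.
by rewrite expf_neq0 // pnatr_eq0.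
Qed.
End Expectation.

Arguments pr {R J}.
Arguments cpr {R J}.
Arguments sg {R J}.

(** * Moments and anticoncentration of sign sums *)

Section SignSums.
Context (R : realFieldType) (J : finType).
Local Notation bits := {ffun J -> bool}.
Local Notation pr := (@pr R _).
Local Notation sg := (@sg R _).
Implicit Types (x y : bits) (v a : J -> R).

(** Bits read along an injection are uniform again. This carries results on an abstract index set
    over to the bits of one row or column of the matrix. *)
Lemma Ex_pushforward (V : finType) (phi : V -> J) (f : {ffun V -> bool} -> R) :
  injective phi -> Ex (fun y : bits => f [ffun i => y (phi i)]) = Ex f.
Proof.
move=> phi_inj.
rewrite (eq_Ex (g := fun y : bits =>
    \sum_z f z * ([ffun i => y (phi i)] == z)%:R)); last first.
  move=> y; rewrite (bigD1 [ffun i => y (phi i)]) //= eqxx mulr1 big1 ?addr0 // => z zy.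
  by rewrite eq_sym (negbTE zy) mulr0.
rewrite Ex_sum [RHS]mulr_suml; apply: eq_bigr => z _; rewrite ExZ; congr (_ * _).
pose s : bits := [ffun j => [exists i, (phi i == j) && z i]].
have -> : Ex (fun y : bits => ([ffun i => y (phi i)] == z)%:R)
  = pr (fun y : bits => [forall j in [set phi i | i : V], y j == s j]) :> R.
  apply: eq_Ex => y; congr (nat_of_bool _)%:R.
  have sE i : s (phi i) = z i.
    rewrite ffunE; apply/existsP/idP => [[k /andP[/eqP/phi_inj-> //]]|zi].
    by exists i; rewrite eqxx.
  apply/eqP/forall_inP => [yz j /imsetP[i _ ->]|ys].
    by rewrite sE -yz ffunE.
  by apply/ffunP => i; rewrite ffunE -sE; apply/eqP/ys/imset_f.
rewrite pr_agree card_imset // card_ffun card_bool natrX.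
by rewrite (_ : #|[pred _ | true]| = #|V|) //; exact: eq_card.
Qed.

(** Terms odd in the new sign average to 0. With [X] the sum of squares so far and [v] the new
    coefficient, the fourth moment becomes at most [3 X^2 + 6 v^2 X + v^4], which is below
    [3 (X + v^2)^2]. *)
Lemma sign_sum_moments v (s : seq J) : uniq s ->
  Ex (fun x => (\sum_(k <- s) v k * sg x k) ^+ 2) = \sum_(k <- s) v k ^+ 2 /\
  Ex (fun x => (\sum_(k <- s) v k * sg x k) ^+ 4) <= 3 * (\sum_(k <- s) v k ^+ 2) ^+ 2.
Proof.
elim: s => [_|k s IH /= /andP[ks /IH[IH2 IH4]]].
  by split; under eq_Ex do rewrite big_nil; rewrite big_nil Ex_cst !expr0n ?mulr0.
pose S x := \sum_(i <- s) v i * sg x i.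
have Sflip x : S (flip k x) = S x.
  by apply: eq_big_seq => i si; rewrite sg_flip; case: eqP => // ik; rewrite -ik si in ks.
have odd p c : Ex (fun x => c * (S x ^+ p * sg x k)) = 0.
  by rewrite ExZ (@Ex_odd _ _ k) ?mulr0 // => x; rewrite Sflip sg_flip eqxx mulrN.
split.
  rewrite (eq_Ex (g := fun x => S x ^+ 2 + (2 * v k * (S x ^+ 1 * sg x k) + v k ^+ 2))); last first.
    move=> x; rewrite big_cons -/(S x).
    rewrite (_ : _ ^+ 2 = S x ^+ 2 + (2 * v k * (S x ^+ 1 * sg x k)
      + v k ^+ 2 * (sg x k * sg x k))); last by ring.
    by rewrite sg_sqr mulr1.
  by rewrite ExD ExD odd Ex_cst IH2 big_cons add0r addrC.
rewrite (eq_Ex (g := fun x => S x ^+ 4 + (4 * v k * (S x ^+ 3 * sg x k)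
    + (6 * v k ^+ 2 * S x ^+ 2 + (4 * v k ^+ 3 * (S x ^+ 1 * sg x k) + v k ^+ 4))))); last first.
  move=> x; rewrite big_cons -/(S x).
  rewrite (_ : _ ^+ 4 = S x ^+ 4 + (4 * v k * (S x ^+ 3 * sg x k)
    + (6 * v k ^+ 2 * (sg x k * sg x k) * S x ^+ 2
    + (4 * v k ^+ 3 * (sg x k * sg x k) * (S x ^+ 1 * sg x k)
    + v k ^+ 4 * (sg x k * sg x k) * (sg x k * sg x k))))); last by ring.
  by rewrite sg_sqr !mulr1.
rewrite !ExD !odd Ex_cst ExZ IH2 big_cons.
move: IH4; set X := \sum_(_ <- _) _ ^+ 2; rewrite -/S.
have := sqr_ge0 (v k ^+ 2); have := sqr_ge0 (v k); move: (Ex _) => E; nra.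
Qed.

Lemma Ex_sign_sum_sqr v (A : {set J}) :
  Ex (fun x => (\sum_(k in A) v k * sg x k) ^+ 2) = \sum_(k in A) v k ^+ 2.
Proof.
have [h _] := sign_sum_moments v (enum_uniq (mem A)).
rewrite big_enum /= in h; rewrite -h; apply: eq_Ex => x.
by rewrite big_enum.
Qed.

Lemma Ex_sign_sum_sqrT v :
  Ex (fun x => (\sum_k v k * sg x k) ^+ 2) = \sum_k v k ^+ 2.
Proof.
rewrite (_ : \sum_k v k ^+ 2 = \sum_(k in setT) v k ^+ 2); last by apply: eq_bigl => k; rewrite inE.
rewrite -Ex_sign_sum_sqr; apply: eq_Ex => x; congr (_ ^+ _).
by apply: eq_bigl => k; rewrite inE.
Qed.

Lemma Ex_sign_sum_pow4 v :
  Ex (fun x => (\sum_k v k * sg x k) ^+ 4) <= 3 * (\sum_k v k ^+ 2) ^+ 2.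
Proof.
have [_ h] := sign_sum_moments v (enum_uniq J).
rewrite big_enum /= in h; apply: le_trans h.
by apply: Ex_le => x; rewrite big_enum.
Qed.

(* Paley-Zygmund *)
Lemma sign_sum_large v :
  3 / 16 <= pr (fun x => \sum_k v k ^+ 2 / 4 <= (\sum_k v k * sg x k) ^+ 2).
Proof.
rewrite -mulr_suml; set A := \sum_k v k ^+ 2.
have A0 : 0 <= A by apply: sumr_ge0 => k _; exact: sqr_ge0.
have [A_eq0|An0] := eqVneq A 0.
  rewrite (_ : pr _ = 1); first by lra.
  rewrite -[RHS](Ex_cst J 1); apply: eq_Ex => x.
  by rewrite A_eq0 mul0r sqr_ge0.
have Agt0 : 0 < A by rewrite lt_neqAle eq_sym An0.
set E := fun x => _.
have E2' := Ex_sign_sum_sqrT v; rewrite -/A in E2'.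
have E4 := Ex_sign_sum_pow4 v; rewrite -/A in E4.
(* On [E], AM-GM gives [s^2 <= s^4 / (8 A) + 2 A]; off [E], [s^2 < A / 4]. In expectation
   [A <= A / 4 + 3 A / 8 + 2 A * pr E], whence [3 / 16]. *)
have : Ex (fun x => (\sum_k v k * sg x k) ^+ 2) <=
   Ex (fun x => A / 4 + ((8 * A)^-1 * (\sum_k v k * sg x k) ^+ 4 + 2 * A * (E x)%:R)).
  apply: Ex_le => x; rewrite /E; set s := \sum_k _ * _.
  case: (lerP (A / 4) (s ^+ 2)) => [_|sA] /=.
    rewrite mulr1n mulr1 -subr_ge0.
    rewrite (_ : _ - _ = (8 * A)^-1 * ((s ^+ 2 - 4 * A) ^+ 2 + 2 * A ^+ 2)); last by field.
    by rewrite mulr_ge0 ?invr_ge0 ?addr_ge0 ?sqr_ge0 ?mulr_ge0 ?sqr_ge0 // ltW // mulr_gt0.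
  rewrite mulr0n mulr0 addr0; apply: (le_trans (ltW sA)); rewrite lerDl.
  have s4 : 0 <= s ^+ 4 by rewrite (_ : s ^+ 4 = (s ^+ 2) ^+ 2) ?sqr_ge0 //; ring.
  by apply: mulr_ge0 => //; rewrite invr_ge0; lra.
rewrite E2' !ExD Ex_cst !ExZ -/(pr E) => h.
have : A <= A / 4 + ((8 * A)^-1 * (3 * A ^+ 2) + 2 * A * pr E).
  apply: (le_trans h); rewrite lerD2l lerD2r ler_wpM2l // invr_ge0; lra.
rewrite (_ : (8 * A)^-1 * (3 * A ^+ 2) = A * (3 / 8)); last by field.
move=> h'; have : A * (3 / 16) <= A * pr E by lra.
by rewrite ler_pM2l.
Qed.

(** Moving a point of the strip down by at least its width takes it past [- r]. Both thresholds are
    kept so that the bound has the same form when the point moves up. *)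
Lemma strip_crossing (z t r : R) : 0 < r -> 2 * r <= t ->
  (`|z| < r)%R%:R <= ((- r < z)%R%:R - (- r < z - t)%R%:R)
     + ((r <= z)%R%:R - (r <= z - t)%R%:R) :> R.
Proof.
move=> r0 tr; rewrite real_ltr_norml ?num_real //.
have [zr|zr] := lerP r z; have [zr'|zr'] := lerP z (- r) => /=;
  have [h|h] := lerP (z - t) (- r) => /=; have [h'|h'] := lerP r (z - t) => /=; lra.
Qed.

(* Each coordinate in [G] is pivotal, at a point of the strip [-r < f < r], for one of
   the monotone functions [f > -r] and [f >= r], whose total influence is at most
   [E |sum_(i in G) x i|]. *)
Lemma littlewood_offord a (c r : R) (G : {set J}) (w : nat) : 0 < r ->
  (forall j, j \in G -> r <= `|a j|) -> (0 < w)%N -> (w ^ 2 <= #|G|)%N ->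
  pr (fun x => `|c + \sum_j a j * sg x j| < r) <= 4 / w%:R.
Proof.
move=> r0 ra w0 wG; pose f x := c + \sum_j a j * sg x j.
have fflip i x : f (flip i x) = f x - 2 * a i * sg x i.
  rewrite /f !(bigD1 i (P := predT)) //= sg_flip eqxx.
  rewrite (eq_bigr (fun j => a j * sg x j)); first by ring.
  by move=> j /negbTE ji; rewrite sg_flip ji.
pose u x : R := (- r < f x)%R%:R; pose v x : R := (r <= f x)%R%:R.
pose s i := Num.sg (a i).
(* The factor [s i * sg x i] is 1 when flipping [i] lowers [f] and -1 when it raises [f], so that
   both differences of monotone indicators are counted positively. *)
have key x i : i \in G -> (`|f x| < r)%R%:R <=
   (u x - u (flip i x)) * (s i * sg x i) + (v x - v (flip i x)) * (s i * sg x i).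
  move=> /ra rai; rewrite /u /v /s fflip /sg.
  have a0 : a i != 0 by rewrite -normr_gt0 (lt_le_trans r0).
  have cross t z : r <= t -> (`|z| < r)%R%:R <= ((- r < z)%R%:R - (- r < z - 2 * t)%R%:R)
     + ((r <= z)%R%:R - (r <= z - 2 * t)%R%:R) :> R.
    by move=> rt; apply: strip_crossing => //; rewrite ler_pM2l.
  have cross' t z : r <= t -> (`|z| < r)%R%:R <= ((- r < z + 2 * t)%R%:R - (- r < z)%R%:R)
     + ((r <= z + 2 * t)%R%:R - (r <= z)%R%:R) :> R.
    move=> rt; rewrite real_ltr_norml ?num_real //.
    have [zr|zr] := lerP r z; have [zr'|zr'] := lerP z (- r) => /=;
      have [h|h] := lerP (z + 2 * t) (- r) => /=; have [h'|h'] := lerP r (z + 2 * t) => /=; lra.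
  move: rai; case: (x i) => /=; rewrite ?expr1 ?expr0; case: sgrP a0 => // ai _ rai;
    have := cross _ (f x) rai; have := cross' _ (f x) rai;
    rewrite ?(mulrN, mulr1, opprK); lra.
have wR : 0 < w%:R :> R by rewrite ltr0n.
set m := #|G| in wG; have m0 : 0 < m%:R :> R.
  by rewrite ltr0n (leq_trans _ wG) // expn_gt0 w0.
pose S x := \sum_(i in G) s i * sg x i.
have step (g : bits -> R) i : Ex (fun x => (g x - g (flip i x)) * (s i * sg x i)) =
    2 * Ex (fun x => g x * (s i * sg x i)).
  rewrite (eq_Ex (g := fun x => g x * (s i * sg x i) + g (flip i x) * (s i * sg (flip i x) i))).
    by rewrite ExD (Ex_flip i (fun x => g x * (s i * sg x i))); ring.
  by move=> x; rewrite sg_flip eqxx; ring.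
have main : m%:R * pr (fun x => `|f x| < r) <= 2 * Ex (fun x => (u x + v x) * S x).
  rewrite (eq_Ex (f := fun x => (u x + v x) * S x) (g := fun x =>
    \sum_(i in G) (u x * (s i * sg x i) + v x * (s i * sg x i)))); last first.
    by move=> x; rewrite mulrDl /S !mulr_sumr -big_split.
  rewrite Ex_sum mulr_sumr.
  rewrite (eq_bigr (fun i => Ex (fun x => (u x - u (flip i x)) * (s i * sg x i) +
     (v x - v (flip i x)) * (s i * sg x i)))); last first.
    by move=> i _; rewrite !ExD !step mulrDr.
  rewrite -Ex_sum /pr -ExZ; apply: Ex_le => x.
  rewrite mulr_natl -sumr_const; apply: ler_sum => i iG; exact: key.
have S2 : Ex (fun x => S x ^+ 2) <= m%:R.
  rewrite Ex_sign_sum_sqr /m -sum1_card natr_sum; apply: ler_sum => i _.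
  by rewrite /s; case: sgrP => _; rewrite ?sqrrN ?expr1n ?expr0n /= ?ler01 ?lexx.
(* [R] is only a real field, so [E |S|] is bounded through [2 |S| <= (w / m) S^2 + m / w] rather
   than by a square root; as [w^2 <= m], nothing essential is lost. *)
have bd : 2 * Ex (fun x => (u x + v x) * S x) <= 2 * (w%:R / m%:R * m%:R + m%:R / w%:R).
  rewrite ler_pM2l //.
  apply: (@le_trans _ _ (Ex (fun x => w%:R / m%:R * S x ^+ 2 + m%:R / w%:R))); last first.
    by rewrite ExD ExZ Ex_cst lerD2r ler_wpM2l // divr_ge0 // ltW.
  apply: Ex_le => x.
  have : (u x + v x) * S x <= 2 * `|S x|.
    apply: (le_trans (ler_norm _)); rewrite normrM ler_wpM2r //.
    by rewrite /u /v; case: (- r < f x); case: (r <= f x); rewrite /= ger0_norm; lra.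
  move/le_trans; apply; rewrite -subr_ge0 -[S x ^+ 2]real_normK ?num_real //.
  rewrite (_ : _ - _ = w%:R / m%:R * (`|S x| - m%:R / w%:R) ^+ 2).
    by rewrite mulr_ge0 ?sqr_ge0 // divr_ge0 // ltW.
  by field; rewrite !gt_eqF.
rewrite ler_pdivlMr // -(ler_pM2l m0).
apply: (le_trans (_ : _ <= (m%:R * pr (fun x => `|f x| < r)) * w%:R)); first by rewrite mulrA.
apply: (le_trans (_ : _ <= (2 * (w%:R / m%:R * m%:R + m%:R / w%:R)) * w%:R)).
  by rewrite ler_pM2r // (le_trans main).
rewrite (_ : (_ * _) * _ = 2 * (w%:R ^+ 2 + m%:R)); last by field; rewrite !gt_eqF.
have : w%:R ^+ 2 <= m%:R :> R by rewrite -natrX ler_nat.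
lra.
Qed.
End SignSums.

Section Exchange.
Context (R : realFieldType) (J K : finType).
Lemma Ex_exchange (f : {ffun J -> bool} -> {ffun K -> bool} -> R) :
  Ex (fun x => Ex (fun y => f x y)) = Ex (fun y => Ex (fun x => f x y)).
Proof. by rewrite /Ex -!mulr_suml exchange_big /= mulrAC. Qed.
End Exchange.

(** * Vector small-ball bound and repeated attempts *)

Section SmallBall.
Context (R : realFieldType) (J : finType).
Local Notation bits := {ffun J -> bool}.
Local Notation pr := (@pr R _).
Local Notation sg := (@sg R _).
Implicit Types (x y : bits) (a : J -> R).

Lemma cover_interval (r y : R) (k : nat) : 0 < r -> 0 <= y -> y <= k%:R * r ->
  exists i : 'I_k.+1, `|y - i%:R * r| < r.
Proof.
move=> r0 y0; elim: k => [|k IH] yk.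
  by exists ord0; rewrite mul0r in yk *; rewrite real_ltr_norml ?num_real //; lra.
case: (lerP y (k%:R * r)) => [/IH[i hi]|ky].
  by exists (widen_ord (leqnSn _) i).
exists ord_max; rewrite real_ltr_norml ?num_real //=.
by rewrite -[k.+1]addn1 natrD in yk *; lra.
Qed.

(** The interval of half-width [k r] is covered by [2 k + 1] strips of half-width [r], centred at
    [i r - k r]. *)
Lemma littlewood_offord_wide a (c r : R) (G : {set J}) (w k : nat) : 0 < r ->
  (forall j, j \in G -> r <= `|a j|) -> (0 < w)%N -> (w ^ 2 <= #|G|)%N ->
  pr (fun x => `|c + \sum_j a j * sg x j| <= k%:R * r) <= (k.*2.+1)%:R * (4 / w%:R).
Proof.
move=> r0 ra w0 wG; pose f x := c + \sum_j a j * sg x j.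
pose E (i : 'I_k.*2.+1) x := `|f x + k%:R * r - i%:R * r| < r.
apply: (@le_trans _ _ (pr (fun x => [exists i in setT, E i x]))).
  apply: pr_le => x; rewrite -/(f x) real_ler_norml ?num_real // => /andP[h1 h2].
  have [|| i hi] := @cover_interval r (f x + k%:R * r) k.*2 r0; first lra.
    by rewrite -addnn natrD; lra.
  by apply/exists_inP; exists i.
apply: le_trans (pr_union _ _ _) _.
rewrite (eq_bigl predT) => [|i]; last by rewrite inE.
rewrite mulr_natl -[in leRHS](card_ord k.*2.+1) -sumr_const; apply: ler_sum => i _.
have := @littlewood_offord R J a (c + k%:R * r - i%:R * r) r G w r0 ra w0 wG.
apply: le_trans; apply: pr_le => x.
by rewrite /E (_ : f x + _ - _ = c + k%:R * r - i%:R * r + \sum_j a j * sg x j) // /f; ring.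
Qed.

(* Projecting on a random sign vector [g] of [{ffun K -> bool}] reduces to the scalar case. *)
Lemma littlewood_offord_vector (K : finType) (v : J -> K -> R) (v0 : K -> R) (r rho : R)
    (G : {set J}) (w k : nat) : 0 < r -> 0 <= rho ->
  (forall j, j \in G -> r ^+ 2 <= \sum_i v j i ^+ 2) -> (0 < w)%N ->
  (16 * w ^ 2 <= #|G|)%N -> 64 * rho <= (k%:R * r) ^+ 2 ->
  pr (fun x => \sum_i (v0 i + \sum_j v j i * sg x j) ^+ 2 <= rho)
    <= 64 * (k.*2.+1)%:R / w%:R.
Proof.
move=> r0 rho0 vr w0 wG rhok.
pose S x i := v0 i + \sum_j v j i * sg x j.
pose a (g : {ffun K -> bool}) j := \sum_i v j i * sg g i.
pose c (g : {ffun K -> bool}) := \sum_i v0 i * sg g i.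
pose D g := [set j in G | r / 2 <= `|a g j|].
pose B g := (w ^ 2 <= #|D g|)%N.
(* By Paley-Zygmund each [j] of [G] enters [D g] with probability at least [3 / 16], while off [B]
   at most [1 / 16] of [G] is in [D g]; the difference is [1 / 8]. *)
have prB : 1 / 8 <= pr B.
  have G0 : 0 < #|G|%:R :> R.
    by rewrite ltr0n (leq_trans _ wG) // muln_gt0 expn_gt0 w0.
  have h1 : #|G|%:R * (3 / 16) <= Ex (fun g => #|D g|%:R) :> R.
    rewrite (eq_Ex (g := fun g => \sum_(j in G) (r / 2 <= `|a g j|)%R%:R)); last first.
      move=> g; rewrite -sum1_card natr_sum big_mkcond /= [RHS]big_mkcond /=.
      by apply: eq_bigr => j _; rewrite inE; case: (j \in G) => //=; case: lerP.
    rewrite Ex_sum mulr_natl -sumr_const; apply: ler_sum => j jG.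
    apply: le_trans (sign_sum_large (v j)) _; apply: pr_le => g.
    rewrite -mulr_suml => h; rewrite -ler_sqr ?nnegrE ?divr_ge0 ?(ltW r0) //.
    rewrite real_normK ?num_real // expr_div_n; have := vr j jG; rewrite /a; lra.
  have h2 : Ex (fun g => #|D g|%:R) <= Ex (fun g => #|G|%:R * (B g)%:R + #|G|%:R / 16) :> R.
    apply: Ex_le => g; rewrite /B; case: leqP => [_|Dw] /=.
      rewrite mulr1; apply: (@le_trans _ _ #|G|%:R); last by rewrite lerDl; lra.
      by rewrite ler_nat subset_leq_card //; apply/subsetP => j; rewrite inE => /andP[].
    rewrite mulr0 add0r ler_pdivlMr // -natrM ler_nat mulnC.
    by apply: leq_trans wG; rewrite leq_pmul2l // ltnW.
  rewrite ExD ExZ Ex_cst -/(pr B) in h2.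
  have : #|G|%:R * (1 / 8) <= #|G|%:R * pr B by lra.
  by rewrite ler_pM2l.
pose A x g := (\sum_i S x i * sg g i) ^+ 2 <= 16 * rho.
have prA x : \sum_i S x i ^+ 2 <= rho -> 15 / 16 <= pr (A x).
  move=> Srho.
  have ES := Ex_sign_sum_sqrT (S x).
  have [rho_eq0|rhon0] := eqVneq rho 0.
    have S0 i : S x i = 0.
      apply/eqP; rewrite -sqrf_eq0 eq_le sqr_ge0 andbT.
      apply: (@le_trans _ _ (\sum_i S x i ^+ 2)); last by rewrite -[leRHS]rho_eq0.
      by rewrite (bigD1 i) //= lerDl; apply: sumr_ge0 => *; exact: sqr_ge0.
    rewrite (_ : pr _ = 1); first by lra.
    rewrite -[RHS](Ex_cst K 1); apply: eq_Ex => g; rewrite /A big1 ?rho_eq0 => [|i _].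
      by rewrite expr0n mulr0 lexx.
    by rewrite S0 mul0r.
  have rho_gt0 : 0 < rho by rewrite lt_neqAle eq_sym rhon0.
  have h := @markov R K (fun g => (\sum_i S x i * sg g i) ^+ 2) (16 * rho)
    (fun _ => sqr_ge0 _) (mulr_gt0 (ltr0n _ 16) rho_gt0).
  have h' : pr (fun g => ~~ A x g) <= 1 / 16.
    apply: (le_trans (pr_le _ _)); [|apply: (le_trans h)].
      by move=> g; rewrite -ltNge => /ltW.
    rewrite ES ler_pdivrMr ?mulr_gt0 //; lra.
  rewrite pr_predC in h'; lra.
(* The overlap is at least [1 / 8 + 15 / 16 - 1]. The choice of [B] is independent of [x], so the
   two expectations can be exchanged and the scalar bound used for each fixed [g]. *)
have prAB x : (\sum_i S x i ^+ 2 <= rho)%R%:R / 16 <= pr (fun g => B g && A x g).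
  case: (boolP (\sum_i S x i ^+ 2 <= rho)) => [/prA hA|_] /=; last by rewrite mul0r pr_ge0.
  have : pr B + pr (A x) <= 1 + pr (fun g => B g && A x g).
    rewrite -[leRHS](_ : Ex (fun g => 1 + (B g && A x g)%:R) = _); last by rewrite ExD Ex_cst.
    rewrite /pr -ExD; apply: Ex_le => g.
    by case: (B g); case: (A x g) => /=; lra.
  lra.
have bound g : B g -> pr (fun x => A x g) <= (k.*2.+1)%:R * (4 / w%:R).
  move=> Bg; have r20 : 0 < r / 2 by lra.
  have D1 j : j \in D g -> r / 2 <= `|a g j| by rewrite inE => /andP[].
  apply: le_trans (littlewood_offord_wide (c g) k r20 D1 w0 Bg); apply: pr_le => x.
  have kr0 : 0 <= k%:R * (r / 2) by apply: mulr_ge0 => //; exact: ltW.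
  rewrite /A -[k%:R * _](ger0_norm kr0).
  have -> : c g + \sum_j a g j * sg x j = \sum_i S x i * sg g i.
    rewrite /S /a /c [RHS](eq_bigr (fun i => v0 i * sg g i + \sum_j v j i * sg x j * sg g i)).
      rewrite [RHS]big_split [X in _ = _ + X]exchange_big /=; congr (_ + _); apply: eq_bigr => j _.
      by rewrite mulr_suml; apply: eq_bigr => i _; rewrite mulrAC.
    by move=> i _; rewrite mulrDl mulr_suml.
  move=> h; rewrite -ler_sqr ?nnegrE ?normr_ge0 // !real_normK ?num_real //.
  by rewrite !exprMn in rhok *; lra.
have : pr (fun x => \sum_i S x i ^+ 2 <= rho) / 16 <= (k.*2.+1)%:R * (4 / w%:R).
  rewrite mulrC /pr -ExZ; apply: (@le_trans _ _ (Ex (fun x => pr (fun g => B g && A x g)))).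
    by apply: Ex_le => x; rewrite mulrC.
  rewrite /pr Ex_exchange -[leRHS](Ex_cst K); apply: Ex_le => g.
  case: (boolP (B g)) => [/bound //|_] /=.
  by rewrite Ex_cst mulr_ge0 ?divr_ge0.
rewrite -/S; lra.
Qed.

Lemma pr_mix_exists (T : {set J}) (A : pred bits) x d : (#|T| <= d)%N ->
  (exists y, A (mix T x y)) -> 2 ^- d <= pr (fun y => A (mix T x y)).
Proof.
move=> Td [s As]; apply: (@le_trans _ _ (2 ^- #|T|)).
  by rewrite lef_pV2 ?posrE ?exprn_gt0 // ler_eXn2l ?ltr1n.
rewrite -(pr_agree R T s); apply: pr_le => y /forall_inP ys.
rewrite (_ : mix T x y = mix T x s) //; apply/ffunP => j; rewrite !ffunE.
by case: ifP => // /ys/eqP.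
Qed.

(** Whatever the other bits are, some pattern on the at most [d] bits of [T i] makes attempt [i]
    succeed, with chance at least [2 ^ - d]; resampling them does not disturb the other attempts, so
    the failures multiply. *)
Lemma pr_independent_attempts (r d : nat) (T : nat -> {set J}) (A : nat -> pred bits) :
  (forall i, (i < r)%N -> #|T i| <= d)%N ->
  (forall i x, (i < r)%N -> exists y, A i (mix (T i) x y)) ->
  (forall i j x y, (i < r)%N -> (j < r)%N -> i != j -> A i (mix (T j) x y) = A i x) ->
  pr (fun x => all (fun i => ~~ A i x) (iota 0 r)) <= (1 - 2 ^- d) ^+ r.
Proof.
elim: r => [|r IH] Td ex indep; first by rewrite expr0 pr_le1.
rewrite (pr_cpr R (T r)) exprSr.
apply: (@le_trans _ _ (Ex (fun x => (all (fun i => ~~ A i x) (iota 0 r))%:R * (1 - 2 ^- d)))).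
  apply: Ex_le => x; rewrite /cpr.
  apply: (@le_trans _ _ (Ex (fun y => (all (fun i => ~~ A i x) (iota 0 r))%:R *
     (~~ A r (mix (T r) x y))%:R))); last first.
    rewrite ExZ ler_wpM2l // -/(pr _) pr_predC lerD2l lerN2.
    by apply: pr_mix_exists; [exact: Td|exact: ex].
  apply: Ex_le => y; rewrite -addn1 iotaD all_cat add0n /= andbT -mulnb natrM.
  rewrite (@eq_in_all _ _ (fun i => ~~ A i x)) // => i; rewrite mem_iota add0n => /andP[_ ir].
  by rewrite indep ?(ltn_trans ir) // neq_ltn ir.
under eq_Ex do rewrite mulrC; rewrite ExZ mulrC.
have d1 : 2 ^- d <= 1 :> R by rewrite invf_le1 ?exprn_gt0 // exprn_ege1 // ler1n.
apply: ler_wpM2r; first lra.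
apply: IH => [i ir|i x ir|i j x y ir jr].
- by apply: Td; rewrite ltnS ltnW.
- by apply: ex; rewrite ltnS ltnW.
- by apply: indep; rewrite ltnS ltnW.
Qed.

Lemma Ex_indep (S : {set J}) (f g : bits -> R) :
  (forall x y, f (mix S x y) = f x) -> (forall x y, g (mix (~: S) x y) = g x) ->
  Ex (fun x => f x * g x) = Ex f * Ex g.
Proof.
move=> fS gS; rewrite -(Ex_mix S).
rewrite (eq_Ex (g := fun x => Ex g * f x)) ?ExZ 1?mulrC // => x.
rewrite mulrC -ExZ; apply: eq_Ex => y; rewrite fS -[g y](gS y x); congr (_ * g _).
by apply/ffunP => j; rewrite !ffunE inE; case: (j \in S).
Qed.
End SmallBall.

(** * Systems of linear and quadratic forms *)

Section LinearSystem.
Context (R : realFieldType) (J I0 : finType).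
Local Notation bits := {ffun J -> bool}.
Local Notation pr := (@pr R _).
Local Notation cpr := (@cpr R _).
Local Notation sg := (@sg R _).
Implicit Types (x y : bits).

Lemma card_setE (I : finType) (A : {set I}) (P : pred I) :
  #|[set i in A | P i]|%:R = \sum_(i in A) (P i)%:R :> R.
Proof.
rewrite -sum1_card natr_sum big_mkcond /= [RHS]big_mkcond /=.
by apply: eq_bigr => i _; rewrite inE; case: (i \in A) => //=; case: (P i).
Qed.

(** Events reading disjoint bits are uncorrelated and any other pair costs at most 1, so [D] bounds
    the variance of the count. Falling below a quarter of [IC] is a deviation of a quarter from a
    mean of at least a half. *)
Lemma chebyshev_system (IC : {set I0}) (Y : I0 -> pred bits) (dep : I0 -> {set J}) (D : R) :
  (forall i x y, i \in IC -> Y i (mix (~: dep i) x y) = Y i x) ->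
  (forall i, i \in IC -> 1 / 2 <= pr (Y i)) ->
  \sum_(i in IC) \sum_(k in IC) (~~ [disjoint dep i & dep k])%:R <= D ->
  pr (fun x => 4 * (#|[set i in IC | Y i x]|)%:R < (#|IC|)%:R :> R) <= 16 * D / (#|IC|)%:R ^+ 2.
Proof.
move=> Ydep Yhalf depD; set m : R := #|IC|%:R.
have D0 : 0 <= D by apply: le_trans depD; apply: sumr_ge0 => i _; apply: sumr_ge0.
have [m0|mn0] := eqVneq m 0.
  rewrite pr_eq0 => [|x]; first by rewrite m0 expr0n invr0 mulr0.
  by rewrite m0 -leNgt mulr_ge0.
have m_gt0 : 0 < m by rewrite lt_neqAle eq_sym mn0 ler0n.
pose y i x : R := (Y i x)%:R; pose p i := Ex (fun x => y i x); pose mu := \sum_(i in IC) p i.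
pose f x := \sum_(i in IC) y i x.
have mum : m / 2 <= mu.
  rewrite /m -sum1_card natr_sum mulr_suml; apply: ler_sum => i iC; exact: Yhalf.
have var : Ex (fun x => (f x - mu) ^+ 2) <= D.
  rewrite (eq_Ex (g := fun x => \sum_(i in IC) \sum_(k in IC) (y i x - p i) * (y k x - p k))).
    apply: le_trans depD; rewrite Ex_sum; apply: ler_sum => i iC.
    rewrite Ex_sum; apply: ler_sum => k kC.
    rewrite (eq_Ex (g := fun x => y i x * y k x + (- p k * y i x + (- p i * y k x + p i * p k)))).
      rewrite !ExD (Ex_cst _ (p i * p k)) !ExZ -/(p i) -/(p k).
      have p01 j : 0 <= p j by exact: pr_ge0.
      case: (boolP [disjoint dep i & dep k]) => ik /=.
        have -> : Ex (fun x => y i x * y k x) = p i * p k; last by lra.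
        apply: (Ex_indep (S := ~: dep i)); first by move=> x z; rewrite /y Ydep.
        move=> x z; rewrite setCK /y -(Ydep k (mix (dep i) x z) x kC) -(Ydep k x x kC).
        congr (_%:R); congr nat_of_bool; congr (Y k _); apply/ffunP => j; rewrite !ffunE !inE.
        case: (boolP (j \in dep k)) => //= jk; case: (boolP (j \in dep i)) => //= ji.
        by move/pred0P: ik => /(_ j); rewrite /= ji jk.
      have : Ex (fun x => y i x * y k x) <= 1.
        rewrite -[leRHS](Ex_cst J); apply: Ex_le => x; rewrite /y.
        by case: (Y i x); case: (Y k x); rewrite ?mulr0 ?mul0r ?mulr1.
      have := mulr_ge0 (p01 i) (p01 k); lra.
    by move=> x; ring.
  move=> x; rewrite /f /mu -sumrB expr2 mulr_suml; apply: eq_bigr => i _.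
  by rewrite mulr_sumr.
apply: (@le_trans _ _ (pr (fun x => (m / 4) ^+ 2 <= (f x - mu) ^+ 2))).
  apply: pr_le => x; rewrite card_setE -/(f x) => fm.
  rewrite -[leRHS]sqrrN ler_sqr ?nnegrE; lra.
apply: le_trans (markov _ _) _ => [x||]; [exact: sqr_ge0|by rewrite exprn_gt0 ?divr_gt0|].
rewrite ler_pdivrMr ?exprn_gt0 ?divr_gt0 //.
by rewrite (_ : 16 * D / m ^+ 2 * (m / 4) ^+ 2 = D) //; field.
Qed.

(** Dichotomy on the number of coefficients of size at least [kap]. If half of the forms have at
    least [w^2] of them, Littlewood-Offord and Markov suffice. Otherwise most forms essentially
    depend on few coordinates: the coordinates [H] shared by at least [w^4] of these forms are few
    and are frozen; the forms with [a i] outside [H] then have few overlaps, and Chebyshev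
    applies. *)
Lemma linear_system (I : {set I0}) (q : I0 -> J -> R) (c : I0 -> R) (a : I0 -> J) (lam : R)
    (w : nat) : 0 < lam -> {in I &, injective a} ->
  (forall i, i \in I -> lam <= `|q i (a i)|) -> (2 <= w)%N ->
  pr (fun x => (16 * #|[set i in I | (lam / (2 * #|J|%:R) <= `|c i + \sum_j q i j * sg x j|)%R]|
                < #|I|)%N) <= 8 / w%:R + 256 * w%:R ^+ 6 / #|I|%:R.
Proof.
move=> lam0 a_inj qa w2; set m := #|I|; set N : R := #|J|%:R.
have w0 : (0 < w)%N by rewrite ltnW.
have wR : 0 < w%:R :> R by rewrite ltr0n.
have [m0|m_gt0] := posnP m.
  rewrite pr_eq0 => [|x]; last by rewrite m0.
  by rewrite addr_ge0 // ?divr_ge0 // mulr_ge0 // exprn_ge0.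
have mR : 0 < m%:R :> R by rewrite ltr0n.
have N1 : 1 <= N.
  rewrite ler1n; move: m_gt0; rewrite card_gt0 => /set0Pn[i _].
  by apply/card_gt0P; exists (a i).
pose kap := lam / (2 * N); have kap0 : 0 < kap by rewrite divr_gt0 // mulr_gt0 //; lra.
have kapN : N * kap = lam / 2 by rewrite /kap; field; lra.
have kap_lam : kap <= lam / 2 by rewrite -kapN ler_peMl // ltW.
pose ell i x := c i + \sum_j q i j * sg x j.
pose L i := [set j | kap <= `|q i j|].
have aL i : i \in I -> a i \in L i by move=> /qa h; rewrite inE; lra.
pose good x := [set i in I | kap <= `|ell i x|].
rewrite -/kap; change (pr (fun x => (16 * #|good x| < m)%N) <= 8 / w%:R + 256 * w%:R ^+ 6 / m%:R).
have [A_ge0 B_ge0] : 0 <= 8 / w%:R :> R /\ 0 <= 256 * w%:R ^+ 6 / m%:R :> R.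
  by rewrite !divr_ge0 ?mulr_ge0 ?exprn_ge0.
pose IA := [set i in I | (w ^ 2 <= #|L i|)%N].
have IAI : IA \subset I by apply/subsetP => i; rewrite inE => /andP[].
have [big|small] := leqP m (2 * #|IA|)%N.
  apply: le_trans (_ : _ <= 8 / w%:R) _; last by rewrite lerDl.
  have IA0 : 0 < #|IA|%:R :> R.
    by rewrite ltr0n -(ltn_pmul2l (isT : (0 < 2)%N)) muln0 (leq_trans m_gt0).
  pose f x : R := \sum_(i in IA) (`|ell i x| < kap)%R%:R.
  apply: (@le_trans _ _ (pr (fun x => #|IA|%:R / 2 <= f x))).
    apply: pr_le => x goodm; rewrite /f -card_setE.
    have : (#|IA| <= #|good x| + #|[set i in IA | (`|ell i x| < kap)%R]|)%N.
      rewrite -(cardsID (good x) IA) leq_add ?subset_leq_card //; first exact: subsetIr.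
      apply/subsetP => i; rewrite !inE => /andP[ng /andP[iI ->]]; rewrite iI /=.
      by rewrite iI /= -ltNge in ng.
    move=> h; rewrite ler_pdivrMr // -natrM ler_nat.
    by move: goodm h big; clear; lia.
  apply: le_trans (markov _ _) _ => [x||]; [exact: sumr_ge0|by rewrite divr_gt0|].
  rewrite ler_pdivrMr ?divr_gt0 // /f Ex_sum.
  apply: (@le_trans _ _ (\sum_(i in IA) (4 / w%:R))).
    apply: ler_sum => i; rewrite inE => /andP[_ Li].
    by apply: (littlewood_offord (c i) kap0 _ w0 Li) => j; rewrite inE.
  by rewrite sumr_const -mulr_natl; lra.
apply: le_trans (_ : _ <= 256 * w%:R ^+ 6 / m%:R) _; last by rewrite lerDr.
pose IB := I :\: IA.
have IBI : IB \subset I by exact: subsetDl.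
have IB2 : (m < 2 * #|IB|)%N.
  by have := cardsID IA I; rewrite -/IB (setIidPr IAI) -/m; move: small; clear; lia.
have LB i : i \in IB -> (#|L i| <= w ^ 2)%N.
  by rewrite !inE => /andP[+ iI]; rewrite iI /= -ltnNge => /ltnW.
pose e j := (\sum_(i in IB) (j \in L i))%N.
have sum_e : (\sum_j e j <= m * w ^ 2)%N.
  rewrite /e exchange_big /= -sum_nat_const.
  apply: (@leq_trans (\sum_(i in IB) w ^ 2)).
    apply: leq_sum => i /LB; rewrite -sum1_card [X in (X <= _)%N -> _]big_mkcond /=.
    by apply: leq_trans; apply: leq_sum => j _; case: (j \in L i).
  by rewrite !sum_nat_const leq_mul2r subset_leq_card ?orbT.
pose H := [set j | (w ^ 4 <= e j)%N].
have H4 : (4 * #|H| <= m)%N.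
  have w24 : (4 <= w ^ 2)%N by rewrite -[4%N]/(2 ^ 2)%N leq_exp2r.
  have : (#|H| * w ^ 4 <= m * w ^ 2)%N.
    apply: leq_trans sum_e; rewrite -sum_nat_const [X in (X <= _)%N]big_mkcond /=.
    by apply: leq_sum => j _; case: ifP => //; rewrite inE.
  have -> : (w ^ 4 = w ^ 2 * w ^ 2)%N by rewrite -expnD.
  rewrite mulnA leq_pmul2r ?expn_gt0 ?w0 //.
  by apply: leq_trans; rewrite mulnC leq_mul2l w24 orbT.
pose IC := [set i in IB | a i \notin H].
have IC4 : (m <= 4 * #|IC|)%N.
  have : (#|IB :\: IC| <= #|H|)%N.
    have inj : {in IB :\: IC &, injective a}.
      by move=> i k; rewrite !inE => /andP[_ /andP[_ iI]] /andP[_ /andP[_ kI]]; exact: a_inj.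
    rewrite -(card_in_imset inj); apply/subset_leq_card/subsetP => _ /imsetP[i + ->].
    by rewrite !inE => /andP[+ /andP[h1 h2]]; rewrite h1 h2 /= negbK.
  have ICB : IC \subset IB by apply/subsetP => i; rewrite inE => /andP[].
  by have := cardsID IC IB; rewrite (setIidPr ICB); move: IB2 H4; clear; lia.
rewrite (pr_cpr R (~: H)) -[leRHS](Ex_cst J); apply: Ex_le => x; rewrite /cpr.
pose Y i y := lam <= `|c i + \sum_(j in L i) q i j * sg (mix (~: H) x y) j|.
have ICI i : i \in IC -> i \in I by rewrite !inE => /andP[/andP[]].
apply: (@le_trans _ _ (pr (fun y => 4 * #|[set i in IC | Y i y]|%:R < #|IC|%:R :> R))).
  apply: pr_le => y; set z := mix _ _ _ => goodm.
  rewrite -natrM ltr_nat; suff : (#|[set i in IC | Y i y]| <= #|good z|)%N by move: goodm IC4; clear; lia.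
  apply/subset_leq_card/subsetP => i; rewrite !inE => /andP[/andP[/andP[_ ->] _] /= Yi].
  (* [kap] is chosen so that all the small coefficients together contribute at most [lam / 2]; a
     truncated form of size [lam] thus leaves a full form of size [lam / 2]. *)
  move: Yi; rewrite /Y /ell -/z (bigID (mem (L i)) predT) /=.
  set s := \sum_(j in L i) _; set t := \sum_(j | _) _ => ls.
  have : `|t| <= lam / 2.
    rewrite -kapN /N -sum1_card natr_sum mulr_suml (le_trans (ler_norm_sum _ _ _)) //.
    rewrite big_mkcond /=; apply: ler_sum => j _; case: ifP => //; last by rewrite mul1r ltW.
    by rewrite inE -ltNge normrM norm_sg mulr1 mul1r => /ltW.
  have := ler_normB (c i + s + t) t; rewrite addrK addrA; lra.
apply: le_trans (@chebyshev_system IC Y (fun i => L i :\: H) (m%:R * w%:R ^+ 6) _ _ _) _.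
- move=> i y z iC; rewrite /Y; congr (_ <= `|_ + _|); apply: eq_bigr => j jL.
  congr (_ * _); rewrite /sg !ffunE in_setC in_setC in_setD jL.
  by case: (j \in H).
- move=> i iC; have aH : a i \notin H by move: iC; rewrite in_set => /andP[].
  (* Flipping the bit [a i], which is not frozen, changes the truncated form by at least [2 * lam],
     so one of the two values has modulus at least [lam]. *)
  have : 1 <= Ex (fun y => (Y i y)%:R) + Ex (fun y => (Y i (flip (a i) y))%:R) :> R.
    rewrite -ExD -[leLHS](Ex_cst J); apply: Ex_le => y.
    suff : Y i y || Y i (flip (a i) y) by case: (Y i y); case: (Y i (flip _ _)) => //= _; lra.
    have zE : mix (~: H) x (flip (a i) y) = flip (a i) (mix (~: H) x y).
      apply/ffunP => j; rewrite !ffunE in_setC; case: eqP => [->|_]; first by rewrite aH.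
      by rewrite !addbF.
    rewrite /Y zE; move: (mix _ _ _) => z; have aLi := aL _ (ICI _ iC).
    rewrite !(bigD1 (a i) aLi) /=.
    have -> : \sum_(j in L i | j != a i) q i j * sg (flip (a i) z) j
        = \sum_(j in L i | j != a i) q i j * sg z j.
      by apply: eq_bigr => j /andP[_ /negbTE ji]; rewrite sg_flip ji.
    rewrite sg_flip eqxx; set s := \sum_(j | _) _; have := qa _ (ICI _ iC); set qi := q i (a i) => qil.
    rewrite mulrN; have : lam <= `|qi * sg z (a i)| by rewrite normrM norm_sg mulr1.
    set t := qi * _ => lt; case: (lerP lam `|c i + (t + s)|) => //=.
    rewrite ltr_norml => /andP[h1 h2]; rewrite leNgt ltr_norml; apply/negP => /andP[h3 h4].
    by move: lt; rewrite ler_normr => /orP[]; lra.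
  rewrite [X in _ + X](Ex_flip (a i) (fun y => (Y i y)%:R)) -/(pr (Y i)); lra.
- have ICsub : IC \subset IB by apply/subsetP => i; rewrite inE => /andP[].
  (* Overlapping pairs are counted by a common coordinate outside [H]. The count is the sum of
     [e j ^ 2], and [e j < w ^ 4] there while the [e j] sum to at most [m * w ^ 2]. *)
  apply: (@le_trans _ _ (\sum_(i in IB) \sum_(k in IB) \sum_(j in ~: H)
     ((j \in L i)%:R * (j \in L k)%:R))).
    rewrite big_mkcond [leRHS]big_mkcond; apply: ler_sum => i _.
    case: (boolP (i \in IC)) => [/(subsetP ICsub) ->|_]; last first.
      by case: ifP => // _; do 2!apply: sumr_ge0 => ? _; exact: mulr_ge0.
    rewrite big_mkcond [leRHS]big_mkcond; apply: ler_sum => k _.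
    case: (boolP (k \in IC)) => [/(subsetP ICsub) ->|_]; last first.
      by case: ifP => // _; apply: sumr_ge0 => ? _; exact: mulr_ge0.
    case: (boolP [disjoint _ & _]) => [_|/pred0Pn[j /=]] /=.
      by apply: sumr_ge0 => ? _; exact: mulr_ge0.
    rewrite !inE => /andP[/andP[jH ji] /andP[_ jk]].
    rewrite (bigD1 j) /=; last by rewrite !inE.
    by rewrite !inE ji jk mulr1 lerDl; apply: sumr_ge0 => ? _; exact: mulr_ge0.
  rewrite (eq_bigr (fun i => \sum_(j in ~: H) (j \in L i)%:R * (e j)%:R)); last first.
    move=> i _; rewrite exchange_big /=; apply: eq_bigr => j _.
    by rewrite /e natr_sum mulr_sumr.
  rewrite exchange_big /=.
  apply: (@le_trans _ _ (\sum_j (e j)%:R * w%:R ^+ 4)); last first.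
    rewrite -mulr_suml -natr_sum -!natrX -!natrM ler_nat -[6%N]/(2 + 4)%N expnD mulnA.
    by rewrite leq_mul2r sum_e orbT.
  rewrite big_mkcond; apply: ler_sum => j _; case: ifP => jH; last by rewrite mulr_ge0 // exprn_ge0.
  rewrite -mulr_suml -natr_sum -/(e j) -natrX -!natrM ler_nat leq_mul2l ltnW ?orbT //.
  by move: jH; rewrite !inE -ltnNge.
have IC0 : 0 < #|IC|%:R :> R by rewrite ltr0n; move: IC4 m_gt0; clear; lia.
rewrite ler_pdivrMr ?exprn_gt0 // mulrAC ler_pdivlMr //.
have IC4R : m%:R <= 4 * #|IC|%:R :> R by rewrite -natrM ler_nat.
rewrite (_ : 16 * _ * _ = w%:R ^+ 6 * (16 * m%:R ^+ 2)); last by ring.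
rewrite (_ : 256 * _ * _ = w%:R ^+ 6 * (16 * (4 * #|IC|%:R) ^+ 2)); last by ring.
rewrite ler_pM2l ?exprn_gt0 // ler_pM2l // ler_sqr ?nnegrE //.
by rewrite mulr_ge0.
Qed.
End LinearSystem.

Section QuadraticSystem.
Context (R : realFieldType) (J I0 : finType).
Local Notation bits := {ffun J -> bool}.
Local Notation pr := (@pr R _).
Local Notation sg := (@sg R _).
Implicit Types (x y z : bits).

Lemma Ex_cauchy_schwarz (S : {set J}) (f : bits -> R) :
  Ex f ^+ 2 <= Ex (fun x => Ex (fun y => f x * f (mix S x y))).
Proof.
rewrite -[in leLHS](Ex_mix S); apply: le_trans (Ex_sqr_le _) _.
rewrite -[leRHS](Ex_mix S); apply: Ex_le => x.
rewrite expr2 -ExZ; apply: Ex_le => y; rewrite mulrC -ExZ; apply: Ex_le => z.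
by rewrite mix_mix.
Qed.

(** Cauchy-Schwarz once for each of [P] and [Q]. The four events are the corners of a box obtained
    by resampling [P], [Q], both or neither. *)
Lemma pr_box (P Q : {set J}) (E : pred bits) :
  pr E ^+ 4 <= Ex (fun x => Ex (fun y => pr (fun z =>
    [&& E x, E (mix P x y), E (mix Q x z) & E (mix P (mix Q x z) y)]))).
Proof.
pose f x : R := (E x)%:R.
rewrite -[4%N]/(2 * 2)%N exprM.
apply: (@le_trans _ _ (Ex (fun x => Ex (fun y => f x * f (mix P x y))) ^+ 2)).
  rewrite ler_sqr ?nnegrE ?sqr_ge0 //; first exact: Ex_cauchy_schwarz.
  by do 2!apply: Ex_ge0 => ?; exact: mulr_ge0.
rewrite Ex_exchange [leRHS]Ex_exchange; apply: le_trans (Ex_sqr_le _) _.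
apply: Ex_le => y; apply: le_trans (Ex_cauchy_schwarz Q _) _.
apply: Ex_le => x; apply: Ex_le => z; rewrite /f -!natrM !mulnb ler_nat.
by case: (E x); case: (E _); case: (E _); case: (E _).
Qed.

(* Decoupling: the box norm reduces the quadratic forms to the forms bilinear in
   [P = a @: I] and [Q = b @: I], to which [linear_system] applies twice. *)
Lemma quadratic_system (I : {set I0}) (l : I0 -> J -> R) (C : I0 -> J -> J -> R)
    (a b : I0 -> J) (lam : R) (w : nat) : 0 < lam ->
  {in I &, injective a} -> {in I &, injective b} ->
  (forall i k, i \in I -> k \in I -> a i != b k) ->
  (forall i, i \in I -> lam <= `|C i (a i) (b i) + C i (b i) (a i)|) -> (2 <= w)%N ->
  pr (fun x => (1024 * #|[set i in I | (lam / (16 * #|J|%:R ^+ 2) <=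
      `|\sum_j l i j * sg x j + \sum_j \sum_k C i j k * sg x j * sg x k|)%R]|
       < #|I|)%N) ^+ 4 <= 16 / w%:R + 4352 * w%:R ^+ 6 / #|I|%:R.
Proof.
move=> lam0 a_inj b_inj ab Cl w2; set m := #|I|; set N : R := #|J|%:R.
have [m0|m_gt0] := posnP m.
  rewrite pr_eq0 => [|x]; last by rewrite m0.
  by rewrite expr0n addr_ge0 // ?divr_ge0 // mulr_ge0 // exprn_ge0.
have mR : 0 < m%:R :> R by rewrite ltr0n.
have wR : 0 < w%:R :> R by rewrite ltr0n ltnW.
have N1 : 1 <= N.
  rewrite ler1n; move: m_gt0; rewrite card_gt0 => /set0Pn[i _].
  by apply/card_gt0P; exists (a i).
have N0 : 0 < N by lra.
pose P := a @: I; pose Q := b @: I.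
have PQ j : j \in P -> j \in Q -> False.
  by move=> /imsetP[i iI ->] /imsetP[k kI] abE; move: (ab i k iI kI); rewrite abE eqxx.
pose f i x := \sum_j l i j * sg x j + \sum_j \sum_k C i j k * sg x j * sg x k.
(* The alternating sum over the box kills the linear part and every product that does not join [P]
   to [Q], as these sets are disjoint. *)
pose D i x y z := f i x - f i (mix P x y) - f i (mix Q x z) + f i (mix P (mix Q x z) y).
pose B i j k := if (j \in P) && (k \in Q) then C i j k + C i k j else 0.
have DE i x y z : D i x y z =
    \sum_k (\sum_j B i j k * (sg x j - sg y j)) * (sg x k - sg z k).
  have sgE S u v j : sg (mix S u v) j = if j \in S then sg v j else sg u j.
    by rewrite /sg ffunE; case: (j \in S).
  rewrite /D /f (_ : _ - _ - _ + _ =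
     (\sum_j (l i j * sg x j - l i j * sg (mix P x y) j - l i j * sg (mix Q x z) j
       + l i j * sg (mix P (mix Q x z) y) j)) +
     \sum_j \sum_k (C i j k * sg x j * sg x k - C i j k * sg (mix P x y) j * sg (mix P x y) k
       - C i j k * sg (mix Q x z) j * sg (mix Q x z) k
       + C i j k * sg (mix P (mix Q x z) y) j * sg (mix P (mix Q x z) y) k)); last first.
    rewrite [X in _ = _ + X](eq_bigr (fun j => \sum_k C i j k * sg x j * sg x k
       - \sum_k C i j k * sg (mix P x y) j * sg (mix P x y) k
       - \sum_k C i j k * sg (mix Q x z) j * sg (mix Q x z) k
       + \sum_k C i j k * sg (mix P (mix Q x z) y) j * sg (mix P (mix Q x z) y) k)).
      by rewrite !(big_split, sumrN) /=; ring.
    by move=> j _; rewrite !(big_split, sumrN).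
  rewrite big1 ?add0r => [|j _]; last first.
    rewrite !sgE; have jPQ := @PQ j.
    case: (boolP (j \in P)) jPQ => jP; case: (boolP (j \in Q)) => jQ jPQ /=;
    by [case: (jPQ isT isT) | ring].
  rewrite (eq_bigr (fun j => \sum_k ((if (j \in P) && (k \in Q) then
      C i j k * (sg x j - sg y j) * (sg x k - sg z k) else 0) +
      (if (k \in P) && (j \in Q) then C i j k * (sg x k - sg y k) * (sg x j - sg z j) else 0)))).
    rewrite (eq_bigr _ (fun j _ => big_split _ _ _ _ _)) big_split /=.
    rewrite exchange_big -big_split /=; apply: eq_bigr => k _.
    rewrite -big_split mulr_suml; apply: eq_bigr => j _; rewrite /B.
    case: ifP => _ /=; ring.
  move=> j _; apply: eq_bigr => k _; rewrite !sgE.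
  have jPQ := @PQ j; have kPQ := @PQ k.
  case: (boolP (j \in P)) jPQ => jP; case: (boolP (j \in Q)) => jQ jPQ /=;
  case: (boolP (k \in P)) kPQ => kP; case: (boolP (k \in Q)) => kQ kPQ /=;
  by [case: (jPQ isT isT) | case: (kPQ isT isT) | ring].
(* Up to sign, [g] is the coefficient of the bit [b i] of [z] in [D]. The first application makes it
   large by the choice of [y]; it is then the distinguished coefficient of the second, in [z]. *)
pose g i x y := \sum_j B i j (b i) * (sg x j - sg y j).
pose kap := lam / (2 * N); have kap0 : 0 < kap by rewrite divr_gt0 ?mulr_gt0.
pose I1 x y := [set i in I | kap <= `|g i x y|].
have stage1 x : pr (fun y => (16 * #|I1 x y| < m)%N) <= 8 / w%:R + 256 * w%:R ^+ 6 / m%:R.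
  have own i : i \in I -> lam <= `|- B i (a i) (b i)|.
    by move=> iI; rewrite normrN /B !imset_f // Cl.
  have := linear_system (q := fun i j => - B i j (b i))
     (fun i => \sum_j B i j (b i) * sg x j) lam0 a_inj own w2.
  apply: le_trans; apply: pr_le => y; rewrite /I1 /g -/N -/kap.
  congr (16 * _ < _)%N; apply: eq_card => i; rewrite !inE; congr (_ && (_ <= `|_|)).
  by rewrite -big_split; apply: eq_bigr => j _ /=; ring.
have stage2 x y : (m <= 16 * #|I1 x y|)%N ->
    pr (fun z => (16 * #|[set i in I1 x y | (kap / (2 * N) <= `|D i x y z|)%R]| < #|I1 x y|)%N)
    <= 8 / w%:R + 4096 * w%:R ^+ 6 / m%:R.
  move=> mI1.
  have b_inj1 : {in I1 x y &, injective b}.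
    by move=> i k; rewrite !inE => /andP[iI _] /andP[kI _]; exact: b_inj.
  have own i : i \in I1 x y -> kap <= `|- (\sum_j B i j (b i) * (sg x j - sg y j))|.
    by rewrite inE normrN => /andP[].
  have := linear_system (q := fun i k => - (\sum_j B i j k * (sg x j - sg y j)))
     (fun i => \sum_k (\sum_j B i j k * (sg x j - sg y j)) * sg x k) kap0 b_inj1 own w2.
  move=> h; apply: (@le_trans _ _ (8 / w%:R + 256 * w%:R ^+ 6 / #|I1 x y|%:R)).
    apply: le_trans h; apply: pr_le => z; rewrite -/N.
    congr (16 * _ < _)%N; apply: eq_card => i; rewrite !in_set; congr (_ && (_ <= `|_|)).
    by rewrite DE -big_split; apply: eq_bigr => k _ /=; ring.
  have I10 : 0 < #|I1 x y|%:R :> R.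
    by rewrite ltr0n; move: mI1 m_gt0; clear; lia.
  rewrite lerD2l ler_pdivrMr // mulrAC ler_pdivlMr //.
  rewrite (_ : 4096 * _ * _ = 256 * w%:R ^+ 6 * (16 * #|I1 x y|%:R)); last by ring.
  by rewrite ler_pM2l ?mulr_gt0 ?exprn_gt0 // -natrM ler_nat.
apply: le_trans (pr_box P Q _) _.
pose F x y z := (16 * #|[set i in I1 x y | (kap / (2 * N) <= `|D i x y z|)%R]| < #|I1 x y|)%N.
pose tau := lam / (16 * N ^+ 2).
pose T x := [set i in I | tau <= `|f i x|].
have tauE : kap / (2 * N) = 4 * tau by rewrite /kap /tau; field; lra.
(* If [D] is at least [4 * tau], one of its four terms is at least [tau]. Each linear step keeps a
   sixteenth of the indices, and [1024 = 16 * 16 * 4]. *)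
have cover x y z : (1024 * #|T x| < m)%N -> (1024 * #|T (mix P x y)| < m)%N ->
    (1024 * #|T (mix Q x z)| < m)%N -> (1024 * #|T (mix P (mix Q x z) y)| < m)%N ->
    (16 * #|I1 x y| < m)%N || F x y z.
  move=> h1 h2 h3 h4; rewrite -[X in X || _]negbK -implybE -leqNgt; apply/implyP => I1m.
  have : (#|[set i in I1 x y | (kap / (2 * N) <= `|D i x y z|)%R]| <=
     #|T x| + #|T (mix P x y)| + #|T (mix Q x z)| + #|T (mix P (mix Q x z) y)|)%N.
    apply: (@leq_trans #|T x :|: T (mix P x y) :|: T (mix Q x z) :|: T (mix P (mix Q x z) y)|).
      apply/subset_leq_card/subsetP => i; rewrite !in_set => /andP[/andP[-> _]] /=.
      rewrite tauE /D; apply: contraTT; rewrite !negb_or -!ltNge => /andP[/andP[/andP[]]].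
      rewrite !ltr_norml => /andP[? ?] /andP[? ?] /andP[? ?] /andP[? ?].
      by apply/andP; split; lra.
    apply: leq_trans (leq_card_setU _ _) _; rewrite leq_add2r.
    apply: leq_trans (leq_card_setU _ _) _; rewrite leq_add2r.
    exact: leq_card_setU.
  by rewrite /F; move: h1 h2 h3 h4 I1m; clear; lia.
apply: (@le_trans _ _ (Ex (fun x => Ex (fun y => (16 * #|I1 x y| < m)%N%:R +
    (8 / w%:R + 4096 * w%:R ^+ 6 / m%:R))))).
  apply: Ex_le => x; apply: Ex_le => y.
  case: (ltnP (16 * #|I1 x y|)%N m) => I1m /=.
    apply: le_trans (pr_le1 _ _) _; rewrite lerDl addr_ge0 ?divr_ge0 //.
    by rewrite mulr_ge0 // exprn_ge0.
  rewrite add0r; apply: le_trans (stage2 x y I1m); apply: pr_le => z /and4P[h1 h2 h3 h4].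
  by have := cover x y z h1 h2 h3 h4; rewrite ltnNge I1m.
rewrite -[leRHS](Ex_cst J); apply: Ex_le => x; rewrite ExD Ex_cst.
have := stage1 x; rewrite /pr => h; apply: le_trans (lerD h (lexx _)) _.
by rewrite le_eqVlt; apply/orP; left; apply/eqP; field; rewrite !gt_eqF.
Qed.
End QuadraticSystem.

(** * Permanents of submatrices *)

Section SubPermanent.
Context (R : comNzRingType) (V : finType).
Implicit Types (A : V -> V -> R) (T B : {set V}) (s : seq V).

(** Laplace expansion along the listed rows; [pm_seq_perm] makes the order irrelevant, so that a
    minor can be expanded along any of its rows. *)
Fixpoint pm_seq A s B : R :=
  if s is r :: s' then \sum_(b in B) A r b * pm_seq A s' (B :\ b) else (B == set0)%:R.

(* Permanent of the submatrix with rows [T] and columns [B], which is 0 if #|T| != #|B|. *)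
Definition pm A T B : R := pm_seq A (enum T) B.

Lemma pm_seq_swap A r1 r2 s B : pm_seq A [:: r1, r2 & s] B = pm_seq A [:: r2, r1 & s] B.
Proof.
rewrite /=; under eq_bigr do rewrite mulr_sumr.
under [RHS]eq_bigr do rewrite mulr_sumr.
rewrite (exchange_big_dep (mem B)) /=; last by move=> i j _; rewrite inE => /andP[].
apply: eq_bigr => j jB; apply: eq_big => [i|i _].
  by rewrite !inE jB andbT andbC eq_sym.
by rewrite !setDDl setUC mulrCA.
Qed.

Lemma pm_seq_front A s1 s2 x B : pm_seq A (s1 ++ x :: s2) B = pm_seq A (x :: s1 ++ s2) B.
Proof.
elim: s1 B => //= y s1 IH B; rewrite -[RHS]pm_seq_swap /=.
by apply: eq_bigr => b _; rewrite IH.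
Qed.

Lemma pm_seq_perm A s1 s2 B : perm_eq s1 s2 -> pm_seq A s1 B = pm_seq A s2 B.
Proof.
elim: s1 s2 B => [|x s1 IH] s2 B; first by rewrite perm_sym => /perm_nilP ->.
move=> s12; have : x \in s2 by rewrite -(perm_mem s12) mem_head.
move=> /path.splitPr xs; case: xs s12 => t1 t2.
rewrite perm_sym perm_catC /= perm_cons perm_sym => s12.
rewrite pm_seq_front /=; apply: eq_bigr => b _; congr (_ * _); apply: IH.
by rewrite perm_sym perm_catC perm_sym.
Qed.

Lemma pm_set0 A B : pm A set0 B = (B == set0)%:R.
Proof. by rewrite /pm enum_set0. Qed.

Lemma pm_row A T B v : v \notin T ->
  pm A (v |: T) B = \sum_(b in B) A v b * pm A T (B :\ b).
Proof.
move=> vT; rewrite /pm (@pm_seq_perm _ _ (v :: enum T)) //.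
apply: uniq_perm; rewrite /= ?enum_uniq ?mem_enum ?vT // => x.
by rewrite mem_enum !inE mem_enum.
Qed.

Lemma setU1D1 (T : {set V}) u i : u != i -> (u |: T) :\ i = u |: (T :\ i).
Proof.
by move=> ui; apply/setP => x; rewrite !inE; have [->|_] := eqVneq x u; rewrite ?ui.
Qed.

(** By induction on the number of rows: expand along one row [u]; either [u] takes the column [v],
    or the smaller minor still contains [v] and is expanded along it. *)
Lemma pm_col A T B v : v \notin B ->
  pm A T (v |: B) = \sum_(i in T) A i v * pm A (T :\ i) B.
Proof.
elim: {T}#|T| {-2}T (erefl #|T|) B => [|k IH] T Tk B vB.
  move/eqP: Tk; rewrite cards_eq0 => /eqP ->; rewrite pm_set0 big_set0.
  by rewrite -subset0 subUset sub1set inE.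
have /card_gt0P[u uT] : (0 < #|T|)%N by rewrite Tk.
have uD : u \notin T :\ u by rewrite !inE eqxx.
have TuE : T = u |: (T :\ u) by rewrite setD1K.
have Tuk : #|T :\ u| = k by move: Tk; rewrite (cardsD1 u) uT add1n => -[].
rewrite [in LHS]TuE pm_row // big_setU1 //= [RHS](big_setD1 u) //=; congr (_ + _).
  by rewrite setU1K.
rewrite (eq_bigr (fun b => \sum_(i in T :\ u) A u b * (A i v * pm A (T :\ u :\ i) (B :\ b)))).
  rewrite exchange_big /=; apply: eq_bigr => i; rewrite !inE => /andP[iu iT].
  have -> : T :\ i = u |: (T :\ u :\ i) by rewrite -setU1D1 1?eq_sym // setD1K.
  rewrite pm_row ?mulr_sumr; last by rewrite !inE eqxx andbF.
  by apply: eq_bigr => b _; rewrite mulrCA.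
move=> b bB; rewrite setU1D1; last by apply: contraNneq vB => ->.
by rewrite IH // ?mulr_sumr // !inE negb_and vB orbT.
Qed.

Lemma pm_tr A T B : pm A T B = pm (fun i j => A j i) B T.
Proof.
elim: {T}#|T| {-2}T (erefl #|T|) B => [|k IH] T Tk B.
  move/eqP: Tk; rewrite cards_eq0 => /eqP ->; rewrite pm_set0.
  case: eqP => [->|/eqP/set0Pn[v vB]]; first by rewrite pm_set0 eqxx.
  by rewrite -(setD1K vB) pm_row ?big_set0 // !inE eqxx.
have /card_gt0P[u uT] : (0 < #|T|)%N by rewrite Tk.
have uD : u \notin T :\ u by rewrite !inE eqxx.
have Tuk : #|T :\ u| = k by move: Tk; rewrite (cardsD1 u) uT add1n => -[].
rewrite -(setD1K uT) pm_row // pm_col //; apply: eq_bigr => b _.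
by rewrite IH.
Qed.

Lemma pm_sym A T B : (forall i j, A i j = A j i) -> pm A T B = pm A B T.
Proof.
move=> Asym; rewrite pm_tr /pm; elim: (enum B) T => //= r s IH T.
by apply: eq_bigr => b _; rewrite Asym IH.
Qed.

Lemma eq_pm A A' T B : (forall i j, i \in T -> j \in B -> A i j = A' i j) ->
  pm A T B = pm A' T B.
Proof.
move=> AA'; have : forall i j, i \in enum T -> j \in B -> A i j = A' i j.
  by move=> i j; rewrite mem_enum; exact: AA'.
rewrite /pm; elim: (enum T) B {AA'} => //= r s IH B AA'; apply: eq_bigr => b bB.
rewrite AA' ?mem_head //; congr (_ * _); apply: IH => i j is_ jB.
by apply: AA'; rewrite ?inE ?is_ ?orbT //; move: jB; rewrite inE => /andP[].
Qed.

Lemma pm_vertex A T B v : v \notin T -> v \notin B ->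
  pm A (v |: T) (v |: B) =
  A v v * pm A T B + \sum_(i in T) \sum_(j in B) A i v * A v j * pm A (T :\ i) (B :\ j).
Proof.
move=> vT vB; rewrite pm_row // big_setU1 //= setU1K //; congr (_ + _).
rewrite exchange_big /=; apply: eq_bigr => j jB.
rewrite setU1D1; last by apply: contraNneq vB => ->.
rewrite pm_col ?mulr_sumr; last by rewrite !inE negb_and vB orbT.
by apply: eq_bigr => i _; rewrite mulrCA mulrA.
Qed.

(* The permutations of the support of [s] are parametrised by one of them, [t]. *)
Lemma sum_perm_pm_seq A s (t : {perm V}) : uniq s ->
  \sum_(p : {perm V} | [forall i, (i \notin s) ==> (p i == t i)]) \prod_(i <- s) A i (p i) =
  pm_seq A s (t @: [set x in s]).
Proof.
elim: s t => [|r s IH] t /=.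
  move=> _; rewrite (big_pred1 t) ?big_nil => [|p].
    by rewrite (_ : [set x in [::]] = set0) ?imset0 ?eqxx //; apply/setP => x; rewrite !inE.
  apply/forallP/eqP => [h|-> i]; last by rewrite eqxx.
  by apply/permP => i; apply/eqP; exact: h.
move=> /andP[rs us].
rewrite (partition_big (fun p : {perm V} => p r) (mem (t @: [set x in r :: s]))) /=; last first.
  move=> p /forallP h; apply/imsetP; exists ((t^-1)%g (p r)); last by rewrite permKV.
  rewrite inE; case: (boolP (_ \in r :: s)) => // zs.
  have := h ((t^-1)%g (p r)); rewrite zs permKV /= (inj_eq perm_inj) => /eqP zr.
  by rewrite zr mem_head in zs.
apply: eq_bigr => b /imsetP[r' r's ->].
(* The reference permutation for the remaining rows: it sends [r] to the prescribed image [t r'] and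
   differs from [t] only at [r] and [r']. *)
rewrite inE in r's; pose t' := (tperm r r' * t)%g.
have t'E x : t' x = t (tperm r r' x) by rewrite permM.
have -> : (t @: [set x in r :: s]) :\ t r' = t' @: [set x in s].
  apply/setP => y; rewrite -[y](permKV t); set z := (t^-1)%g y.
  rewrite in_setD1 (inj_eq perm_inj) mem_imset; last exact: perm_inj.
  have -> : t z = t' (tperm r r' z) by rewrite t'E tpermK.
  rewrite mem_imset; last exact: perm_inj.
  rewrite !inE; move: r's; rewrite inE; case: tpermP => [->|->|/eqP/negbTE -> /eqP ->] //.
    case: (eqVneq r' r) => [-> _|rr' /= ->]; first by rewrite (negbTE rs).
    by rewrite eqxx.
  by rewrite eqxx (negbTE rs).
rewrite -IH // mulr_sumr; apply: eq_big => [p|p /andP[_ /eqP prb]].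
  apply/andP/forallP => [[/forallP h /eqP prb] i|h].
    apply/implyP => is_; rewrite t'E; case: (eqVneq i r) => [->|ir].
      by rewrite tpermL prb.
    have ir' : i != r'.
      by apply: contraNneq is_ => ie; move: r's; rewrite -ie inE (negbTE ir).
    rewrite tpermD; [|by rewrite eq_sym|by rewrite eq_sym].
    by apply: (implyP (h i)); rewrite inE negb_or ir.
  split.
    apply/forallP => i; apply/implyP; rewrite inE negb_or => /andP[ir is_].
    move/implyP: (h i) => /(_ is_) /eqP ->; rewrite t'E tpermD //; rewrite eq_sym //.
    by apply: contraNneq is_ => ie; move: r's; rewrite -ie inE (negbTE ir).
  by move/implyP: (h r) => /(_ rs) /eqP ->; rewrite t'E tpermL.
by rewrite big_cons prb.
Qed.

Lemma pm_setT A : pm A setT setT = \sum_(p : {perm V}) \prod_i A i (p i).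
Proof.
have sT : [set x in enum [set: V]] = [set: V] by apply/setP => x; rewrite !inE mem_enum inE.
rewrite /pm; have := sum_perm_pm_seq A 1%g (enum_uniq (mem [set: V])).
rewrite sT (_ : _ @: setT = setT) => [<-|]; last first.
  by apply/setP => x; rewrite inE; apply/imsetP; exists x; rewrite ?inE ?perm1.
apply: eq_big => [p|p _]; first by apply/forallP => i; rewrite mem_enum inE.
by rewrite big_enum /=; apply: eq_bigl => i; rewrite inE.
Qed.
End SubPermanent.

(** * Exposing a vertex *)

Section VertexExposure.
Context (R : realFieldType) (n : nat).
Local Notation V := 'I_n.
Local Notation bits := {ffun V * V -> bool}.
Local Notation pr := (@pr R _).
Local Notation cpr := (@cpr R _).
Local Notation sg := (@sg R _).
Implicit Types (x y : bits) (T B : {set V}) (a b v : V) (t : nat).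

Definition edge (i j : V) : V * V := if (i <= j)%N then (i, j) else (j, i).

Definition ent x (i j : V) : R := sg x (edge i j).

Lemma edgeC i j : edge i j = edge j i.
Proof. by rewrite /edge; case: (ltngtP i j) => // /val_inj ->. Qed.

Lemma ent_sym x i j : ent x i j = ent x j i.
Proof. by rewrite /ent edgeC. Qed.

Definition below t : {set V} := [set i : V | (i < t)%N].

(** Resampling this set is conditioning on the matrix of the first [t] vertices; these sets are the
    filtration of the vertex exposure. *)
Definition fresh t : {set V * V} := [set p : V * V | (t <= p.1)%N || (t <= p.2)%N].

Lemma fresh_subset s t : (s <= t)%N -> fresh t \subset fresh s.
Proof.
move=> st; apply/subsetP => p; rewrite !inE => /orP[] h; rewrite (leq_trans st h) ?orbT //.
Qed.

Lemma below_subset s t : (s <= t)%N -> below s \subset below t.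
Proof. by move=> st; apply/subsetP => i; rewrite !inE => /leq_trans; exact. Qed.

Lemma edge_fresh t i j : (edge i j \in fresh t) = (t <= i)%N || (t <= j)%N.
Proof. by rewrite /edge; case: ifP; rewrite inE // orbC. Qed.

Lemma pm_agree t x y T B : (forall p, p \notin fresh t -> y p = x p) ->
  T \subset below t -> B \subset below t -> pm (ent y) T B = pm (ent x) T B.
Proof.
move=> yx /subsetP Tt /subsetP Bt; apply: eq_pm => i j /Tt it /Bt jt.
rewrite /ent /sg yx // edge_fresh negb_or -!ltnNge; by rewrite !inE in it jt; rewrite it.
Qed.

Lemma mix_fresh t x y p : p \notin fresh t -> mix (fresh t) x y p = x p.
Proof. by move=> /negbTE pt; rewrite ffunE pt. Qed.

Definition column v y : {ffun V -> bool} := [ffun i => y (i, v)].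

(** The indicator extends the coefficients by 0 to all pairs of vertices, the shape that
    [quadratic_system] expects. *)
Definition vertex_coef x T B i j : R :=
  ((i \in T) && (j \in B))%:R * pm (ent x) (T :\ i) (B :\ j).

Definition vertex_poly x T B v (z : {ffun V -> bool}) : R :=
  \sum_j ((j == v)%:R * pm (ent x) T B) * sg z j +
  \sum_j \sum_k vertex_coef x T B j k * sg z j * sg z k.

Lemma pm_vertex_fresh t v x y T B : v = t :> nat ->
  T \subset below t -> B \subset below t ->
  pm (ent (mix (fresh t) x y)) (v |: T) (v |: B) = vertex_poly x T B v (column v y).
Proof.
move=> vt Tt Bt.
have out (S : {set V}) : S \subset below t -> v \notin S.
  by move/subsetP => St; apply/negP => /St; rewrite inE vt ltnn.
have entv (i : V) : (i <= t)%N -> ent (mix (fresh t) x y) i v = sg (column v y) i.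
  move=> it; change ((-1) ^+ mix (fresh t) x y (edge i v) = (-1) ^+ column v y i :> R).
  rewrite !ffunE edge_fresh vt leqnn orbT.
  by rewrite /edge vt it.
have le (S : {set V}) (i : V) : S \subset below t -> i \in S -> (i <= t)%N.
  by move/subsetP => St /St; rewrite inE => /ltnW.
have pmE (S S' : {set V}) : S \subset below t -> S' \subset below t ->
    pm (ent (mix (fresh t) x y)) S S' = pm (ent x) S S'.
  by apply: pm_agree => p; exact: mix_fresh.
rewrite pm_vertex ?out // pmE // entv ?vt // /vertex_poly.
have -> : \sum_j ((j == v)%:R * pm (ent x) T B) * sg (column v y) j =
    sg (column v y) v * pm (ent x) T B.
  rewrite (bigD1 v) //= eqxx mul1r mulrC big1 ?addr0 // => j /negbTE ->.
  by rewrite !mul0r.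
congr (_ + _).
rewrite big_mkcond; apply: eq_bigr => i _; rewrite /vertex_coef; case: ifP => iT; last first.
  by rewrite big1 // => k _; rewrite !mul0r.
rewrite big_mkcond; apply: eq_bigr => j _; case: ifP => jB; last by rewrite !mul0r.
rewrite entv ?(le T) // ent_sym entv ?(le B) // pmE ?mul1r; first by rewrite mulrC mulrA.
  exact: subset_trans (subsetDl _ _) Tt.
exact: subset_trans (subsetDl _ _) Bt.
Qed.

Lemma vertex_system t v x (I0 : finType) (I : {set I0}) (T B : I0 -> {set V})
    (a b : I0 -> V) (lam : R) (w : nat) : v = t :> nat -> 0 < lam ->
  (forall i, i \in I -> T i \subset below t /\ B i \subset below t) ->
  {in I &, injective a} -> {in I &, injective b} ->
  (forall i k, i \in I -> k \in I -> a i != b k) ->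
  (forall i, i \in I ->
     lam <= `|vertex_coef x (T i) (B i) (a i) (b i) + vertex_coef x (T i) (B i) (b i) (a i)|) ->
  (2 <= w)%N ->
  cpr (fresh t) x (fun y => (1024 * #|[set i in I | (lam / (16 * n%:R ^+ 2) <=
      `|pm (ent y) (v |: T i) (v |: B i)|)%R]| < #|I|)%N) ^+ 4
    <= 16 / w%:R + 4352 * w%:R ^+ 6 / #|I|%:R.
Proof.
move=> vt lam0 TB a_inj b_inj ab coef w2.
have := quadratic_system (fun i j => (j == v)%:R * pm (ent x) (T i) (B i))
  (C := fun i => vertex_coef x (T i) (B i)) lam0 a_inj b_inj ab coef w2.
rewrite card_ord; apply: le_trans; rewrite le_eqVlt; apply/orP; left; apply/eqP.
congr (_ ^+ 4); rewrite /cpr /pr.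
pose phi (i : V) := (i, v); have phi_inj : injective phi by move=> i j [].
rewrite -[RHS](Ex_pushforward _ phi_inj); apply: eq_Ex => y.
congr (nat_of_bool (1024 * _ < _))%N%:R; apply: eq_card => i; rewrite !in_set.
by case: (boolP (i \in I)) => //= /TB[Tt Bt]; rewrite pm_vertex_fresh.
Qed.

(** The alternating sum of the minor over the four signs of the entries [(a, v)] and [(b, v)] is 4
    times the coefficient of their product, up to sign; hence one of the four values is at least the
    coefficient. *)
Lemma vertex_attempt t v x y T B a b : v = t :> nat ->
  T \subset below t -> B \subset below t -> a != b ->
  exists y', `|vertex_coef x T B a b + vertex_coef x T B b a| <=
    `|pm (ent (mix (fresh t) x (mix [set (a, v); (b, v)] y y'))) (v |: T) (v |: B)|.
Proof.
move=> vt Tt Bt ab; set c := _ + _; set S := [set _; _].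
pose z := column v y; pose F := vertex_poly x T B v.
have flips : F z - F (flip a z) - F (flip b z) + F (flip a (flip b z)) =
    4 * (sg z a * sg z b) * c.
  have pick (f : V -> V -> R) i0 j0 :
      \sum_i \sum_j f i j * ((i == i0) && (j == j0))%:R = f i0 j0.
    rewrite (bigD1 i0) //= [X in _ + X]big1 ?addr0 => [|i /negbTE ->]; last first.
      by apply: big1 => j _; rewrite mulr0.
    rewrite (bigD1 j0) //= !eqxx mulr1 big1 ?addr0 // => j /negbTE ->.
    by rewrite andbF mulr0.
  rewrite /c -(pick (vertex_coef x T B) a b) -(pick (vertex_coef x T B) b a).
  rewrite -big_split mulr_sumr /=.
  rewrite (eq_bigr (fun i => \sum_j vertex_coef x T B i j *
     (sg z i * sg z j - sg (flip a z) i * sg (flip a z) j - sg (flip b z) i * sg (flip b z) j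
      + sg (flip a (flip b z)) i * sg (flip a (flip b z)) j))); last first.
    move=> i _; rewrite -big_split mulr_sumr; apply: eq_bigr => j _ /=.
    have E1 : sg z a * sg z b * ((i == a) && (j == b))%:R =
        sg z i * sg z j * ((i == a) && (j == b))%:R.
      by case: (eqVneq i a) => [->|_]; case: (eqVneq j b) => [->|_]; rewrite ?mulr0.
    have E2 : sg z a * sg z b * ((i == b) && (j == a))%:R =
        sg z i * sg z j * ((i == b) && (j == a))%:R.
      case: (eqVneq i b) => [->|_]; case: (eqVneq j a) => [->|_]; rewrite ?mulr0 //.
      by rewrite [sg z a * _]mulrC.
    have dis (k : V) : ~~ ((k == a) && (k == b)).
      by apply/negP => /andP[/eqP -> /eqP e]; rewrite e eqxx in ab.
    rewrite [LHS](_ : _ = 4 * vertex_coef x T B i j *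
      (sg z a * sg z b * ((i == a) && (j == b))%:R + sg z a * sg z b * ((i == b) && (j == a))%:R)).
      rewrite E1 E2 !sg_flip; move: (dis i) (dis j).
      by case: (i == a); case: (i == b); case: (j == a); case: (j == b) => //= _ _; ring.
    by ring.
  rewrite /F /vertex_poly.
  pose G u := \sum_j ((j == v)%:R * pm (ent x) T B) * sg u j.
  have lin : G z - G (flip a z) - G (flip b z) + G (flip a (flip b z)) = 0.
    rewrite /G -!sumrB -big_split big1 // => j _ /=; rewrite !sg_flip.
    by case: (eqVneq j a) => [->|_]; rewrite ?(negbTE ab); [ring|case: ifP => _; ring].
  rewrite -[RHS]add0r -[X in _ = X + _]lin /G.
  rewrite [X in _ = _ + X](eq_bigr (fun i => \sum_j vertex_coef x T B i j * sg z i * sg z j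
    - \sum_j vertex_coef x T B i j * sg (flip a z) i * sg (flip a z) j
    - \sum_j vertex_coef x T B i j * sg (flip b z) i * sg (flip b z) j
    + \sum_j vertex_coef x T B i j * sg (flip a (flip b z)) i * sg (flip a (flip b z)) j)).
    by rewrite !(big_split, sumrN) /=; ring.
  by move=> i _; rewrite -!sumrB -big_split; apply: eq_bigr => j _ /=; ring.
suff [u Fu uS] : exists2 u : {ffun V -> bool}, `|c| <= `|F u| &
    forall i, i != a -> i != b -> u i = z i.
  exists [ffun p => u p.1]; rewrite pm_vertex_fresh //.
  rewrite (_ : column v _ = u) //; apply/ffunP => i; rewrite !ffunE !inE !xpair_eqE eqxx !andbT.
  by case: eqP => //= /eqP ia; case: eqP => //= /eqP ib; rewrite uS // ffunE.
have uS1 i : i != a -> i != b -> flip a z i = z i.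
  by move=> /negbTE ia _; rewrite ffunE ia addbF.
have uS2 i : i != a -> i != b -> flip b z i = z i.
  by move=> _ /negbTE ib; rewrite ffunE ib addbF.
have uS3 i : i != a -> i != b -> flip a (flip b z) i = z i.
  by move=> ia ib; rewrite ffunE (negbTE ia) addbF uS2.
have hc : `|4 * (sg z a * sg z b) * c| = 4 * `|c|.
  by rewrite !normrM !norm_sg !mulr1 ger0_norm.
case: (lerP `|c| `|F z|) => h1; first by exists z.
case: (lerP `|c| `|F (flip a z)|) => h2; first by exists (flip a z).
case: (lerP `|c| `|F (flip b z)|) => h3; first by exists (flip b z).
case: (lerP `|c| `|F (flip a (flip b z))|) => h4; first by exists (flip a (flip b z)).
have := ler_normB (F z) (F (flip a z)).
have := ler_normB (F z - F (flip a z)) (F (flip b z)).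
have := ler_normD (F z - F (flip a z) - F (flip b z)) (F (flip a (flip b z))).
rewrite flips hc; lra.
Qed.
End VertexExposure.

(** * From a principal minor to the whole permanent *)

Section Endgame.
Context (R : realFieldType) (n : nat).
Local Notation V := 'I_n.
Local Notation bits := {ffun V * V -> bool}.
Local Notation pr := (@pr R _).
Local Notation cpr := (@cpr R _).
Local Notation ent := (@ent R n).
Local Notation below := (@below n).
Local Notation fresh := (@fresh n).
Local Notation rho := (15 / 16 : R).
Implicit Types (x y : bits) (O G H Z : {set V}) (v w : V) (t : nat) (lam : R).

(** The minor is recorded by the vertices that it misses: the endgame consists in moving and
    shrinking [Z]. Every exchange reveals two vertices and removes two from [Z], so [t + #|Z|] is
    invariant. *)
Definition heavy t x Z lam : bool :=
  lam <= `|pm (ent x) (below t :\: Z) (below t :\: Z)|.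

Lemma below_succ t v : v = t :> nat -> below t.+1 = v |: below t.
Proof. by move=> vt; apply/setP => i; rewrite !inE ltnS leq_eqVlt -val_eqE /= vt. Qed.

Lemma below_setD2 t v w Z (a b : V) : v = t :> nat -> w = t.+1 :> nat ->
  Z \subset below t -> a \in Z -> b \in Z ->
  below t.+2 :\: (Z :\ a :\ b) = w |: (a |: (b |: (v |: (below t :\: Z)))).
Proof.
move=> vt wt Zt aZ bZ; rewrite (below_succ wt) (below_succ vt).
have vZ : v \notin Z by apply/negP => /(subsetP Zt); rewrite inE vt ltnn.
have wZ : w \notin Z by apply/negP => /(subsetP Zt); rewrite inE wt ltnNge leqnSn.
apply/setP => k; rewrite !in_setD !in_setU !in_set1 !in_setD.
have [->|kw] := eqVneq k w; first by rewrite (negbTE wZ) !andbF.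
have [->|ka] := eqVneq k a; first by rewrite (subsetP Zt _ aZ) !orbT andbF.
have [->|kb] := eqVneq k b; first by rewrite (subsetP Zt _ bZ) !orbT.
by have [->|kv] := eqVneq k v; rewrite ?(negbTE vZ).
Qed.

(** First half of an exchange: the minor leaves the principal ones, with [b] only a row and [a] only
    a column, so a single order of the two entries contributes. *)
Lemma vertex_coef_open x (S : {set V}) (a b : V) : a != b -> a \notin S -> b \notin S ->
  vertex_coef R x (b |: S) (a |: S) a b + vertex_coef R x (b |: S) (a |: S) b a
  = pm (ent x) S S.
Proof.
move=> ab aS bS.
rewrite /vertex_coef !in_setU1 (negbTE ab) (negbTE aS) /= mul0r add0r !eqxx /= mul1r.
by rewrite !setU1K.
Qed.

(** Second half of an exchange, back to a principal minor: by symmetry of the matrix both orders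
    contribute the minor opened at [v], whence the factor 2. *)
Lemma vertex_coef_close x (S : {set V}) (a b v : V) :
  a != b -> v != a -> v != b -> a \notin S -> b \notin S ->
  let S1 := a |: (b |: (v |: S)) in
  vertex_coef R x S1 S1 a b + vertex_coef R x S1 S1 b a
  = 2 * pm (ent x) (v |: (b |: S)) (v |: (a |: S)).
Proof.
move=> ab va vb aS bS S1.
have S1a : S1 :\ a = v |: (b |: S).
  rewrite /S1 setU1K; first by rewrite setUCA.
  by rewrite !in_setU1 (negbTE ab) [a == v]eq_sym (negbTE va).
have S1b : S1 :\ b = v |: (a |: S).
  rewrite /S1 [a |: _]setUCA setU1K; first by rewrite setUCA.
  by rewrite !in_setU1 [b == a]eq_sym (negbTE ab) [b == v]eq_sym (negbTE vb).
rewrite /vertex_coef S1a S1b /S1 !in_setU1 !eqxx !orbT /= !mul1r.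
by rewrite (pm_sym (v |: (a |: S)) _ (ent_sym R x)) mulr_natl mulr2n.
Qed.

(* The coefficient of the monomial [x_va x_vb x_wa x_wb] in the permanent of the principal
   minor on [S :|: [set a; b; v; w]] is twice the permanent of the principal minor on [S]. *)
Lemma double_attempt t v w x Z lam r (a b : nat -> V) :
  v = t :> nat -> w = t.+1 :> nat -> Z \subset below t -> heavy t x Z lam ->
  (forall i, (i < r)%N -> (a i \in Z) /\ (b i \in Z)) ->
  (forall i j, (i < r)%N -> (j < r)%N -> a i != b j) ->
  (forall i j, (i < r)%N -> (j < r)%N -> i != j -> (a i != a j) && (b i != b j)) ->
  cpr (fresh t) x (fun y => all (fun i => ~~ heavy t.+2 y (Z :\ a i :\ b i) lam) (iota 0 r))
    <= rho ^+ r.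
Proof.
move=> vt wt Zt hvZ abZ ab ab_inj.
(* An attempt is decided by four bits, the entries of [a i] and [b i] with the two new vertices. *)
have -> : rho = 1 - 2 ^- 4 by field.
set S := below t :\: Z in hvZ.
have vw : v != w by rewrite -val_eqE /= vt wt neq_ltn ltnSn.
have vbel : v \notin below t by rewrite inE vt ltnn.
have wbel : w \notin below t.+1 by rewrite inE wt ltnn.
have SE i : (i < r)%N ->
    below t.+2 :\: (Z :\ a i :\ b i) = w |: (a i |: (b i |: (v |: S))).
  by move=> /abZ[aZ bZ]; exact: below_setD2.
pose T i := [set p in [:: (a i, v); (b i, v); (a i, w); (b i, w)]].
apply: (@pr_independent_attempts _ _ r 4 T
   (fun i y => heavy t.+2 (mix (fresh t) x y) (Z :\ a i :\ b i) lam)).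
- by move=> i ir; rewrite cardsE (leq_trans (card_size _)).
- move=> i y ir; have [aZ bZ] := abZ i ir.
  set A := a i in aZ *; set B := b i in bZ *.
  have AB : A != B by exact: ab.
  have St : S \subset below t by exact: subsetDl.
  have AS : A \notin S by rewrite /S in_setD aZ.
  have BS : B \notin S by rewrite /S in_setD bZ.
  have At : A \in below t by exact: (subsetP Zt).
  have Bt : B \in below t by exact: (subsetP Zt).
  have sub1 k : k \in below t -> k |: S \subset below t by move=> kt; rewrite subUset sub1set kt.
  have [y1 hy1] := vertex_attempt R x y vt (sub1 _ Bt) (sub1 _ At) AB.
  set x1 := mix (fresh t) x (mix [set (A, v); (B, v)] y y1) in hy1.
  have c1 := vertex_coef_open x AB AS BS.
  rewrite c1 in hy1.
  pose S1 := A |: (B |: (v |: S)).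
  have S1t : S1 \subset below t.+1.
    rewrite (below_succ vt) /S1 !subUset !sub1set !in_setU1 eqxx At Bt !orbT /=.
    exact: subset_trans St (subsetUr _ _).
  have [y2 hy2] := vertex_attempt R x1 (mix [set (A, v); (B, v)] y y1) wt S1t S1t AB.
  have vA : v != A by apply: contraNneq vbel => ->.
  have vB : v != B by apply: contraNneq vbel => ->.
  have c2 := vertex_coef_close x1 AB vA vB AS BS; rewrite /= -/S1 in c2.
  pose y' : bits := [ffun p => if p \in [set (A, v); (B, v)] then y1 p else y2 p].
  exists y'; rewrite /heavy SE // -/A -/B -/S1.
  rewrite (_ : mix (fresh t) x (mix (T i) y y') =
    mix (fresh t.+1) x1 (mix [set (A, w); (B, w)] (mix [set (A, v); (B, v)] y y1) y2)).
    apply: le_trans hy2; rewrite c2 normrM ger0_norm //.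
    have := normr_ge0 (pm (ent x) S S); move: hy1 hvZ; rewrite /heavy -/S; lra.
  apply/ffunP => p; rewrite /x1 /y' !ffunE /T in_set !in_cons in_nil orbF !in_set2.
  have vfresh k : (k, v) \in fresh t by rewrite inE /= vt leqnn orbT.
  have nvw k l : ((k, v) == (l, w)) = false by rewrite xpair_eqE (negbTE vw) andbF.
  have [->|_] := eqVneq p (A, v).
    by rewrite vfresh !nvw /=; case: (_ \in fresh t.+1).
  have [->|_] := eqVneq p (B, v).
    by rewrite vfresh !nvw orbT /=; case: (_ \in fresh t.+1).
  rewrite /=; case: (boolP (_ || _)) => [pw|_].
    have -> : p \in fresh t.+1.
      by case/orP: pw => /eqP ->; rewrite !inE /= wt leqnn orbT.
    have -> // : p \in fresh t.
    by case/orP: pw => /eqP ->; rewrite !inE /= wt leqnSn orbT.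
  case: (boolP (p \in fresh t.+1)) => // pf.
  by rewrite (subsetP (fresh_subset _ (leqnSn t))).
(* Independence of the attempts: the vertices [a j] and [b j] lie in [Z] and are absent from the
   minor of attempt [i], which therefore reads no bit of [T j]. *)
move=> i j y y' ir jr ij; rewrite /heavy; congr (_ <= `|_|); rewrite SE //.
have [aZ bZ] := abZ j jr.
have /andP[aij bij] := ab_inj i j ir jr ij.
have out k : k \in [:: a j; b j] -> k \notin w |: (a i |: (b i |: (v |: S))).
  have kt : k \in [:: a j; b j] -> k \in Z by rewrite !inE => /orP[] /eqP ->.
  move=> kab; have kZ := kt kab; rewrite !in_setU1 !negb_or in_setD kZ /= andbT.
  have kb := subsetP Zt _ kZ.
  have -> : k != v by apply: contraNneq vbel => <-.
  have -> : k != w.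
    by apply: contraNneq wbel => <-; rewrite (subsetP (below_subset _ (leqnSn t))).
  move: kab; rewrite !inE => /orP[] /eqP ->.
    by rewrite eq_sym aij ab.
  by rewrite eq_sym ab // eq_sym bij.
apply: eq_pm => k l kS lS; rewrite /ent /sg !ffunE.
rewrite (_ : edge k l \in T j = false) //; apply/negbTE/negP.
have first_comp : (edge k l).1 \in w |: (a i |: (b i |: (v |: S))) by rewrite /edge; case: ifP.
rewrite /T in_set !in_cons in_nil orbF => h.
have /out : (edge k l).1 \in [:: a j; b j].
  by rewrite !inE; case/or4P: h => /eqP ->; rewrite eqxx ?orbT.
by rewrite first_comp.
Qed.

Lemma fresh_subset2 t : fresh t.+2 \subset fresh t.
Proof. by apply: fresh_subset; rewrite -addn2 leq_addr. Qed.

Lemma disjoint_pairs G r : (2 * r <= #|G|)%N -> (0 < r)%N -> exists a b : nat -> V,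
  [/\ forall i, (i < r)%N -> (a i \in G) /\ (b i \in G),
      forall i j, (i < r)%N -> (j < r)%N -> a i != b j &
      forall i j, (i < r)%N -> (j < r)%N -> i != j -> (a i != a j) && (b i != b j)].
Proof.
move=> Gr r0; have /card_gt0P[d _] : (0 < #|G|)%N by apply: leq_trans Gr; rewrite muln_gt0.
exists (fun i => nth d (enum G) (2 * i)), (fun i => nth d (enum G) (2 * i).+1).
have lt i k : (i < r)%N -> (k < 2)%N -> (2 * i + k < size (enum G))%N.
  by rewrite -cardE => ir k2; apply: leq_trans Gr; move: ir k2; clear; lia.
have lt0 i : (i < r)%N -> (2 * i < size (enum G))%N by move=> ir; rewrite -[(2 * i)%N]addn0 lt.
have lt1 i : (i < r)%N -> ((2 * i).+1 < size (enum G))%N by move=> ir; rewrite -addn1 lt.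
split=> [i ir|i j ir jr|i j ir jr ij].
- by split; rewrite -mem_enum mem_nth ?lt0 ?lt1.
- rewrite nth_uniq ?enum_uniq ?lt0 ?lt1 //; apply/eqP; clear; lia.
- rewrite !nth_uniq ?enum_uniq ?lt0 ?lt1 //; move/eqP: ij => ij.
  by apply/andP; split; apply/eqP; move: ij; clear; lia.
Qed.

Lemma setD2_union O G (a b : V) : [disjoint O & G] -> a \in G -> b \in G ->
  (O :|: G) :\ a :\ b = O :|: (G :\ a :\ b).
Proof.
move=> OG aG bG; apply/setP => k; rewrite !inE.
have out c : c \in G -> c \in O = false.
  by move=> cG; apply/negbTE/negP => cO; move/pred0P: OG => /(_ c); rewrite /= cO cG.
have [->|ka] := eqVneq k a; first by rewrite !andbF (out _ aG).
by have [->|kb] := eqVneq k b; rewrite //= (out _ bG).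
Qed.

(** [O] is the part of the missing set that is left untouched; the [r] attempts use disjoint pairs
    of [G]. *)
Lemma double_step t x O G lam r : (t.+1 < n)%N -> [disjoint O & G] ->
  O :|: G \subset below t -> heavy t x (O :|: G) lam -> (2 * r <= #|G|)%N -> (0 < r)%N ->
  cpr (fresh t) x (fun y => ~~ [exists G' : {set V},
    [&& G' \subset G, #|G'| + 2 == #|G| & heavy t.+2 y (O :|: G') lam]%N]) <= rho ^+ r.
Proof.
move=> tn OG OGt hv Gr r0; have [a [b [abG ab ab_inj]]] := disjoint_pairs Gr r0.
have vt : Ordinal (ltnW tn) = t :> nat by [].
have wt : Ordinal tn = t.+1 :> nat by [].
have abZ i : (i < r)%N -> a i \in O :|: G /\ b i \in O :|: G.
  by move=> /abG[aG bG]; rewrite !in_setU aG bG !orbT.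
apply: le_trans (double_attempt vt wt OGt hv abZ ab ab_inj).
apply: pr_le => y /existsPn hG; apply/allP => i; rewrite mem_iota add0n => /andP[_ ir].
have [aG bG] := abG i ir; apply: contra (hG (G :\ a i :\ b i)) => h.
have bG' : b i \in G :\ a i by rewrite !inE bG eq_sym ab.
apply/and3P; split.
- by rewrite (subset_trans (subsetDl _ _)) ?subsetDl.
- by rewrite [X in _ == X](cardsD1 (a i)) aG (cardsD1 (b i)) bG' addnC addnA.
- by rewrite -setD2_union.
Qed.

(** At least [k + d] pairs are available at first and one fewer at each later step. The failures are
    thus dominated by a geometric series of ratio [rho], and the bound does not grow with the number
    [d] of steps, which can be of order [n]. *)
Lemma shrink d t x O G lam k : (t + 2 * d <= n)%N -> [disjoint O & G] ->
  O :|: G \subset below t -> heavy t x (O :|: G) lam -> (2 * k + 2 * d <= #|G|)%N ->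
  cpr (fresh t) x (fun y => ~~ [exists G' : {set V},
    [&& G' \subset G, #|G'| + 2 * d == #|G| & heavy (t + 2 * d) y (O :|: G') lam]%N])
  <= 16 * rho ^+ k * (1 - rho ^+ d).
Proof.
elim: d t x G => [|d IH] t x G tn OG OGt hv Gk.
  rewrite expr0 subrr mulr0 le_eqVlt; apply/orP; left; apply/eqP/pr_eq0 => y; rewrite negbK.
  apply/existsP; exists G; rewrite subxx muln0 !addn0 eqxx /=.
  move: hv; rewrite /heavy (@pm_agree R n t x) ?subsetDl // => p; exact: mix_fresh.
have tn2 : (t.+1 < n)%N by move: tn; clear; lia.
have r0 : (0 < k + d.+1)%N by rewrite addnS.
have Gr : (2 * (k + d.+1) <= #|G|)%N by move: Gk; clear; lia.
have step1 := double_step tn2 OG OGt hv Gr r0.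
have rd0 (i : nat) : 0 <= rho ^+ i by apply: exprn_ge0; lra.
have rd1 (i : nat) : rho ^+ i <= 1 by apply: exprn_ile1; lra.
have q0 : 0 <= 16 * rho ^+ k * (1 - rho ^+ d).
  by rewrite mulr_ge0 ?mulr_ge0 ?rd0 // subr_ge0.
apply: le_trans (cpr_step (S' := fresh t.+2) _ q0 step1 _) _.
- exact: fresh_subset2.
- move=> y _ /existsP[G1 /and3P[G1G /eqP G1c hv1]].
  have OG1 : [disjoint O & G1] by exact: disjointWr OG.
  have OG1t : O :|: G1 \subset below t.+2.
    apply: subset_trans (below_subset _ (leqnSn t.+1)).
    apply: subset_trans (below_subset _ (leqnSn t)).
    by apply: subset_trans OGt; rewrite setUS.
  have tn' : (t.+2 + 2 * d <= n)%N by move: tn; clear; lia.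
  have G1k : (2 * k + 2 * d <= #|G1|)%N by move: Gk G1c; clear; lia.
  apply: le_trans (IH t.+2 y G1 tn' OG1 OG1t hv1 G1k); apply: pr_le => z.
  apply: contra => /existsP[G2 /and3P[G21 /eqP G2c hv2]]; apply/existsP; exists G2.
  rewrite (subset_trans G21 G1G) /=; apply/andP; split.
    by rewrite -G1c -G2c mulnS [(2 + _)%N]addnC addnA.
  by rewrite (_ : t + 2 * d.+1 = t.+2 + 2 * d)%N //; clear; lia.
rewrite exprD exprS; have := mulr_ge0 (rd0 k) (rd0 d).
set X := rho ^+ k; set Y := rho ^+ d; lra.
Qed.

(* While [O] is not empty, a step removes [o] of [O] and [h] of [G] with probability at least
   1/16, and otherwise almost surely two elements of [G]; hence the potential 2^#|O|. *)
Lemma absorb N t x O G lam k : (0 < k)%N -> (t + 2 * N <= n)%N -> [disjoint O & G] ->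
  O :|: G \subset below t -> heavy t x (O :|: G) lam -> (2 * k + 2 * N <= #|G|)%N ->
  cpr (fresh t) x (fun y => ~~ [exists G' : {set V},
    [&& G' \subset G, #|G'| + 2 * N == #|O| + #|G| & heavy (t + 2 * N) y G' lam]%N])
  <= (2 ^+ #|O| - 1) * (31 / 32) ^+ N + N%:R * rho ^+ k.
Proof.
move=> k0; elim: N t x O G => [|N IH] t x O G tn OG OGt hv Gk.
  rewrite expr0 mulr1 mul0r addr0.
  have [O0|O0] := posnP #|O|.
    have OE : O = set0 by apply/eqP; rewrite -cards_eq0 O0.
    rewrite O0 expr0 subrr le_eqVlt; apply/orP; left; apply/eqP/pr_eq0 => y; rewrite negbK.
    apply/existsP; exists G; rewrite subxx muln0 !addn0 add0n eqxx /=.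
    rewrite OE set0U in hv; move: hv.
    rewrite /heavy (@pm_agree R n t x) ?subsetDl // => p; exact: mix_fresh.
  apply: le_trans (pr_le1 _ _) _; rewrite lerBrDr.
  by rewrite -[X in X <= _]/(2%:R) -[X in X <= _]expr1 ler_eXn2l // ltr1n.
have tn2 : (t.+1 < n)%N by move: tn; clear; lia.
have Gr : (2 * k <= #|G|)%N by move: Gk; clear; lia.
have step1 := double_step tn2 OG OGt hv Gr k0.
pose b u : R := (2 ^+ u - 1) * (31 / 32) ^+ N + N%:R * rho ^+ k.
have p31 (i : nat) : 0 <= (31 / 32 : R) ^+ i by apply: exprn_ge0; lra.
have rk0 : 0 <= rho ^+ k by apply: exprn_ge0; lra.
have b_ge0 u : 0 <= b u.
  by rewrite addr_ge0 ?mulr_ge0 ?rk0 ?p31 // subr_ge0 exprn_ege1 // ler1n.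
have below2 G1 O1 : O1 \subset O -> G1 \subset G -> O1 :|: G1 \subset below t.+2.
  move=> O1O G1G; apply: subset_trans (below_subset _ (leqnSn t.+1)).
  apply: subset_trans (below_subset _ (leqnSn t)).
  by apply: subset_trans OGt; rewrite setUSS.
have tn' : (t.+2 + 2 * N <= n)%N by move: tn; clear; lia.
set F := fun y => ~~ _.
have next y O1 G1 : O1 \subset O -> G1 \subset G -> (#|O1| + #|G1| + 2 = #|O| + #|G|)%N ->
    (#|G| <= #|G1| + 2)%N -> heavy t.+2 y (O1 :|: G1) lam -> cpr (fresh t.+2) y F <= b #|O1|.
  move=> O1O G1G c1 c2 hv1.
  have OG1 : [disjoint O1 & G1] by apply: disjointW OG.
  have G1k : (2 * k + 2 * N <= #|G1|)%N by move: Gk c2; clear; lia.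
  apply: le_trans (IH t.+2 y O1 G1 tn' OG1 (below2 _ _ O1O G1G) hv1 G1k); apply: pr_le => z.
  apply: contra => /existsP[G2 /and3P[G21 /eqP G2c hv2]]; apply/existsP; exists G2.
  rewrite (subset_trans G21 G1G) /=; apply/andP; split.
    by rewrite -c1 -G2c mulnS [(2 + _)%N]addnC addnA.
  by rewrite (_ : t + 2 * N.+1 = t.+2 + 2 * N)%N //; clear; lia.
have next2 y G1 : G1 \subset G -> (#|G1| + 2 = #|G|)%N -> heavy t.+2 y (O :|: G1) lam ->
    cpr (fresh t.+2) y F <= b #|O|.
  by move=> G1G G1c; apply: next => //; rewrite -?addnA G1c.
have [O0|O0] := posnP #|O|.
  apply: le_trans (cpr_step (S' := fresh t.+2) _ (b_ge0 #|O|) step1 _) _.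
  - exact: fresh_subset2.
  - by move=> y _ /existsP[G1 /and3P[G1G /eqP G1c hv1]]; exact: next2 hv1.
  by rewrite /b O0 expr0 subrr !mul0r !add0r -[N.+1]addn1 natrD mulrDl; lra.
have /card_gt0P[o oO] := O0.
have /card_gt0P[h hG] : (0 < #|G|)%N by apply: leq_trans Gr; rewrite muln_gt0.
have oh : o != h.
  by apply/eqP => oh; move/pred0P: OG => /(_ o); rewrite /= oO oh hG.
(* [E1] is preferred whenever it holds. Either way at most two elements leave [G], so that it keeps
   enough pairs for the remaining steps. *)
pose E1 y := heavy t.+2 y ((O :\ o) :|: (G :\ h)) lam.
pose E2 y := [exists G1 : {set V},
    [&& G1 \subset G, #|G1| + 2 == #|G| & heavy t.+2 y (O :|: G1) lam]%N].
have prE1 : 1 / 16 <= cpr (fresh t) x E1.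
  have vt : Ordinal (ltnW tn2) = t :> nat by [].
  have wt : Ordinal tn2 = t.+1 :> nat by [].
  have := @double_attempt t _ _ x (O :|: G) lam 1 (fun=> o) (fun=> h) vt wt OGt hv.
  rewrite expr1 => hd; have : cpr (fresh t) x (fun y => ~~ E1 y) <= rho.
    apply: le_trans (hd _ _ _) => //.
    - apply: pr_le => y; rewrite /= andbT /E1; apply: contra.
      rewrite (_ : (O :|: G) :\ o :\ h = (O :\ o) :|: (G :\ h)) //.
      apply/setP => j; rewrite !inE.
      have out c : c \in O -> c \in G -> False.
        by move=> cO cG; move/pred0P: OG => /(_ c); rewrite /= cO cG.
      have [->|jo] := eqVneq j o.
        by rewrite (negbTE oh) /=; case: (boolP (o \in G)) => // /(out _ oO).
      have [->|jh] //= := eqVneq j h.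
      by case: (boolP (h \in O)) => // hO; case: (out _ hO hG).
    - by move=> i _; rewrite !inE oO hG orbT.
    - by move=> [|i] [|j].
  rewrite /cpr pr_predC; lra.
have bmono : b #|O|.-1 <= b #|O|.
  by rewrite lerD2r ler_wpM2r ?p31 // lerD2r ler_weXn2l ?ler1n // leq_pred.
have main : cpr (fresh t) x F <=
    Ex (fun y => (~~ E2 (mix (fresh t) x y))%:R + (b #|O| +
      - (b #|O| - b #|O|.-1) * (E1 (mix (fresh t) x y))%:R)).
  rewrite /cpr /pr (cpr_tower (S' := fresh t.+2) x (fun y => (F y)%:R)); last exact: fresh_subset2.
  apply: Ex_le => y; set z := mix (fresh t) x y.
  change (cpr (fresh t.+2) z F <= (~~ E2 z)%:R + (b #|O| + - (b #|O| - b #|O|.-1) * (E1 z)%:R)).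
  case: (boolP (E1 z)) => e1 /=.
    apply: (@le_trans _ _ (b #|O|.-1)).
      have Oo : (#|O| = #|O :\ o|.+1)%N by rewrite (cardsD1 o) oO.
      have Gh : (#|G| = #|G :\ h|.+1)%N by rewrite (cardsD1 h) hG.
      rewrite [in #|O|.-1]Oo; apply: next e1; rewrite ?subsetDl //; rewrite ?Oo Gh; clear; lia.
    by case: (E2 z) => /=; lra.
  rewrite mulr0 addr0; case: (boolP (E2 z)) => e2 /=; last first.
    by apply: le_trans (pr_le1 _ _) _; rewrite lerDl.
  by rewrite add0r; case/existsP: e2 => G1 /and3P[G1G /eqP G1c hv1]; exact: next2 hv1.
apply: (le_trans main); rewrite ExD [X in _ + X]ExD (Ex_cst _ (b #|O|)) ExZ.
change (cpr (fresh t) x (fun y => ~~ E2 y)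
  + (b #|O| + - (b #|O| - b #|O|.-1) * cpr (fresh t) x E1) <=
  (2 ^+ #|O| - 1) * (31 / 32) ^+ N.+1 + N.+1%:R * rho ^+ k).
(* Progress halves [2 ^ #|O|] and has probability at least [1 / 16]: the potential shrinks by
   [1 - 1 / 32] on average. *)
have hb : b #|O| - b #|O|.-1 = 2 ^+ #|O| / 2 * (31 / 32) ^+ N.
  rewrite /b; case: #|O| O0 => // u _ /=; rewrite exprS; by field.
have h1 : (b #|O| - b #|O|.-1) * (1 / 16) <= (b #|O| - b #|O|.-1) * cpr (fresh t) x E1.
  by rewrite ler_wpM2l // subr_ge0.
have E2le : cpr (fresh t) x (fun y => ~~ E2 y) <= rho ^+ k by exact: step1.
rewrite hb in h1 *; rewrite /b exprS -[N.+1]addn1 natrD.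
have X0 := p31 N; have Y1 : 0 <= 2 ^+ #|O| * (31 / 32) ^+ N :> R by apply: mulr_ge0 X0; exact: exprn_ge0.
move: E2le h1 X0 Y1; set X := (31 / 32) ^+ N; set Y := 2 ^+ #|O|; set W := rho ^+ k.
by move: (cpr _ _ _) (cpr _ _ _) => U U'; rewrite mulrDl mul1r; lra.
Qed.
End Endgame.

(** * Reaching many disjoint target sets and completing the permanent *)

Section FinalPhase.
Context (R : realFieldType) (n : nat).
Local Notation V := 'I_n.
Local Notation bits := {ffun V * V -> bool}.
Local Notation pr := (@pr R _).
Local Notation cpr := (@cpr R _).
Local Notation ent := (@ent R n).
Local Notation below := (@below n).
Local Notation fresh := (@fresh n).
Local Notation rho := (15 / 16 : R).
Implicit Types (x y : bits) (O G H Z : {set V}) (v w : V) (t : nat) (lam : R).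

(** Fixes the length of the absorption: [64 * u] double steps beat the initial potential
    [2 ^ (2 * u)], with [rho ^ u] to spare. *)
Lemma pow31 : (2 ^+ 2 * (31 / 32) ^+ 64 : R) <= rho.
Proof.
have h (q c : R) : 0 <= q -> q <= c -> q * q <= c * c.
  by move=> q0 qc; apply: ler_pM.
have h1 : (31 / 32 : R) ^+ 2 <= 19 / 20 by rewrite expr2; lra.
have p k : 0 <= (31 / 32 : R) ^+ k by apply: exprn_ge0; lra.
have h2 : (31 / 32 : R) ^+ 4 <= 91 / 100.
  by rewrite (exprD _ 2 2); apply: le_trans (h _ _ (p _) h1) _; lra.
have h3 : (31 / 32 : R) ^+ 8 <= 83 / 100.
  by rewrite (exprD _ 4 4); apply: le_trans (h _ _ (p _) h2) _; lra.
have h4 : (31 / 32 : R) ^+ 16 <= 69 / 100.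
  by rewrite (exprD _ 8 8); apply: le_trans (h _ _ (p _) h3) _; lra.
have h5 : (31 / 32 : R) ^+ 32 <= 48 / 100.
  by rewrite (exprD _ 16 16); apply: le_trans (h _ _ (p _) h4) _; lra.
have h6 : (31 / 32 : R) ^+ 64 <= 234 / 1000.
  by rewrite (exprD _ 32 32); apply: le_trans (h _ _ (p _) h5) _; lra.
lra.
Qed.

(** Three moves: shrink [Z :\: H] to [2 * u] elements, absorb these into [H] by [64 * u] double
    steps, shrink what is left, [4 * u] elements of [H], to [2 * u]. The size [130 * u] is the
    [128 * u] elements that the absorption may take from [H] plus a reserve of [2 * u] that keeps
    [u] pairs available. *)
Lemma chain u t x Z H lam : (0 < u)%N -> Z \subset below t -> heavy t x Z lam ->
  (t + #|Z| = n)%N -> ~~ odd #|Z| -> H \subset Z -> #|H| = (130 * u)%N ->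
  (132 * u <= #|Z|)%N ->
  cpr (fresh t) x (fun y => ~~ [exists G : {set V},
    [&& G \subset H, #|G| == 2 * u & heavy (n - 2 * u) y G lam]%N])
  <= 100 * u%:R * rho ^+ u.
Proof.
move=> u0 Zt hv tZ oddZ HZ H130 Z132.
pose O := Z :\: H; pose d := (#|O|./2 - u)%N.
have cO : (#|Z| = #|H| + #|O|)%N by rewrite -(cardsID H Z) (setIidPr HZ).
(* [shrink] removes elements in pairs, so parity has to match for exactly [2 * u] to remain. *)
have oddO : ~~ odd #|O| by move: oddZ; rewrite cO H130 oddD oddM.
have Oe : #|O| = (2 * u + 2 * d)%N.
  by have := odd_double_half #|O|; rewrite (negbTE oddO) /d; move: cO H130 Z132; clear; lia.
have HO : [disjoint H & O] by rewrite /O disjoints_subset setDE setCI setCK subsetUr.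
have HOE : H :|: O = Z.
  by apply/setP => k; rewrite !inE; case: (boolP (k \in H)) => // /(subsetP HZ) ->.
have rk0 : 0 <= rho ^+ u by apply: exprn_ge0; lra.
have rd1 (i : nat) : rho ^+ i <= 1 by apply: exprn_ile1; lra.
have rd0 (i : nat) : 0 <= rho ^+ i by apply: exprn_ge0; lra.
set F := fun y => ~~ _.
have C y G : G \subset H -> #|G| = (4 * u)%N -> heavy (n - 4 * u) y G lam ->
    G \subset below (n - 4 * u) -> cpr (fresh (n - 4 * u)) y F <= 16 * rho ^+ u.
  move=> GH G4 hvG Gt.
  have dis : [disjoint set0 & G] by rewrite -setI_eq0 set0I.
  have tn : (n - 4 * u + 2 * u <= n)%N by move: cO tZ H130 u0; clear; lia.
  rewrite -[G]set0U in hvG Gt.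
  have Gk : (2 * u + 2 * u <= #|G|)%N by rewrite G4; clear; lia.
  have := shrink tn dis Gt hvG Gk => h; apply: (@le_trans _ _ (16 * rho ^+ u * (1 - rho ^+ u))).
    apply: le_trans h; apply: pr_le => z; apply: contra => /existsP[G' /and3P[G'G /eqP cG' h]].
    apply/existsP; exists G'; rewrite (subset_trans G'G GH) /=; apply/andP; split.
      by apply/eqP; move: cG' G4 => /=; clear; lia.
    rewrite set0U in h; rewrite (_ : n - 2 * u = n - 4 * u + 2 * u)%N //.
    by move: cO tZ H130 u0; clear; lia.
  rewrite ler_piMr ?mulr_ge0 //; have := rd0 u; lra.
have Bst y O' : O' \subset O -> #|O'| = (2 * u)%N -> heavy (n - 132 * u) y (H :|: O') lam ->
    H :|: O' \subset below (n - 132 * u) -> cpr (fresh (n - 132 * u)) y F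
      <= (rho ^+ u + (64 * u)%:R * rho ^+ u) + 16 * rho ^+ u.
  move=> O'O cO' hvO O't.
  have dis : [disjoint O' & H] by rewrite disjoint_sym; exact: disjointWr HO.
  have tn : (n - 132 * u + 2 * (64 * u) <= n)%N by move: tZ Z132; clear; lia.
  rewrite setUC in hvO O't.
  have Gk : (2 * u + 2 * (64 * u) <= #|H|)%N by rewrite H130; clear; lia.
  have := absorb u0 tn dis O't hvO Gk => h.
  have te : (n - 132 * u + 2 * (64 * u) = n - 4 * u)%N by move: tZ Z132; clear; lia.
  rewrite te in h; have q0 : 0 <= 16 * rho ^+ u by rewrite mulr_ge0.
  apply: le_trans (cpr_step (S' := fresh (n - 4 * u)) _ q0 h _) _.
    by apply: fresh_subset; move: tZ Z132; clear; lia.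
    move=> z _ /existsP[G /and3P[GH /eqP cG hvG]]; apply: (C _ _ GH _ hvG).
      by move: cG => /=; rewrite cO' H130; clear; lia.
    apply: subset_trans (subset_trans GH (subset_trans HZ Zt)) _.
    by apply: below_subset; move: tZ Z132; clear; lia.
  rewrite lerD2r lerD2r cO' exprM.
  apply: (@le_trans _ _ ((2 ^+ 2) ^+ u * (31 / 32) ^+ (64 * u))).
    rewrite ler_wpM2r ?lerBlDr ?lerDl //; apply: exprn_ge0; lra.
  have pp : 0 <= 2 ^+ 2 * (31 / 32) ^+ 64 :> R.
    by apply: mulr_ge0; [exact: exprn_ge0|apply: exprn_ge0; lra].
  have r0 : 0 <= rho by lra.
  by rewrite exprM -exprMn lerXn2r ?nnegrE // pow31.
have tn : (t + 2 * d <= n)%N by move: tZ cO Oe H130; clear; lia.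
have Zt' := Zt; have hv' := hv; rewrite -HOE in Zt' hv'.
have Gk : (2 * u + 2 * d <= #|O|)%N by rewrite Oe.
have h := shrink tn HO Zt' hv' Gk.
have te : (t + 2 * d = n - 132 * u)%N by move: tZ cO Oe H130; clear; lia.
rewrite te in h.
have q0 : 0 <= (rho ^+ u + (64 * u)%:R * rho ^+ u) + 16 * rho ^+ u.
  by rewrite !addr_ge0 ?mulr_ge0.
apply: le_trans (cpr_step (S' := fresh (n - 132 * u)) _ q0 h _) _.
- by apply: fresh_subset; rewrite -te leq_addr.
- move=> y _ /existsP[O' /and3P[O'O /eqP cO' hvO]]; apply: (Bst _ _ O'O _ hvO).
    by move: cO' => /=; rewrite Oe; clear; lia.
  apply: subset_trans (below_subset _ (_ : t <= n - 132 * u)%N); last by rewrite -te leq_addr.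
  by apply: subset_trans Zt'; rewrite setUS.
have u1 : 1 <= u%:R :> R by rewrite ler1n.
have hU : 0 <= (u%:R - 1) * rho ^+ u by rewrite mulr_ge0 // subr_ge0.
have hd : 16 * rho ^+ u * (1 - rho ^+ d) <= 16 * rho ^+ u.
  by rewrite ler_piMr ?mulr_ge0 //; have := rd0 d; lra.
rewrite natrM; lra.
Qed.

(** Each of the [2 * u] last vertices keeps at least one minor in 1024 and divides its size by at
    most [16 * n ^ 2]. Disjointness of the [Z i] gives each form its own two coordinates, as
    [quadratic_system] requires. When [Z i] is empty all surviving minors are the whole
    permanent. *)
Lemma final_phase u t x (I0 : finType) (I : {set I0}) (Z : I0 -> {set V}) lam (w m : nat)
    (p : R) : 0 < lam -> (2 <= w)%N -> (0 < m)%N -> 0 <= p ->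
  16 / w%:R + 4352 * w%:R ^+ 6 / m%:R <= p ^+ 4 ->
  (t + 2 * u = n)%N -> (1024 ^ (2 * u) * m <= #|I|)%N ->
  (forall i, i \in I -> [/\ Z i \subset below t, #|Z i| = (2 * u)%N & heavy t x (Z i) lam]) ->
  (forall i k, i \in I -> k \in I -> i != k -> [disjoint Z i & Z k]) ->
  cpr (fresh t) x (fun y => `|pm (ent y) setT setT| < lam / (16 * n%:R ^+ 2) ^+ (2 * u))
  <= (2 * u)%:R * p.
Proof.
move=> lam0 w2 m0 p0 pE.
elim: u t x I Z lam lam0 => [|u IH] t x I Z lam lam0 tn Im ZI Zdis.
  rewrite muln0 mul0r expr0 divr1 le_eqVlt; apply/orP; left; apply/eqP/pr_eq0 => y.
  have /card_gt0P[i iI] : (0 < #|I|)%N by apply: leq_trans Im; rewrite muln0 expn0 mul1n.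
  have [_ cZ hv] := ZI i iI; rewrite -leNgt; apply: (le_trans hv).
  have Z0 : Z i = set0 by apply/eqP; rewrite -cards_eq0 cZ.
  have bT : below t = setT.
    by apply/setP => k; rewrite !inE; have := ltn_ord k; move: tn; rewrite muln0 addn0 => ->.
  rewrite Z0 setD0 bT (@pm_agree R n t x) ?bT // => q; exact: mix_fresh.
have vn : (t < n)%N by move: tn; clear; lia.
have wn : (t.+1 < n)%N by move: tn; clear; lia.
pose v : V := Ordinal vn; pose v' : V := Ordinal wn.
have vt : v = t :> nat by []. have v't : v' = t.+1 :> nat by [].
have vbel : v \notin below t by rewrite inE ltnn.
pose a i := nth v (enum (Z i)) 0; pose b i := nth v (enum (Z i)) 1.
have szZ i : i \in I -> (2 <= size (enum (Z i)))%N.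
  by move=> /ZI[_ cZ _]; rewrite -cardE cZ mulnS.
have aZ i : i \in I -> a i \in Z i by move=> /szZ s2; rewrite -mem_enum mem_nth // ltnW.
have bZ i : i \in I -> b i \in Z i by move=> /szZ s2; rewrite -mem_enum mem_nth.
have abi i : i \in I -> a i != b i.
  by move=> /szZ s2; rewrite nth_uniq ?enum_uniq // ltnW.
have Zne i k j : i \in I -> k \in I -> i != k -> j \in Z i -> j \in Z k -> False.
  by move=> iI kI ik ji jk; have /pred0P/(_ j) := Zdis i k iI kI ik; rewrite /= ji jk.
have a_inj : {in I &, injective a}.
  move=> i k iI kI aik; apply/eqP/negPn/negP => ik; apply: (Zne i k (a i)) => //; first exact: aZ.
  by rewrite aik aZ.
have b_inj : {in I &, injective b}.
  move=> i k iI kI aik; apply/eqP/negPn/negP => ik; apply: (Zne i k (b i)) => //; first exact: bZ.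
  by rewrite aik bZ.
have ab i k : i \in I -> k \in I -> a i != b k.
  move=> iI kI; have [<-|ik] := eqVneq i k; first exact: abi.
  by apply/eqP => e; apply: (Zne i k (a i)) => //; [exact: aZ|rewrite e bZ].
pose S i := below t :\: Z i.
have St i : S i \subset below t by exact: subsetDl.
have aS i : i \in I -> a i \notin S i by move=> iI; rewrite in_setD aZ.
have bS i : i \in I -> b i \notin S i by move=> iI; rewrite in_setD bZ.
have at_ i : i \in I -> a i \in below t by move=> iI; case: (ZI i iI) => /subsetP Zt _ _; rewrite Zt ?aZ.
have bt i : i \in I -> b i \in below t by move=> iI; case: (ZI i iI) => /subsetP Zt _ _; rewrite Zt ?bZ.
have sub1 i k : k \in below t -> k |: S i \subset below t.
  by move=> kt; rewrite subUset sub1set kt St.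
pose c : R := 16 * n%:R ^+ 2.
have n0 : 0 < n%:R :> R by rewrite ltr0n (leq_ltn_trans _ vn).
have c0 : 0 < c by rewrite mulr_gt0 // exprn_gt0.
(* At least [m] indices are left at every step, so one [p] serves for all; the fourth power is the
   loss of the decoupling. *)
have prob (s : nat) (E : R) : (m <= s)%N -> 0 <= E ->
    E ^+ 4 <= 16 / w%:R + 4352 * w%:R ^+ 6 / s%:R -> E <= p.
  move=> ms E0 Ele; rewrite -(ler_pXn2r (n := 4)) ?nnegrE //.
  apply: le_trans Ele _; apply: le_trans pE; rewrite lerD2l.
  by rewrite ler_wpM2l ?mulr_ge0 ?exprn_ge0 // lef_pV2 ?posrE ?ltr0n ?ler_nat // (leq_trans m0).
have pow1024 k : (0 < 1024 ^ k)%N by rewrite expn_gt0.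
have Im0 : (m <= #|I|)%N by apply: leq_trans Im; rewrite leq_pmull.
have coef1 i : i \in I -> lam <= `|vertex_coef R x (b i |: S i) (a i |: S i) (a i) (b i)
     + vertex_coef R x (b i |: S i) (a i |: S i) (b i) (a i)|.
  by move=> iI; rewrite vertex_coef_open ?abi ?aS ?bS //; case: (ZI i iI).
have sub2 i : i \in I -> b i |: S i \subset below t /\ a i |: S i \subset below t.
  by move=> iI; rewrite !sub1 ?at_ ?bt.
pose I1 y := [set i in I | lam / c <= `|pm (ent y) (v |: (b i |: S i)) (v |: (a i |: S i))|].
have step1 : cpr (fresh t) x (fun y => ~~ ~~ (1024 * #|I1 y| < #|I|)%N) <= p.
  apply: (prob #|I|) => //; first exact: pr_ge0.
  have := vertex_system vt lam0 sub2 a_inj b_inj ab coef1 w2; apply: le_trans.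
  rewrite lerXn2r ?nnegrE ?pr_ge0 //; apply: pr_le => y; rewrite negbK.
  by apply: leq_trans; rewrite ltnS leq_mul2l; apply/orP; right; apply/subset_leq_card/subsetP => i; rewrite !in_set.
have Z'E i : i \in I -> below t.+2 :\: (Z i :\ a i :\ b i) = v' |: (a i |: (b i |: (v |: S i))).
  by move=> iI; case: (ZI i iI) => Zt _ _; rewrite -below_setD2 ?aZ ?bZ.
pose I2 (J : {set I0}) y := [set i in J | heavy t.+2 y (Z i :\ a i :\ b i) (lam / c / c)].
have step2 y : (#|I| <= 1024 * #|I1 y|)%N ->
    cpr (fresh t.+1) y (fun z => ~~ ~~ (1024 * #|I2 (I1 y) z| < #|I1 y|)%N) <= p.
  move=> I1I.
  have I1sub i : i \in I1 y -> i \in I by rewrite in_set => /andP[].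
  have I1m : (m <= #|I1 y|)%N.
    rewrite -(leq_pmul2l (isT : (0 < 1024)%N)); apply: leq_trans I1I.
    apply: leq_trans Im; rewrite leq_mul2r; apply/orP; right.
    by rewrite -[X in (X <= _)%N]expn1 leq_exp2l // mulnS.
  apply: (prob #|I1 y|) => //; first exact: pr_ge0.
  pose S1 i := a i |: (b i |: (v |: S i)).
  have lc0 : 0 < lam / c by rewrite divr_gt0.
  have S1t i : i \in I1 y -> S1 i \subset below t.+1 /\ S1 i \subset below t.+1.
    move=> /I1sub iI; suff : S1 i \subset below t.+1 by [].
    rewrite (below_succ vt) /S1 !subUset !sub1set !in_setU1 eqxx at_ ?bt ?orbT //=.
    exact: subset_trans (St i) (subsetUr _ _).
  have a_inj1 : {in I1 y &, injective a} by move=> i k /I1sub iI /I1sub kI; exact: a_inj.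
  have b_inj1 : {in I1 y &, injective b} by move=> i k /I1sub iI /I1sub kI; exact: b_inj.
  have ab1 i k : i \in I1 y -> k \in I1 y -> a i != b k.
    by move=> /I1sub iI /I1sub kI; exact: ab.
  have coef2 i : i \in I1 y -> lam / c <= `|vertex_coef R y (S1 i) (S1 i) (a i) (b i)
       + vertex_coef R y (S1 i) (S1 i) (b i) (a i)|.
    move=> iI1; have iI := I1sub i iI1.
    have va : v != a i by apply: contraNneq vbel => ->; exact: at_.
    have vb : v != b i by apply: contraNneq vbel => ->; exact: bt.
    rewrite (vertex_coef_close R y (abi i iI) va vb (aS i iI) (bS i iI)) normrM ger0_norm //.
    move: iI1; rewrite in_set => /andP[_ h]; have := lc0; lra.
  have := vertex_system v't lc0 S1t a_inj1 b_inj1 ab1 coef2 w2; apply: le_trans.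
  rewrite lerXn2r ?nnegrE ?pr_ge0 //; apply: pr_le => z; rewrite negbK.
  apply: leq_trans; rewrite ltnS leq_mul2l; apply/orP; right; apply/subset_leq_card/subsetP => i.
  by rewrite !in_set => /andP[/andP[iI h1] h2]; rewrite iI h1 /= /heavy Z'E.
set F := fun y => `|_| < _.
have ge0 k : 0 <= (2 * k)%:R * p by rewrite mulr_ge0.
have last y z : (#|I| <= 1024 * #|I1 y|)%N -> (#|I1 y| <= 1024 * #|I2 (I1 y) z|)%N ->
    cpr (fresh t.+2) z F <= (2 * u)%:R * p.
  move=> h1 h2; have I2sub i : i \in I2 (I1 y) z -> i \in I.
    by rewrite in_set => /andP[+ _]; rewrite in_set => /andP[].
  have lcc : 0 < lam / c / c by rewrite !divr_gt0.
  apply: le_trans (IH t.+2 z (I2 (I1 y) z) (fun i => Z i :\ a i :\ b i) _ lcc _ _ _ _).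
  - apply: pr_le => r; rewrite /F -/c.
    rewrite (_ : lam / c ^+ (2 * u.+1) = lam / c / c / c ^+ (2 * u)) //.
    by rewrite mulnS exprD expr2 !invfM !mulrA.
  - by move: tn; clear; lia.
  - move: Im h1 h2; rewrite mulnS !expnS; move: (_ ^ _)%N => X; clear; nia.
  - move=> i iI2; have iI := I2sub i iI2; have [Zt cZ _] := ZI i iI.
    have bZ' : b i \in Z i :\ a i by rewrite !inE bZ // eq_sym abi.
    split.
    + apply: subset_trans (below_subset _ (leqnSn t.+1)).
      apply: subset_trans (below_subset _ (leqnSn t)).
      by apply: subset_trans Zt; rewrite (subset_trans (subsetDl _ _)) ?subsetDl.
    + by move: cZ; rewrite (cardsD1 (a i)) aZ // (cardsD1 (b i)) bZ' mulnS => -[].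
    + by move: iI2; rewrite in_set => /andP[].
  - move=> i k /I2sub iI /I2sub kI ik; apply: disjointW (Zdis i k iI kI ik);
      by rewrite (subset_trans (subsetDl _ _)) ?subsetDl.
rewrite mulnS natrD mulrDl -[2%:R]/(1 + 1) mulrDl mul1r -addrA.
apply: (cpr_step (S' := fresh t.+1) _ _ step1).
- by apply: fresh_subset.
- exact: addr_ge0.
move=> y _; rewrite -leqNgt => h1; apply: (cpr_step (S' := fresh t.+2) _ _ (step2 y h1)) => //.
  by apply: fresh_subset.
by move=> z _; rewrite -leqNgt => h2; exact: last h1 h2.
Qed.

Lemma subset_of_card (T : finType) (A : {set T}) k : (k <= #|A|)%N ->
  exists2 B : {set T}, B \subset A & #|B| = k.
Proof.
move=> kA; exists [set x in take k (enum A)].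
  by apply/subsetP => x; rewrite inE => /mem_take; rewrite mem_enum.
by rewrite cardsE (card_uniqP _) ?take_uniq ?enum_uniq // size_takel // -cardE.
Qed.

Lemma disjoint_blocks (T : finType) (A : {set T}) m h : (m * h <= #|A|)%N ->
  exists H : nat -> {set T}, (forall i, (i < m)%N -> H i \subset A /\ #|H i| = h) /\
    (forall i j, (i < m)%N -> (j < m)%N -> i != j -> [disjoint H i & H j]).
Proof.
elim: m A => [|m IH] A mA; first by exists (fun=> set0).
have [|B BA cB] := @subset_of_card _ A h; first by apply: leq_trans mA; rewrite mulSn leq_addr.
have [|H [HA Hdis]] := IH (A :\: B).
  have := cardsID B A; rewrite (setIidPr BA) cB => e; move: mA; rewrite -e mulSn.
  by rewrite leq_add2l.
exists (fun i => if i is i'.+1 then H i' else B); split.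
  by move=> [|i] im //; have [HAB ->] := HA i im; rewrite (subset_trans HAB) ?subsetDl.
have BH i : (i < m)%N -> [disjoint H i & B].
  by move=> /HA[HAB _]; move: HAB; rewrite subsetD => /andP[].
move=> [|i] [|j] //= im jm ij; first by rewrite disjoint_sym BH.
  by rewrite BH.
exact: Hdis.
Qed.

Lemma endgame u t x Z lam (w m N : nat) (p : R) : 0 < lam -> (2 <= w)%N -> (0 < m)%N -> 0 <= p ->
  16 / w%:R + 4352 * w%:R ^+ 6 / m%:R <= p ^+ 4 -> (0 < u)%N ->
  Z \subset below t -> heavy t x Z lam -> (t + #|Z| = n)%N -> ~~ odd #|Z| ->
  (N * (130 * u) <= #|Z|)%N -> (2 <= N)%N -> (2 * (1024 ^ (2 * u) * m) <= N)%N ->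
  cpr (fresh t) x (fun y => `|pm (ent y) setT setT| < lam / (16 * n%:R ^+ 2) ^+ (2 * u))
  <= 200 * u%:R * rho ^+ u + (2 * u)%:R * p.
Proof.
move=> lam0 w2 m0 p0 pE u0 Zt hv tZ oddZ NZ N2 Nm.
have [H [HZ Hdis]] := disjoint_blocks NZ.
have Z132 : (132 * u <= #|Z|)%N.
  apply: leq_trans NZ; apply: (@leq_trans (2 * (130 * u))); first by clear; lia.
  by rewrite leq_mul2r N2 orbT.
pose E i y := [exists G : {set V},
    [&& G \subset H i, #|G| == 2 * u & heavy (n - 2 * u) y G lam]%N].
pose I y := [set i : 'I_N | E i y].
have rk0 : 0 <= rho ^+ u by apply: exprn_ge0; lra.
have NR : 0 < N%:R :> R by rewrite ltr0n ltnW.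
have step : cpr (fresh t) x (fun y => ~~ (N <= 2 * #|I y|)%N) <= 200 * u%:R * rho ^+ u.
  rewrite /cpr; pose f y : R := \sum_(i < N) (~~ E i (mix (fresh t) x y))%:R.
  apply: (@le_trans _ _ (pr (fun y => N%:R / 2 <= f y))).
    apply: pr_le => y; set z := mix _ _ _; rewrite -ltnNge => IN.
    have -> : f y = #|~: I z|%:R.
      rewrite /f -sum1_card natr_sum [RHS]big_mkcond; apply: eq_bigr => i _.
      by rewrite !inE; case: (E i z).
    rewrite ler_pdivrMr // -natrM ler_nat; have := cardsC (I z); rewrite card_ord.
    by move: IN; clear; lia.
  apply: le_trans (markov _ _) _ => [y||]; [exact: sumr_ge0|by rewrite divr_gt0|].
  rewrite ler_pdivrMr ?divr_gt0 // /f Ex_sum.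
  apply: (@le_trans _ _ (\sum_(i < N) (100 * u%:R * rho ^+ u))).
    apply: ler_sum => i _; have [HiZ cH] := HZ i (ltn_ord i).
    exact: chain u0 Zt hv tZ oddZ HiZ cH Z132.
  by rewrite sumr_const card_ord -mulr_natl; lra.
have q0 : 0 <= (2 * u)%:R * p by rewrite mulr_ge0.
have tn : (t <= n - 2 * u)%N by move: Z132 tZ; clear; lia.
apply: (cpr_step (S' := fresh (n - 2 * u)) _ _ step) => //; first by apply: fresh_subset.
move=> y _ IN.
pose G i := odflt set0 [pick G : {set V} |
   [&& G \subset H i, #|G| == 2 * u & heavy (n - 2 * u) y G lam]%N].
have GE (i : 'I_N) : i \in I y -> [&& G i \subset H i, #|G i| == 2 * u & heavy (n - 2 * u) y (G i) lam]%N.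
  by rewrite inE /E /G => /existsP[G0 hG0]; case: pickP => [//|/(_ G0)]; rewrite hG0.
apply: (final_phase (I := I y) (Z := fun i : 'I_N => G i) lam0 w2 m0 p0 pE).
- by move: Z132 tZ; clear; lia.
- by move: IN Nm; clear; lia.
- move=> i /GE/and3P[GH /eqP cG hG]; split=> //; have [HiZ _] := HZ i (ltn_ord i).
  apply: subset_trans (below_subset _ tn); exact: subset_trans GH (subset_trans HiZ Zt).
- move=> i k /GE/and3P[GH _ _] /GE/and3P[GH' _ _] ik.
  by apply: disjointW (Hdis i k _ _ _).
Qed.
End FinalPhase.

(** * From an arbitrary minor to a principal one *)

Section Conversion.
Context (R : realFieldType) (n : nat).
Local Notation V := 'I_n.
Local Notation bits := {ffun V * V -> bool}.
Local Notation pr := (@pr R _).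
Local Notation cpr := (@cpr R _).
Local Notation sg := (@sg R _).
Local Notation ent := (@ent R n).
Local Notation below := (@below n).
Local Notation fresh := (@fresh n).
Implicit Types (x y : bits) (T B : {set V}) (v : V) (t : nat) (lam : R).

Lemma cpr_ge_exists (S : {set V * V}) (Q : bits -> {set V * V}) x (E : pred bits) d :
  (forall y, exists y', E (mix S x (mix (Q x) y y'))) -> (#|Q x| <= d)%N ->
  2 ^- d <= cpr S x E.
Proof.
move=> ex Qd; rewrite /cpr (pr_cpr R (Q x)) -[leLHS](Ex_cst (V * V)%type).
by apply: Ex_le => y; apply: pr_mix_exists.
Qed.

Lemma vertex_pair_prob t v x T B (a b : V) lam : v = t :> nat ->
  T \subset below t -> B \subset below t -> a != b ->
  lam <= `|vertex_coef R x T B a b + vertex_coef R x T B b a| ->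
  1 / 4 <= cpr (fresh t) x (fun y => lam <= `|pm (ent y) (v |: T) (v |: B)|).
Proof.
move=> vt Tt Bt ab lamc; rewrite (_ : 1 / 4 = 2 ^- 2); last by field.
apply: (cpr_ge_exists (Q := fun=> [set (a, v); (b, v)])).
  move=> y; have [y' hy'] := vertex_attempt R x y vt Tt Bt ab.
  by exists y'; apply: le_trans lamc hy'.
by rewrite cards2; case: (_ != _).
Qed.

Lemma vertex_diag_prob t v x T B lam : v = t :> nat ->
  T \subset below t -> B \subset below t -> lam <= `|pm (ent x) T B| ->
  1 / 2 <= cpr (fresh t) x (fun y => lam <= `|pm (ent y) (v |: T) (v |: B)|).
Proof.
move=> vt Tt Bt lamp; rewrite (_ : 1 / 2 = 2 ^- 1); last by field.
have vT : v \notin T by apply/negP => /(subsetP Tt); rewrite inE vt ltnn.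
have vB : v \notin B by apply/negP => /(subsetP Bt); rewrite inE vt ltnn.
apply: (cpr_ge_exists (Q := fun=> [set (v, v)])); last by rewrite cards1.
move=> y; pose z := column v y.
have colE (u : {ffun V -> bool}) : (forall i, i != v -> u i = z i) ->
    column v (mix [set (v, v)] y [ffun q => u q.1]) = u.
  move=> uz; apply/ffunP => i; rewrite !ffunE in_set1 xpair_eqE eqxx andbT.
  by case: eqP => //= /eqP iv; rewrite uz // ffunE.
have flips : vertex_poly R x T B v z - vertex_poly R x T B v (flip v z) =
    2 * sg z v * pm (ent x) T B.
  rewrite /vertex_poly.
  have -> : \sum_j \sum_k vertex_coef R x T B j k * sg (flip v z) j * sg (flip v z) k =
     \sum_j \sum_k vertex_coef R x T B j k * sg z j * sg z k.
    apply: eq_bigr => j _; apply: eq_bigr => k _; rewrite !sg_flip /vertex_coef.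
    have [->|_] := eqVneq j v; first by rewrite (negbTE vT) !mul0r.
    by have [->|_] := eqVneq k v; rewrite ?(negbTE vB) ?andbF ?mul0r.
  rewrite opprD addrACA subrr addr0 -sumrB (bigD1 v) //= big1 ?addr0 => [|j /negbTE jv].
    by rewrite sg_flip eqxx /=; ring.
  by rewrite jv !mul0r subrr.
have zz i : i != v -> flip v z i = z i by move=> /negbTE iv; rewrite ffunE iv addbF.
case: (lerP lam `|vertex_poly R x T B v z|) => h1.
  by exists [ffun q => z q.1]; rewrite (pm_vertex_fresh _ _ _ vt) // colE.
case: (lerP lam `|vertex_poly R x T B v (flip v z)|) => h2.
  by exists [ffun q => flip v z q.1]; rewrite (pm_vertex_fresh _ _ _ vt) // colE.
have := ler_normB (vertex_poly R x T B v z) (vertex_poly R x T B v (flip v z)).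
rewrite flips !normrM norm_sg mulr1 ger0_norm //; lra.
Qed.

(* For [c] of [T :\: B] and [d1, d2] of [B :\: T], put [p = pm T B], and let [p1], [p2] be its
   values after exchanging [c] with [d1], [d2]. The coefficients available at a new vertex are
   [p + p1], [p + p2], [p1 + p2], and these cannot all be small. *)
Lemma conversion_step t v x T B lam : v = t :> nat ->
  T \subset below t -> B \subset below t -> #|T| = #|B| -> (0 < #|T :\: B|)%N ->
  0 < lam -> lam <= `|pm (ent x) T B| ->
  exists T' B' : {set V}, [/\ T' \subset below t, B' \subset below t,
    #|T'| = #|T|.+1 /\ #|B'| = #|T|.+1, #|T' :\: B'|.+1 = #|T :\: B| &
    1 / 4 <= cpr (fresh t) x (fun y => lam / 2 <= `|pm (ent y) (v |: T') (v |: B')|)].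
Proof.
move=> vt Tt Bt TB /card_gt0P[c cX] lam0 lamp.
have memE (X Y : {set V}) k : X = Y -> (k \in X) = (k \in Y) by move=> ->.
have [cB cT] : c \notin B /\ c \in T by move: cX; rewrite inE => /andP[].
have XY : #|T :\: B| = #|B :\: T|.
  by have := cardsID B T; have := cardsID T B; rewrite setIC TB; clear; lia.
have ct := subsetP Tt _ cT.
have Y0 : (0 < #|B :\: T|)%N by rewrite -XY; apply/card_gt0P; exists c.
have subS (S : {set V}) k : k \in below t -> S \subset below t -> k |: S \subset below t.
  by move=> kt St; rewrite subUset sub1set kt.
have B1t := subS _ _ ct Bt.
have cB1 : #|c |: B| = #|T|.+1 by rewrite cardsU1 cB TB.
have YE d : d \in B :\: T -> [/\ d \notin T, d \in B, d != c & d \in below t].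
  rewrite inE => /andP[dT dB]; split=> //; last exact: (subsetP Bt).
  by apply: contraNneq dT => ->.
have open1 d : d \in B :\: T -> [/\ d |: T \subset below t, #|d |: T| = #|T|.+1
    & #|(d |: T) :\: (c |: B)|.+1 = #|T :\: B|].
  move=> /YE[dT dB dc dt]; split; [exact: subS|by rewrite cardsU1 dT|].
  rewrite [RHS](cardsD1 c) cX add1n; congr _.+1; apply: eq_card => k; rewrite !inE.
  have [->|kd] := eqVneq k d; first by rewrite dB !orbT /= !andbF.
  by rewrite negb_or andbA.
have coefdc d : d \in B :\: T -> vertex_coef R x (d |: T) (c |: B) d c = pm (ent x) T B.
  by move=> /YE[dT dB _ _]; rewrite /vertex_coef !in_setU1 !eqxx /= mul1r !setU1K.
pose p d := pm (ent x) ((d |: T) :\ c) ((c |: B) :\ d).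
have coefcd d : d \in B :\: T -> vertex_coef R x (d |: T) (c |: B) c d = p d.
  by move=> /YE[dT dB _ _]; rewrite /vertex_coef !in_setU1 cT dB !orbT /= mul1r.
have use1 d : d \in B :\: T -> lam / 2 <= `|pm (ent x) T B + p d| ->
  exists T' B' : {set V}, [/\ T' \subset below t, B' \subset below t,
    #|T'| = #|T|.+1 /\ #|B'| = #|T|.+1, #|T' :\: B'|.+1 = #|T :\: B| &
    1 / 4 <= cpr (fresh t) x (fun y => lam / 2 <= `|pm (ent y) (v |: T') (v |: B')|)].
  move=> dY lamc; have [s1 s2 s3] := open1 d dY; exists (d |: T), (c |: B); split=> //.
  have [_ _ dc _] := YE d dY.
  by apply: (vertex_pair_prob vt s1 B1t dc); rewrite coefdc // coefcd.
(* With a single [d], exchanging it with [c] swaps [T] and [B]; by symmetry the coefficient is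
   [2 * pm T B]. *)
have [Y1|] := eqVneq #|B :\: T| 1%N.
  have /card_gt0P[d dY] := Y0; apply: (use1 d dY).
  have [dT dB dc dt] := YE d dY.
  have YEd : B :\: T = [set d].
    by apply/esym/eqP; rewrite eqEcard sub1set dY cards1 Y1.
  have XEc : T :\: B = [set c].
    by apply/esym/eqP; rewrite eqEcard sub1set cX cards1 XY Y1.
  have E1 : (d |: T) :\ c = B.
    apply/setP => k; rewrite !inE; have := memE _ _ k YEd; have := memE _ _ k XEc; rewrite !inE.
    have [->|kc] := eqVneq k c; first by rewrite (negbTE cB).
    have [->|kd] := eqVneq k d; first by rewrite dB.
    by case: (k \in T); case: (k \in B).
  have E2 : (c |: B) :\ d = T.
    apply/setP => k; rewrite !inE; have := memE _ _ k YEd; have := memE _ _ k XEc; rewrite !inE.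
    have [->|kd] := eqVneq k d; first by rewrite (negbTE dT).
    have [->|kc] := eqVneq k c; first by rewrite cT.
    by case: (k \in T); case: (k \in B).
  rewrite /p E1 E2 (pm_sym B T (ent_sym R x)).
  rewrite (_ : _ + _ = 2 * pm (ent x) T B); last by ring.
  rewrite normrM ger0_norm //.
  by have := normr_ge0 (pm (ent x) T B); lra.
move=> Y1; have /card_gt1P[d1 [d2 [d1Y d2Y d12]]] : (1 < #|B :\: T|)%N.
  by rewrite ltn_neqAle eq_sym Y1.
case: (lerP (lam / 2) `|pm (ent x) T B + p d1|) => h1; first exact: (use1 d1).
case: (lerP (lam / 2) `|pm (ent x) T B + p d2|) => h2; first exact: (use1 d2).
have [d1T d1B d1c d1t] := YE d1 d1Y; have [d2T d2B d2c d2t] := YE d2 d2Y.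
have TD : (d1 |: (d2 |: (T :\ c))) = d1 |: ((d2 |: T) :\ c) by rewrite setU1D1.
exists (d1 |: (d2 |: (T :\ c))), (c |: B); split=> //.
- by rewrite !subS // (subset_trans (subsetDl _ _)).
- split=> //; rewrite !cardsU1 !in_setU1 !in_setD1 (negbTE d12) (negbTE d1T) (negbTE d2T) !andbF /=.
  by rewrite [X in _ = X.+1](cardsD1 c) cT !add1n.
- rewrite [RHS](cardsD1 c) cX add1n; congr _.+1; apply: eq_card => k; rewrite !inE.
  have [->|kd1] := eqVneq k d1; first by rewrite d1B !orbT /= !andbF.
  have [->|kd2] := eqVneq k d2; first by rewrite d2B !orbT /= !andbF.
  by rewrite negb_or /=; case: (k == c); case: (k \in B).
apply: (@vertex_pair_prob t v x _ _ d2 d1) => //; first by rewrite !subS // (subset_trans (subsetDl _ _)).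
  by rewrite eq_sym.
have -> : vertex_coef R x (d1 |: (d2 |: T :\ c)) (c |: B) d2 d1 = p d1.
  rewrite /vertex_coef !in_setU1 eqxx d1B !orbT /= mul1r /p setUCA setU1K ?(setU1D1 _ d1c) //.
  by rewrite !inE eq_sym (negbTE d12) (negbTE d2T) andbF.
have -> : vertex_coef R x (d1 |: (d2 |: T :\ c)) (c |: B) d1 d2 = p d2.
  rewrite /vertex_coef !in_setU1 eqxx d2B !orbT /= mul1r /p setU1K ?(setU1D1 _ d2c) //.
  by rewrite !inE (negbTE d12) (negbTE d1T) andbF.
have := ler_normD (pm (ent x) T B + p d1) (pm (ent x) T B + p d2).
have := ler_normB (pm (ent x) T B + p d1 + (pm (ent x) T B + p d2)) (p d1 + p d2).
rewrite (_ : _ + _ - _ = 2 * pm (ent x) T B); last by ring.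
rewrite normrM ger0_norm //; lra.
Qed.

(** The final size [s] is prescribed: a successful exchange adds 2 to [#|T|] and takes 1 from both
    [#|T :\: B|] and [u]; once [T = B], a diagonal step adds 1 to [#|T|] and takes 1 from [u]. A
    vertex that does not help is skipped. Success has chance at least [1 / 4] and halves [2 ^ u],
    whence [7 / 8]. *)
Lemma conversion N u s t x T B lam : (t + N <= n)%N -> 0 < lam ->
  T \subset below t -> B \subset below t -> #|T| = #|B| -> (#|T :\: B| <= u)%N ->
  s = (#|T| + #|T :\: B| + u)%N -> lam <= `|pm (ent x) T B| ->
  cpr (fresh t) x (fun y => ~~ [exists S : {set V}, [&& S \subset below (t + N), #|S| == s &
    lam / 2 ^+ u <= `|pm (ent y) S S|]]) <= (2 ^+ u - 1) * (7 / 8) ^+ N.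
Proof.
elim: N u t x T B lam => [|N IH] u t x T B lam tN lam0 Tt Bt TB qu sE lamp.
all: have [u0|u0] := posnP u.
- have TBE : T = B.
    apply/eqP; rewrite eqEcard TB leqnn andbT -setD_eq0 -cards_eq0.
    by move: qu; rewrite u0; case: #|_|.
  subst B.
  rewrite u0 expr0 subrr mul0r le_eqVlt; apply/orP; left; apply/eqP/pr_eq0 => y; rewrite negbK.
  apply/existsP; exists T; rewrite addn0 Tt sE u0 setDv cards0 !addn0 eqxx /= divr1.
  by rewrite (@pm_agree R n t x) // => q; exact: mix_fresh.
- rewrite expr0 mulr1; apply: le_trans (pr_le1 _ _) _; rewrite lerBrDr.
  by rewrite -[X in X <= _]/(2%:R) -[X in X <= _]expr1 ler_eXn2l // ltr1n.
- have TBE : T = B.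
    apply/eqP; rewrite eqEcard TB leqnn andbT -setD_eq0 -cards_eq0.
    by move: qu; rewrite u0; case: #|_|.
  subst B.
  rewrite u0 expr0 subrr mul0r le_eqVlt; apply/orP; left; apply/eqP/pr_eq0 => y; rewrite negbK.
  apply/existsP; exists T; rewrite (subset_trans Tt (below_subset _ (leq_addr _ _))).
  rewrite sE u0 setDv cards0 !addn0 eqxx /= divr1.
  by rewrite (@pm_agree R n t x) // => q; exact: mix_fresh.
have memE (X Y : {set V}) k : X = Y -> (k \in X) = (k \in Y) by move=> ->.
have tn : (t < n)%N by move: tN; clear; lia.
pose v : V := Ordinal tn; have vt : v = t :> nat by [].
have vbel : v \notin below t by rewrite inE ltnn.
have up (S : {set V}) : S \subset below t -> v |: S \subset below t.+1.
  by move=> St; rewrite (below_succ vt) setUS.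
have out (S : {set V}) : S \subset below t -> v \notin S by move=> St; apply: contra vbel => /(subsetP St).
have [T' [B' [T't B't TB' qu' [sE' pr4]]]] : exists T' B' : {set V},
   [/\ T' \subset below t.+1, B' \subset below t.+1, #|T'| = #|B'|, (#|T' :\: B'| <= u.-1)%N &
     s = (#|T'| + #|T' :\: B'| + u.-1)%N /\
     1 / 4 <= cpr (fresh t) x (fun y => lam / 2 <= `|pm (ent y) T' B'|)].
  have [q0|q0] := posnP #|T :\: B|.
    exists (v |: T), (v |: B); rewrite !up // !cardsU1 !out // TB.
    have -> : (v |: T) :\: (v |: B) = set0.
      apply/setP => k; rewrite !inE negb_or; have [->//|kv] := eqVneq k v.
      by have := memE _ _ k (cards0_eq q0); rewrite !inE.
    rewrite cards0; split=> //; split.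
      by move: sE u0; rewrite q0 TB; clear; lia.
    apply: (@le_trans _ _ (1 / 2)); first by lra.
    apply: le_trans (vertex_diag_prob vt Tt Bt lamp) _.
    by apply: pr_le => y /=; apply: le_trans; lra.
  have [T' [B' [T't B't [cT' cB'] q' p4]]] := conversion_step vt Tt Bt TB q0 lam0 lamp.
  have DE : (v |: T') :\: (v |: B') = T' :\: B'.
    apply/setP => k; rewrite !inE negb_or; have [->|//] := eqVneq k v.
    by rewrite (negbTE (out _ T't)) andbF.
  exists (v |: T'), (v |: B'); rewrite !up // !cardsU1 !out // DE cT' cB'; split=> //.
    by move: q' qu; clear; lia.
  by split=> //; move: sE q' u0; clear; lia.
have tN' : (t.+1 + N <= n)%N by move: tN; clear; lia.
set F := fun y => ~~ _.
pose b k : R := (2 ^+ k - 1) * (7 / 8) ^+ N.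
have p7 : 0 <= (7 / 8 : R) ^+ N by apply: exprn_ge0; lra.
have l2 : 0 < lam / 2 by lra.
pose E1 y := lam / 2 <= `|pm (ent y) T' B'|.
have win y : E1 y -> cpr (fresh t.+1) y F <= b u.-1.
  move=> e1; apply: le_trans (IH u.-1 t.+1 y T' B' _ tN' l2 T't B't TB' qu' sE' e1).
  apply: pr_le => z; rewrite /F; apply: contra => /existsP[S /and3P[St cS hS]].
  apply/existsP; exists S; rewrite -addSnnS St cS /=; apply: le_trans hS.
  by rewrite -[in leLHS](prednK u0) exprS invfM mulrA.
have lose y : cpr (fresh t.+1) (mix (fresh t) x y) F <= b u.
  apply: le_trans (IH u t.+1 (mix (fresh t) x y) T B lam tN' lam0 _ _ TB qu sE _).
  - apply: pr_le => z; rewrite /F; apply: contra => /existsP[S hS].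
    by apply/existsP; exists S; rewrite -addSnnS.
  - exact: subset_trans (below_subset _ (leqnSn t)).
  - exact: subset_trans (below_subset _ (leqnSn t)).
  - by rewrite (@pm_agree R n t x) // => q; exact: mix_fresh.
have bmono : b u.-1 <= b u.
  by rewrite ler_wpM2r // lerD2r ler_weXn2l ?ler1n // leq_pred.
have main : cpr (fresh t) x F <=
    Ex (fun y => b u + - (b u - b u.-1) * (E1 (mix (fresh t) x y))%:R).
  rewrite /cpr /pr (cpr_tower (S' := fresh t.+1) x (fun y => (F y)%:R)); last by apply: fresh_subset.
  apply: Ex_le => y; set z := mix (fresh t) x y.
  change (cpr (fresh t.+1) z F <= b u + - (b u - b u.-1) * (E1 z)%:R).
  case: (boolP (E1 z)) => [/win|_] /=; first by lra.
  by rewrite mulr0 addr0; exact: lose.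
apply: (le_trans main); rewrite ExD (Ex_cst _ (b u)) ExZ.
have h1 : (b u - b u.-1) * (1 / 4) <= (b u - b u.-1) * cpr (fresh t) x E1.
  by rewrite ler_wpM2l // subr_ge0.
change (b u + - (b u - b u.-1) * cpr (fresh t) x E1 <= (2 ^+ u - 1) * (7 / 8) ^+ N.+1).
have hb : b u - b u.-1 = 2 ^+ u / 2 * (7 / 8) ^+ N.
  by rewrite /b -(prednK u0) /= exprS; field.
rewrite hb in h1 *; rewrite /b exprS.
by move: h1 p7; set X := (7 / 8) ^+ N; set Y := 2 ^+ u; move: (cpr _ _ _) => U; lra.
Qed.
End Conversion.

(** * Growth of the minors row by row *)

Section Growth.
Context (R : rcfType) (n l e : nat).
Hypothesis l_gt0 : (0 < l)%N.
Hypothesis n_gt0 : (0 < n)%N.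
Local Notation V := 'I_n.
Local Notation bits := {ffun V * V -> bool}.
Local Notation pr := (@pr R _).
Local Notation cpr := (@cpr R _).
Local Notation sg := (@sg R _).
Local Notation ent := (@ent R n).
Local Notation below := (@below n).
Implicit Types (x y : bits) (T B : {set V}) (v b : V) (r j : nat).

Definition block j : {set V} := [set b : V | (l <= b)%N && ((b - l) %/ (l + e) == j)%N].

(* The rows [r] with [r %/ l = j] only use columns of [block j]; these are larger than [r], so
   that their entries are still unrevealed, and [e] of them stay unused. *)
Fixpoint families r : {set {set V}} :=
  if r is r'.+1
  then [set B' : {set V} | [exists b in block (r' %/ l), (b \in B') && (B' :\ b \in families r')]]
  else [set set0].

Definition mass r x : R := \sum_(B in families r) pm (ent x) (below r) B ^+ 2.

Lemma le_gt0 : (0 < l + e)%N. Proof. by rewrite addn_gt0 l_gt0. Qed.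

Lemma block_gt r b : b \in block (r %/ l) -> (r < b)%N.
Proof.
rewrite inE => /andP[lb /eqP bj]; have h := leq_trunc_div (b - l) (l + e).
rewrite bj mulnDr in h.
have := divn_eq r l; have := ltn_pmod r l_gt0; move: lb h.
by move: (r %/ l)%N (r %% l)%N => q m; clear; nia.
Qed.

Lemma families_card r B : B \in families r -> #|B| = r.
Proof.
elim: r B => [|r IH] B; first by rewrite inE => /eqP ->; rewrite cards0.
by rewrite inE => /exists_inP[b _ /andP[bB /IH cB]]; rewrite (cardsD1 b) bB cB.
Qed.

(** Only rows from [j * l] on take columns of [block j]. During batch [j] the bound is below [l],
    which leaves [e] free columns in the block. *)
Lemma families_block r B j : B \in families r -> (#|B :&: block j| <= r - j * l)%N.
Proof.
elim: r B => [|r IH] B; first by rewrite inE => /eqP ->; rewrite set0I cards0.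
rewrite [_ \in _]inE => /exists_inP[b bD /andP[bB /IH cB]].
have [ej|nej] := eqVneq (r %/ l)%N j.
  have -> : (r.+1 - j * l = (r - j * l).+1)%N.
    by rewrite subSn // -ej leq_trunc_div.
  apply: (@leq_trans (#|(B :\ b) :&: block j|.+1)%N); last by rewrite ltnS.
  have sub : B :&: block j \subset b |: ((B :\ b) :&: block j).
    apply/subsetP => k; rewrite in_setI in_setU1 in_setI in_setD1 => /andP[-> ->].
    by rewrite !andbT orbN.
  apply: leq_trans (subset_leq_card sub) _.
  by rewrite cardsU1; case: (_ \notin _).
have -> : B :&: block j = (B :\ b) :&: block j.
  apply/setP => k; rewrite !in_setI in_setD1; have [->|//] := eqVneq k b.
  by move: bD; rewrite !inE => /andP[-> /eqP ->]; rewrite (negbTE nej) !andbF.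
by apply: leq_trans cB _; rewrite leq_sub2r.
Qed.

Lemma families_below r J B : (r <= J * l)%N -> B \in families r ->
  B \subset below (l + J * (l + e)).
Proof.
elim: r B => [|r IH] B rJ; first by rewrite inE => /eqP ->; exact: sub0set.
rewrite inE => /exists_inP[b bD /andP[bB BB]].
rewrite -(setD1K bB) subUset sub1set (IH _ (ltnW rJ) BB) andbT inE.
move: bD; rewrite inE => /andP[lb /eqP bj].
have rl : (r %/ l < J)%N by rewrite ltn_divLR.
have : (b - l < J * (l + e))%N by rewrite -ltn_divLR ?le_gt0 // bj.
by move: lb; clear; lia.
Qed.

Lemma block_card j : (l + j.+1 * (l + e) <= n)%N -> (l + e <= #|block j|)%N.
Proof.
move=> jn.
have bd (i : 'I_(l + e)) : (l + j * (l + e) + i < n)%N.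
  by apply: leq_trans jn; rewrite mulSn; have := ltn_ord i; clear; lia.
pose f (i : 'I_(l + e)) : V := Ordinal (bd i).
have f_inj : injective f.
  move=> i k /(congr1 val) /= /eqP; rewrite eqn_add2l => /eqP; exact: val_inj.
rewrite -[X in (X <= _)%N]card_ord -(card_imset predT f_inj).
apply/subset_leq_card/subsetP => _ /imsetP[i _ ->].
rewrite inE /= -!addnA leq_addr /= addKn divnMDl ?le_gt0 //.
by rewrite divn_small ?addn0 // ltn_ord.
Qed.

Lemma unused_card r B : (l + (r %/ l).+1 * (l + e) <= n)%N -> B \in families r ->
  (e <= #|block (r %/ l) :\: B|)%N.
Proof.
move=> rn BB; have := block_card rn; have := families_block (r %/ l) BB.
rewrite -(cardsID B (block (r %/ l))) setIC.
have := divn_eq r l; have := ltn_pmod r l_gt0.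
move: (r %/ l)%N (r %% l)%N => q m; move: #|_| #|_| => a b.
by clear; nia.
Qed.

(** With [D] the block of row [v], these pairs lie above the diagonal, and they occur in no minor
    whose rows precede [v]. *)
Definition row_bits v (D : {set V}) : {set V * V} := [set p : V * V | (p.1 == v) && (p.2 \in D)].

Section Step.
Variables (r : nat) (v : V).
Hypothesis vr : v = r :> nat.
Hypothesis room : (l + (r %/ l).+1 * (l + e) <= n)%N.
Local Notation D := (block (r %/ l)).
Local Notation S := (row_bits v D).

Lemma ent_row_old x y (i c : V) : (i < r)%N -> ent (mix S x y) i c = ent x i c.
Proof.
move=> ir; rewrite /ent /sg ffunE inE /edge.
case: leqP => ic /=; rewrite -val_eqE /= vr ltn_eqF //; exact: ltn_trans ir.
Qed.

Lemma pm_row_old x y B : pm (ent (mix S x y)) (below r) B = pm (ent x) (below r) B.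
Proof. by apply: eq_pm => i j; rewrite inE => ir _; exact: ent_row_old. Qed.

Lemma ent_row_new x y b : ent (mix S x y) v b = if b \in D then sg y (v, b) else ent x v b.
Proof.
rewrite /ent /sg ffunE inE; have := @block_gt r b; rewrite /edge.
case: (boolP (b \in D)) => bD h /=.
  by rewrite vr ltnW ?h //= eqxx bD.
case: leqP => vb /=; first by rewrite eqxx (negbTE bD).
by rewrite -val_eqE /= (ltn_eqF vb).
Qed.

Lemma mass_old x y : mass r (mix S x y) = mass r x.
Proof. by apply: eq_bigr => B _; rewrite pm_row_old. Qed.

Lemma pm_row_expand x y B' : pm (ent (mix S x y)) (below r.+1) B' =
  \sum_(b in B') (if b \in D then sg y (v, b) else ent x v b) * pm (ent x) (below r) (B' :\ b).
Proof.
rewrite (below_succ vr) pm_row; last by rewrite inE vr ltnn.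
by apply: eq_bigr => b _; rewrite ent_row_new pm_row_old.
Qed.

Lemma families_succ b B : b \in D -> b \notin B -> B \in families r -> b |: B \in families r.+1.
Proof.
by move=> bD bB BB; rewrite inE; apply/exists_inP; exists b => //; rewrite setU11 setU1K.
Qed.

Lemma sum_families_le (F : {set V} -> R) b : b \in D -> (forall B, 0 <= F B) ->
  \sum_(B in families r | b \notin B) F (b |: B) <= \sum_(B in families r.+1 | b \in B) F B.
Proof.
move=> bD F0; rewrite [leRHS](reindex_onto (fun B => b |: B) (fun B => B :\ b)) /=; last first.
  by move=> B /andP[_ bB]; rewrite setD1K.
rewrite big_mkcond [leRHS]big_mkcond; apply: ler_sum => B _.
case: ifP => [/andP[BB bB]|_]; last by case: ifP.
by rewrite families_succ // setU11 setU1K // eqxx.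
Qed.

Lemma mass_ge0 s x : 0 <= mass s x.
Proof. by apply: sumr_ge0 => B _; exact: sqr_ge0. Qed.

(** The new minors form a vector with coordinates [B'], a signed sum over the columns [b], and
    [mass] is its squared length. The vector attached to [b] has squared length [wt b], and many of
    these are large. *)
Lemma mass_growth (k w : nat) (beta : R) x : (0 < w)%N -> (32 * w ^ 2 <= e)%N ->
  beta = k%:R ^+ 2 * e%:R / (128 * n%:R) ->
  cpr S x (fun y => mass r.+1 y < beta * mass r y) <= 64 * (k.*2.+1)%:R / w%:R.
Proof.
move=> w0 we betaE; set q := mass r x.
have nR : 0 < n%:R :> R by rewrite ltr0n.
have eR : 0 < e%:R :> R by rewrite ltr0n (leq_trans _ we) // muln_gt0 expn_gt0 w0.
have bound0 : 0 <= 64 * (k.*2.+1)%:R / w%:R :> R by rewrite divr_ge0 ?mulr_ge0.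
have [q0|qn0] := eqVneq q 0.
  rewrite /cpr pr_eq0 // => y; rewrite mass_old -/q q0 mulr0 -leNgt; exact: mass_ge0.
have q_gt0 : 0 < q by rewrite lt_neqAle eq_sym qn0 mass_ge0.
pose p B := pm (ent x) (below r) B.
pose wt b := \sum_(B in families r | b \notin B) p B ^+ 2.
pose thr := e%:R * q / (2 * n%:R).
have thr0 : 0 < thr by rewrite divr_gt0 ?mulr_gt0.
pose G := [set b in D | thr <= wt b].
have wtq b : wt b <= q.
  rewrite /wt /q /mass big_mkcondr; apply: ler_sum => B _; case: ifP => // _; exact: sqr_ge0.
have wt0 b : 0 <= wt b by apply: sumr_ge0 => B _; exact: sqr_ge0.
have sum_wt : e%:R * q <= \sum_(b in D) wt b.
  rewrite /wt (exchange_big_dep (mem (families r))) /= => [|b B bD /andP[]] //; rewrite /q /mass mulr_sumr.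
  apply: ler_sum => B BB; rewrite -/(p B).
  rewrite (eq_bigl (fun b => b \in D :\: B)) => [|b]; last by rewrite !inE BB andbC.
  rewrite sumr_const -[leRHS]mulr_natl ler_wpM2r ?sqr_ge0 // ler_nat; exact: unused_card.
(* Each [B] leaves at least [e] columns of the block free, so the [wt b] sum to at least [e * q].
   Columns below [thr] account for at most half of this, and any other column for at most [q]. *)
have G2 : (e <= 2 * #|G|)%N.
  rewrite -(ler_nat R) natrM -(ler_pM2r q_gt0).
  have : \sum_(b in D) wt b <= #|G|%:R * q + n%:R * thr.
    rewrite (bigID (mem G)) /=; apply: lerD.
      apply: (@le_trans _ _ (\sum_(b in G) q)); last by rewrite sumr_const mulr_natl.
      by rewrite big_mkcond [leRHS]big_mkcond; apply: ler_sum => b _;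
        case: (boolP (b \in G)) => bG; rewrite ?andbT ?andbF //; case: ifP => // _; exact: ltW.
    apply: (@le_trans _ _ (\sum_(b : V) thr)); last by rewrite sumr_const card_ord mulr_natl.
    rewrite big_mkcond; apply: ler_sum => b _; case: ifP => [/andP[bD]|_]; last exact: ltW.
    by rewrite inE bD /= -ltNge => /ltW.
  have -> : n%:R * thr = e%:R * q / 2 by rewrite /thr; field; rewrite gt_eqF.
  lra.
pose rr := Num.sqrt thr.
have rr0 : 0 < rr by rewrite sqrtr_gt0.
have rr2 : rr ^+ 2 = thr by rewrite sqr_sqrtr // ltW.
pose vec (b : V) (B' : {set V}) : R :=
  if [&& b \in D, b \in B' & B' \in families r.+1] then p (B' :\ b) else 0.
pose vec0 (B' : {set V}) : R := if B' \in families r.+1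
  then \sum_(b in B' | b \notin D) ent x v b * p (B' :\ b) else 0.
have vecG b : b \in G -> rr ^+ 2 <= \sum_B' vec b B' ^+ 2.
  rewrite inE rr2 => /andP[bD]; move/le_trans; apply.
  apply: le_trans (_ : _ <= \sum_(B in families r.+1 | b \in B) p (B :\ b) ^+ 2) _.
    have := @sum_families_le (fun B => p (B :\ b) ^+ 2) b bD (fun B => sqr_ge0 _).
    apply: le_trans; rewrite le_eqVlt; apply/orP; left; apply/eqP.
    by apply: eq_bigr => B /andP[_ bB]; rewrite setU1K.
  rewrite big_mkcond; apply: ler_sum => B _; rewrite /vec bD /= andbC.
  by case: ifP => // _; rewrite expr0n.
have w16 : (16 * w ^ 2 <= #|G|)%N by move: we G2; clear; lia.
have b0 : 0 <= beta * q.
  by rewrite mulr_ge0 ?mass_ge0 // betaE divr_ge0 ?mulr_ge0 ?exprn_ge0.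
have bk : 64 * (beta * q) <= (k%:R * rr) ^+ 2.
  rewrite exprMn rr2 /thr betaE le_eqVlt; apply/orP; left; apply/eqP; field.
  by rewrite gt_eqF.
have := littlewood_offord_vector vec0 rr0 b0 vecG w0 w16 bk; apply: le_trans.
pose phi (b : V) := (v, b); have phi_inj : injective phi by move=> b c [].
rewrite /cpr /pr -[leRHS](Ex_pushforward _ phi_inj); apply: Ex_le => y.
set z := [ffun b => y (phi b)].
have zE b : sg z b = sg y (v, b) by congr ((-1) ^+ nat_of_bool _); rewrite ffunE.
have -> : mass r.+1 (mix S x y) = \sum_B' (vec0 B' + \sum_b vec b B' * sg z b) ^+ 2.
  rewrite /mass big_mkcond; apply: eq_bigr => B' _; rewrite /vec0 /vec.
  case: ifP => B'F; last first.
    rewrite big1 ?addr0 ?expr0n // => b _; by rewrite !andbF mul0r.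
  rewrite pm_row_expand (bigID (mem D)) /= addrC; congr ((_ + _) ^+ 2).
    by apply: eq_bigr => b /andP[_ /negbTE ->].
  rewrite big_mkcond; apply: eq_bigr => b _; rewrite andbT andbC.
  case: ifP => [/andP[bD _]|_]; last by rewrite mul0r.
  by rewrite bD mulrC zE.
rewrite mass_old -/q ler_nat; by case: ltP => //= /ltW ->.
Qed.

(** For a fixed [B], adding a free column [b] gives a minor that changes by [2 * p B] when the sign
    [(v, b)] flips; hence all of [e] free columns fail with probability at most [2 ^ - e]. By
    Markov, sets [B] for which they all fail rarely carry half of the mass. *)
Lemma mass_survival x :
  cpr S x (fun y => mass r.+1 y < (2 * n%:R)^-1 * mass r y) <= 2 * 2 ^- e.
Proof.
set q := mass r x.
have nR : 0 < n%:R :> R by rewrite ltr0n.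
have pw0 : 0 < 2 ^- e :> R by rewrite invr_gt0 exprn_gt0.
have [q0|qn0] := eqVneq q 0.
  rewrite /cpr pr_eq0 => [|y]; first by rewrite mulr_ge0 // ltW.
  rewrite mass_old -/q q0 mulr0 -leNgt; exact: mass_ge0.
have q_gt0 : 0 < q by rewrite lt_neqAle eq_sym qn0 mass_ge0.
pose p B := pm (ent x) (below r) B.
pose P y b (B : {set V}) := pm (ent (mix S x y)) (below r.+1) (b |: B).
pose ok y (B : {set V}) := [exists b in D :\: B, `|p B| <= `|P y b B|].
have pr_bad B : B \in families r -> pr (fun y => ~~ ok y B) <= 2 ^- e.
  move=> BB; have cE := unused_card room BB.
  have [e0|e0] := posnP e; first by rewrite e0 expr0 invr1 pr_le1.
  have /card_gt0P[d _] := leq_trans e0 cE.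
  pose c i := nth d (enum (D :\: B)) i.
  have cD i : (i < e)%N -> c i \in D :\: B.
    by move=> ie; rewrite -mem_enum mem_nth // -cardE (leq_trans ie).
  have c_inj i j : (i < e)%N -> (j < e)%N -> i != j -> c i != c j.
    by move=> ie je ij; rewrite nth_uniq ?enum_uniq // -cardE (leq_trans _ cE).
  have := @pr_independent_attempts R _ e 1 (fun i => [set (v, c i)])
    (fun i y => `|p B| <= `|P y (c i) B|).
  have -> : 1 - 2 ^- 1 = 2^-1 :> R by field.
  rewrite exprVn => h; apply: le_trans (h _ _ _).
  - apply: pr_le => y /exists_inPn hy; apply/allP => i; rewrite mem_iota add0n => /andP[_ ie].
    by apply: hy; exact: cD.
  - by move=> i _; rewrite cards1.
  - move=> i y ie; have := cD i ie; rewrite in_setD => /andP[cB cDD].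
    pose u y := \sum_(b in B) (if b \in D then sg y (v, b) else ent x v b) * pm (ent x) (below r) ((c i |: B) :\ b).
    have PE y0 : P y0 (c i) B = sg y0 (v, c i) * p B + u y0.
      by rewrite /P pm_row_expand big_setU1 //= cDD setU1K.
    have uE y0 : u (flip (v, c i) y0) = u y0.
      apply: eq_bigr => b bB; rewrite sg_flip xpair_eqE eqxx /=.
      by have [be|//] := eqVneq b (c i); rewrite -be bB in cB.
    have [h1|h1] := lerP `|p B| `|P y (c i) B|; first by exists y; rewrite mixx.
    exists (flip (v, c i) y).
    have -> : mix [set (v, c i)] y (flip (v, c i) y) = flip (v, c i) y.
      apply/ffunP => j; rewrite !ffunE in_set1; case: eqP => // _.
      by rewrite addbF.
    move: h1; rewrite !PE uE sg_flip eqxx => h1.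
    have := ler_normB (sg y (v, c i) * p B + u y) (- sg y (v, c i) * p B + u y).
    rewrite (_ : _ + u y - _ = 2 * sg y (v, c i) * p B); last by ring.
    rewrite !normrM norm_sg mulr1 ger0_norm //; lra.
  - move=> i j y y' ie je ij; congr (_ <= `|_|); rewrite /P !pm_row_expand.
    apply: eq_bigr => b bB; congr (_ * _); case: ifP => // _; rewrite /sg !ffunE in_set1.
    rewrite xpair_eqE eqxx /=; have [be|//] := eqVneq b (c j).
    move: bB; rewrite be in_setU1 eq_sym (negbTE (c_inj i j ie je ij)) /=.
    by have := cD j je; rewrite in_setD => /andP[/negbTE ->].
pose f y := \sum_(B in families r) p B ^+ 2 * (~~ ok y B)%:R.
have Ef : Ex f <= 2 ^- e * q.
  rewrite /f Ex_sum /q /mass mulr_sumr; apply: ler_sum => B BB; rewrite ExZ mulrC.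
  by rewrite ler_wpM2r ?sqr_ge0 // -/(pr _) pr_bad.
(* A set [B'] arises from at most one [B] for each column [b], hence is counted at most [n]
   times. *)
have good y : \sum_(B in families r) p B ^+ 2 * (ok y B)%:R <= n%:R * mass r.+1 (mix S x y).
  apply: (@le_trans _ _ (\sum_(B in families r) \sum_(b in D :\: B) P y b B ^+ 2)).
    apply: ler_sum => B _; case: (boolP (ok y B)) => [/exists_inP[b bDB hb]|_] /=; last first.
      by rewrite mulr0; apply: sumr_ge0 => *; exact: sqr_ge0.
    rewrite mulr1 (bigD1 b) //= -[X in X <= _]real_normK ?num_real //.
    rewrite -[X in _ <= X + _]real_normK ?num_real //.
    apply: le_trans (_ : _ <= `|P y b B| ^+ 2) _; first by rewrite ler_sqr ?nnegrE.
    by rewrite lerDl; apply: sumr_ge0 => *; exact: sqr_ge0.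
  rewrite (exchange_big_dep (mem D)) /= => [|B b _]; last by rewrite inE => /andP[].
  apply: (@le_trans _ _ (\sum_(b in D) mass r.+1 (mix S x y))); last first.
    rewrite sumr_const -[leLHS]mulr_natl ler_wpM2r ?mass_ge0 // ler_nat.
    by rewrite -[X in (_ <= X)%N]card_ord max_card.
  apply: ler_sum => b bD.
  pose F B := pm (ent (mix S x y)) (below r.+1) B ^+ 2.
  apply: (@le_trans _ _ (\sum_(B in families r.+1 | b \in B) F B)).
    apply: le_trans (sum_families_le bD (fun B => sqr_ge0 _ : 0 <= F B)).
    rewrite le_eqVlt; apply/orP; left; apply/eqP; apply: eq_bigl => B.
    by rewrite in_setD bD andbT.
  rewrite /mass big_mkcondr; apply: ler_sum => B _; case: ifP => // _; exact: sqr_ge0.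
apply: (@le_trans _ _ (pr (fun y => q / 2 <= f y))).
  apply: pr_le => y; rewrite mass_old -/q => hy.
  have : f y + \sum_(B in families r) p B ^+ 2 * (ok y B)%:R = q.
    rewrite -big_split; apply: eq_bigr => B _ /=.
    by case: (ok y B); rewrite ?mulr0 ?mulr1 ?add0r ?addr0.
  have := good y; have : n%:R * mass r.+1 (mix S x y) < q / 2.
    rewrite -(ltr_pM2l nR) in hy; apply: lt_le_trans hy _.
    by rewrite le_eqVlt; apply/orP; left; apply/eqP; field; rewrite gt_eqF.
  lra.
apply: le_trans (markov _ _) _ => [y||].
- by apply: sumr_ge0 => B _; rewrite mulr_ge0 // sqr_ge0.
- lra.
rewrite ler_pdivrMr; last lra.
by move: Ef; set X := 2 ^- e; lra.
Qed.

End Step.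

Lemma mass0 x : mass 0 x = 1.
Proof.
by rewrite /mass big_set1 (_ : below 0 = set0) ?pm_set0 ?eqxx ?expr1n //.
Qed.

Lemma growth (J rows k w f : nat) (beta delta p : R) :
  (rows <= J * l)%N -> (l + J * (l + e) <= n)%N ->
  (0 < w)%N -> (32 * w ^ 2 <= e)%N -> 64 * (k.*2.+1)%:R / w%:R <= p ->
  0 < beta -> beta = k%:R ^+ 2 * e%:R / (128 * n%:R) ->
  0 < delta -> delta <= 1 -> beta * delta = (2 * n%:R)^-1 ->
  pr (fun x => mass rows x < beta ^+ rows * delta ^+ f) <=
    2 ^+ rows * p ^+ f + rows%:R * (2 * 2 ^- e).
Proof.
move=> rowsJ room w0 we wp beta0 betaE delta0 delta1 bd.
have p0 : 0 <= p by apply: le_trans wp; rewrite divr_ge0 ?mulr_ge0.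
have nR : 0 < n%:R :> R by rewrite ltr0n.
have rn r : (r < rows)%N -> (l + (r %/ l).+1 * (l + e) <= n)%N.
  move=> rr; apply: leq_trans room; rewrite leq_add2l leq_mul2r; apply/orP; right.
  by rewrite ltn_divLR // (leq_trans rr).
have vn r : (r < rows)%N -> (r < n)%N.
  move=> rr; apply: (leq_trans rr); apply: (leq_trans rowsJ); apply: leq_trans room.
  by rewrite mulnDr; clear; lia.
pose gam : R := (2 * n%:R)^-1.
pose dies r x := mass r.+1 x < gam * mass r x.
pose dead r x := has (fun s => dies s x) (iota 0 r).
pose X r j x := mass r x < beta ^+ r * delta ^+ j.
have pr_dies (r : nat) : (r < rows)%N -> pr (dies r) <= 2 * 2 ^- e.
  move=> rr; pose v : V := Ordinal (vn r rr).
  rewrite (pr_cpr R (row_bits v (block (r %/ l)))) -[leRHS](Ex_cst (V * V)%type).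
  by apply: Ex_le => x; apply: mass_survival => //; exact: rn.
have pr_dead : pr (dead rows) <= rows%:R * (2 * 2 ^- e).
  have : forall r, (r <= rows)%N -> pr (dead r) <= r%:R * (2 * 2 ^- e).
    elim=> [|r IH] rr; first by rewrite mul0r pr_eq0.
    apply: (@le_trans _ _ (pr (dead r) + pr (dies r))); last first.
      by rewrite -[r.+1]addn1 natrD mulrDl mul1r lerD ?pr_dies // IH // ltnW.
    rewrite -ExD; apply: Ex_le => x; rewrite /dead -addn1 iotaD has_cat add0n /= orbF.
    by case: (has _ _); case: (dies r x); rewrite /= ?addr0 ?add0r ?lerDl.
  exact.
have old r s (rr : (r < rows)%N) x y : (s <= r)%N ->
    mass s (mix (row_bits (Ordinal (vn r rr)) (block (r %/ l))) x y) = mass s x.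
  move=> sr; apply: eq_bigr => B _; congr (_ ^+ 2); apply: eq_pm => i j.
  by rewrite inE => is_ _; rewrite ent_row_old // (leq_trans is_).
(* Instead of choosing a set of bad rows, the recursion asks whether the last row is bad:
   [2 ^ r * p ^ j.+1] if it is not, [p * (2 ^ r * p ^ j)] if it is. *)
have main r j : (r <= rows)%N -> pr (fun x => X r j x && ~~ dead r x) <= 2 ^+ r * p ^+ j.
  elim: r j => [|r IH] j rr.
    rewrite pr_eq0 ?mulr_ge0 ?exprn_ge0 // => x; rewrite /X /dead /= andbT mass0 expr0 mul1r.
    by rewrite -leNgt exprn_ile1 // ltW.
  case: j => [|j].
    by rewrite expr0 mulr1; apply: le_trans (pr_le1 _ _) _; rewrite exprn_ege1 // ler1n.
  pose v : V := Ordinal (vn r rr); pose S := row_bits v (block (r %/ l)).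
  pose Y x := X r j x && ~~ dead r x.
  have Yold x y : Y (mix S x y) = Y x.
    rewrite /Y /X /dead old //; congr (_ && ~~ _); apply: eq_in_has => s.
    by rewrite mem_iota add0n => /andP[_ sr]; rewrite /dies !old // ltnW.
  have stepY : pr (fun x => Y x && (mass r.+1 x < beta * mass r x)) <= p * pr Y.
    rewrite (pr_cpr R S) -ExZ; apply: Ex_le => x; rewrite /cpr.
    rewrite (_ : pr _ = Ex (fun y => (Y x)%:R * (mass r.+1 (mix S x y) < beta * mass r (mix S x y))%R%:R)); last first.
      by apply: eq_Ex => y; rewrite Yold -natrM mulnb.
    rewrite ExZ mulrC ler_wpM2r //; apply: le_trans wp.
    by apply: mass_growth betaE => //; exact: rn.
  apply: (@le_trans _ _ (pr (fun x => X r j.+1 x && ~~ dead r x) +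
     pr (fun x => Y x && (mass r.+1 x < beta * mass r x)))).
    rewrite -ExD; apply: Ex_le => x; rewrite /Y /dead -addn1 iotaD has_cat add0n /= orbF negb_or.
    rewrite -/(dead r x); case: (boolP (dead r x)) => dr; first by rewrite !andbF /= addr0.
    rewrite !andbT /= /dies -leNgt; case: (boolP (X r j.+1 x)) => Xr /=.
      by rewrite -natrD ler_nat; case: (_ && _).
    rewrite add0r ler_nat addn1; case: (boolP (X r.+1 j.+1 x)) => //= Xr'.
    case: (lerP (gam * mass r x) _) => //= gm.
    rewrite /X -leNgt in Xr; rewrite /X in Xr'.
    have -> : X r j x.
      rewrite /X -(ltr_pM2l (_ : 0 < gam)) ?invr_gt0 ?mulr_gt0 //.
      apply: le_lt_trans gm _; apply: lt_le_trans Xr' _.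
      by rewrite /gam -bd !exprS le_eqVlt; apply/orP; left; apply/eqP; ring.
    rewrite (lt_le_trans Xr') // exprS -mulrA ler_wpM2l // ltW //.
  apply: le_trans (lerD (IH _ (ltnW rr)) stepY) _.
  have := ler_wpM2l p0 (IH j (ltnW rr)); rewrite !exprS -/Y; lra.
apply: (@le_trans _ _ (pr (fun x => X rows f x && ~~ dead rows x) + pr (dead rows))).
  rewrite -ExD; apply: Ex_le => x; rewrite -/(X rows f x).
  by case: (X rows f x); case: (dead rows x); rewrite /= ?addr0 ?add0r.
by apply: lerD; [exact: main|].
Qed.

Lemma mass_heavy rows x theta : theta <= mass rows x -> 0 < theta ->
  exists2 B, B \in families rows & theta / 2 ^+ n <= pm (ent x) (below rows) B ^+ 2.
Proof.
move=> hm theta0; apply/exists_inP; apply: contraLR hm => /exists_inPn h; rewrite -ltNge.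
have F0 : (#|families rows| <= 2 ^ n)%N.
  rewrite -[X in (_ <= 2 ^ X)%N]card_ord -cardsT -card_powerset; apply/subset_leq_card/subsetP.
  by move=> B _; rewrite powersetE subsetT.
have p2 : 0 < 2 ^+ n :> R by rewrite exprn_gt0.
have [F00|Fn0] := posnP #|families rows|.
  by rewrite /mass (cards0_eq F00) big_set0.
apply: (@lt_le_trans _ _ (\sum_(B in families rows) theta / 2 ^+ n)).
  have /card_gt0P[B0 B0F] := Fn0; rewrite /mass (bigD1 B0) //= [ltRHS](bigD1 B0) //=.
  apply: ltr_leD; first by rewrite ltNge h.
  by apply: ler_sum => B /andP[BF _]; rewrite ltW // ltNge h.
rewrite sumr_const -[leLHS]mulr_natl mulrA ler_pdivrMr // mulrC ler_pM2l //.
by rewrite -natrX ler_nat.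
Qed.
End Growth.

(** * Combination of the phases *)

Section Assembly.
Context (R : rcfType) (n : nat).
Local Notation V := 'I_n.
Local Notation bits := {ffun V * V -> bool}.
Local Notation pr := (@pr R _).
Local Notation cpr := (@cpr R _).
Local Notation ent := (@ent R n).
Local Notation below := (@below n).
Local Notation fresh := (@fresh n).
Local Notation rho := (15 / 16 : R).
Implicit Types (x y : bits).

Lemma card_below t : (t <= n)%N -> #|below t| = t.
Proof.
elim: t => [|t IH] tn.
  by apply/eqP; rewrite cards_eq0 -subset0; apply/subsetP => i; rewrite inE ltn0.
have vt : Ordinal tn = t :> nat by [].
by rewrite (below_succ vt) cardsU1 inE ltnn IH // ltnW.
Qed.

Section Assembled.
Variables (l e J k w1 f N u w2 m M : nat) (beta delta p1 p2 : R).
Local Notation rows := (J * l)%N.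
Local Notation gap := (l + J * e)%N.
Hypothesis l_gt0 : (0 < l)%N.
Hypothesis n_gt0 : (0 < n)%N.
Hypothesis w1_gt0 : (0 < w1)%N.
Hypothesis w1e : (32 * w1 ^ 2 <= e)%N.
Hypothesis kw1 : 64 * (k.*2.+1)%:R / w1%:R <= p1.
Hypothesis beta_gt0 : 0 < beta.
Hypothesis betaE : beta = k%:R ^+ 2 * e%:R / (128 * n%:R).
Hypothesis delta_gt0 : 0 < delta.
Hypothesis delta_le1 : delta <= 1.
Hypothesis beta_delta : beta * delta = (2 * n%:R)^-1.
Hypothesis roomN : (2 * (l + J * (l + e) + N) <= n + rows)%N.
Hypothesis roomM : (2 * (M * (130 * u)) + rows + 2 * gap + 3 <= n)%N.
Hypothesis w2_gt1 : (2 <= w2)%N.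
Hypothesis m_gt0 : (0 < m)%N.
Hypothesis p2_ge0 : 0 <= p2.
Hypothesis p2E : 16 / w2%:R + 4352 * w2%:R ^+ 6 / m%:R <= p2 ^+ 4.
Hypothesis u_gt0 : (0 < u)%N.
Hypothesis M_gt1 : (2 <= M)%N.
Hypothesis Mm : (2 * (1024 ^ (2 * u) * m) <= M)%N.

Let theta : R := beta ^+ rows * delta ^+ f.
Let lam0 : R := Num.sqrt (theta / 2 ^+ n).
Let lam1 : R := lam0 / 2 ^+ (gap + 3).

Lemma theta_gt0 : 0 < theta. Proof. by rewrite mulr_gt0 // exprn_gt0. Qed.

Lemma lam0_gt0 : 0 < lam0.
Proof. by rewrite sqrtr_gt0 divr_gt0 ?theta_gt0 // exprn_gt0. Qed.

Lemma room : (l + J * (l + e) <= n)%N.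
Proof. by move: roomN; rewrite mulnDr; clear; lia. Qed.

Definition small_permanent x : bool :=
  `|pm (ent x) setT setT| < lam1 / (16 * n%:R ^+ 2) ^+ (2 * u).

(** The endgame needs [t' + #|Z| = n], and [#|Z| = t' - s] for a principal minor of size [s]: this
    forces [t' = (n + s) / 2]. Divisibility by 4 makes [#|Z|] an even integer. *)
Lemma principal_endgame t s x (S : {set V}) : S \subset below t -> #|S| = s ->
  lam1 <= `|pm (ent x) S S| -> (2 * t <= n + s)%N -> (4 %| n - s)%N -> (s <= n)%N ->
  (2 * (M * (130 * u)) + s <= n)%N ->
  cpr (fresh ((n + s)./2)) x small_permanent <= 200 * u%:R * rho ^+ u + (2 * u)%:R * p2.
Proof.
move=> St cS hS tn n4 sn Ms; set t' := (n + s)./2.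
case/dvdnP: n4 => q qE.
have nE : n = (s + q * 4)%N by rewrite -qE subnKC.
have t'E : t' = (s + 2 * q)%N.
  by rewrite /t' nE (_ : (s + q * 4 + s = (s + 2 * q).*2)%N) ?doubleK // -!muln2; clear; lia.
have St' : S \subset below t'.
  apply: subset_trans St _; apply: below_subset; rewrite t'E.
  by move: tn nE; clear; lia.
pose Z := below t' :\: S.
have ZE : below t' :\: Z = S by rewrite /Z setDDr setDv set0U; apply/setIidPr.
have cZ : #|Z| = (2 * q)%N.
  have := cardsID S (below t'); rewrite (setIidPr St') cS card_below -/Z; last first.
    by rewrite t'E; move: nE; clear; lia.
  by rewrite t'E; clear; lia.
have lam1_gt0 : 0 < lam1 by rewrite divr_gt0 ?lam0_gt0 // exprn_gt0.
apply: (endgame (Z := Z) lam1_gt0 w2_gt1 m_gt0 p2_ge0 p2E u_gt0 _ _ _ _ _ M_gt1 Mm).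
- exact: subsetDl.
- by rewrite /heavy ZE.
- by rewrite cZ t'E; move: nE; clear; lia.
- by rewrite cZ oddM.
- by rewrite cZ; move: Ms nE; clear; lia.
Qed.

Lemma permanent_lower : pr small_permanent <=
  2 ^+ rows * p1 ^+ f + rows%:R * (2 * 2 ^- e) +
  (2 ^+ (gap + 3) * (7 / 8) ^+ N + (200 * u%:R * rho ^+ u + (2 * u)%:R * p2)).
Proof.
(* All columns of the families lie below [t0], so the minor found by [growth] is fixed once the
   first [t0] vertices are revealed. *)
pose t0 := (l + J * (l + e))%N.
have err3 : 0 <= 200 * u%:R * rho ^+ u + (2 * u)%:R * p2.
  by rewrite addr_ge0 ?mulr_ge0 // exprn_ge0 //; lra.
have p7 (i : nat) : 0 <= (7 / 8 : R) ^+ i by apply: exprn_ge0; lra.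
have step1 : pr (fun x => ~~ (theta <= mass R l e (J * l) x)) <=
    2 ^+ rows * p1 ^+ f + rows%:R * (2 * 2 ^- e).
  apply: le_trans (growth l_gt0 n_gt0 f (leqnn _) room w1_gt0 w1e kw1 beta_gt0
    betaE delta_gt0 delta_le1 beta_delta).
  by apply: pr_le => x; rewrite -ltNge.
apply: (pr_step (S := fresh t0) _ step1).
  by rewrite addr_ge0 // mulr_ge0 // exprn_ge0.
move=> x hx; have [B BF hB] := mass_heavy hx theta_gt0.
have Bt := families_below l_gt0 (leqnn _) BF.
have cB := families_card BF.
have hB' : lam0 <= `|pm (ent x) (below rows) B|.
  by rewrite -sqrtr_sqr ler_wsqrtr.
have rt0 : (rows <= t0)%N by rewrite /t0 mulnDr; clear; lia.
have rn : (rows <= n)%N by apply: leq_trans rt0 room.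
set T := below rows in hB'; set q := #|T :\: B|.
have qgap : (q <= gap)%N.
  have BT : #|B :\: T| = q.
    have := cardsID B T; have := cardsID T B; rewrite setIC cB (card_below rn) /q; clear; lia.
  have sub : B :\: T \subset below t0 :\: T by exact: setSD.
  rewrite -BT (leq_trans (subset_leq_card sub)) //.
  have := cardsID T (below t0); rewrite (setIidPr (below_subset _ rt0)) !card_below //; last exact: room.
  by rewrite /t0 mulnDr; clear; lia.
(* At most three extra diagonal steps adjust the size modulo 4; they are the 3 in [gap + 3]. *)
pose a := ((n - rows - 2 * q) %% 4)%N.
have a3 : (a <= 3)%N by rewrite -ltnS ltn_mod.
pose s := (rows + q + (q + a))%N.
have sn : (s <= n)%N by rewrite /s; move: roomM qgap a3; clear; lia.
have n4 : (4 %| n - s)%N.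
  have -> : (n - s = (n - rows - 2 * q) %/ 4 * 4)%N; last by rewrite dvdn_mull.
  rewrite /s /a; have := divn_eq (n - rows - 2 * q) 4; clear; lia.
have tN : (t0 + N <= n)%N by move: roomN rn; rewrite -/t0; clear; lia.
have cTB : #|T| = #|B| by rewrite cB card_below.
have qle : (#|T :\: B| <= q + a)%N by rewrite leq_addr.
have sE : s = (#|T| + #|T :\: B| + (q + a))%N by rewrite card_below.
have conv := conversion tN lam0_gt0 (below_subset _ rt0) Bt cTB qle sE hB'.
have ts : (t0 + N <= (n + s)./2)%N.
  by rewrite -[(t0 + N)%N]doubleK half_leq // -mul2n; move: roomN; rewrite -/t0 /s; clear; lia.
(* Vertices between the end of the conversion and [(n + s)./2] are revealed without being used; they
   join the missing set. *)
apply: le_trans (cpr_step (S' := fresh ((n + s)./2)) _ err3 conv _) _.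
- by apply: fresh_subset; apply: leq_trans ts; rewrite leq_addr.
- move=> y _ /existsP[S /and3P[St /eqP cS hS]].
  apply: (principal_endgame St cS) => //.
  + apply: le_trans hS; rewrite /lam1 ler_pM2l ?lam0_gt0 // lef_pV2 ?posrE ?exprn_gt0 //.
    by rewrite ler_weXn2l ?ler1n // leq_add.
  + by move: roomN; rewrite -/t0 /s; clear; lia.
  + by rewrite /s; move: roomM qgap a3; clear; lia.
rewrite lerD2r ler_wpM2r //; apply: (@le_trans _ _ (2 ^+ (q + a))); first by rewrite lerBlDr lerDl.
by rewrite ler_weXn2l ?ler1n // leq_add.
Qed.

End Assembled.
End Assembly.

(** * Choice of the parameters *)

Lemma log_scale_arith (R : realFieldType) (N X J r F U g c l2 lb ld l16 s : R) :
    0 < N -> 0 < X -> 0 < J -> 0 <= c -> 0 <= l2 -> 0 <= r -> 0 <= F -> 0 <= U ->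
    r <= N -> 2 * g + 6 <= N -> J * N <= J * r + 54 * N -> J * (2 * F) <= 3 * N ->
    12 * U * J <= N -> X - c <= lb -> - (2 * X) <= ld -> l16 <= X ->
    J * (c + 2 * l2) <= X -> 2 * s = r * lb + F * ld - N * l2 ->
  (N / 2 - 30 / J * N) * X < s - (g + 3) * l2 - 2 * U * (l16 + 2 * X).
Proof.
move=> N0 X0 J0 c0 l20 r0 F0 U0 rN gN rJ FJ UJ lb1 ld1 l16X lc sE.
pose Y := N * X / J.
have Y0 : 0 < Y by rewrite divr_gt0 // mulr_gt0.
have JY : J * Y = N * X by rewrite /Y mulrCA mulfV ?mulr1 // gt_eqF.
have YE : (N / 2 - 30 / J * N) * X = N * X / 2 - 30 * Y by rewrite /Y; ring.
rewrite {}YE; move: (Y) Y0 JY => {}Y Y0 JY.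
have rX : N * X - 54 * Y <= r * X.
  rewrite -(ler_pM2l J0).
  have := ler_wpM2r (ltW X0) rJ; move: JY; clear; nra.
have rc : r * c + (N + 2 * g + 6) * l2 <= Y.
  have h1 := ler_wpM2r c0 rN; have h2 := ler_wpM2r l20 gN.
  have h3 : N * (c + 2 * l2) <= Y.
    by rewrite -(ler_pM2l J0) JY mulrCA ler_pM2l.
  move: h1 h2 h3; clear; lra.
have fY : 2 * F * X <= 3 * Y.
  rewrite -(ler_pM2l J0); have := ler_wpM2r (ltW X0) FJ; move: JY; clear; nra.
have uY : 12 * U * X <= Y.
  rewrite -(ler_pM2l J0); have := ler_wpM2r (ltW X0) UJ; move: JY; clear; nra.
have rb := ler_wpM2l r0 lb1; have fd := ler_wpM2l F0 ld1; have ul := ler_wpM2l U0 l16X.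
move: sE rX rc fY uY rb fd ul Y0; clear; lra.
Qed.

Lemma sqrtn_exists q : exists k, (k ^ 2 <= q < k.+1 ^ 2)%N.
Proof.
elim: q => [|q [k /andP[kq qk]]]; first by exists 0%N.
have [le|gt] := leqP (k.+1 ^ 2) q.+1; last by exists k; rewrite gt (leq_trans kq).
by exists k.+1; rewrite le /= (leq_ltn_trans qk) // ltn_sqr.
Qed.

Section Choice.
Variables (J u n : nat).
(** 192 comes from [64 * (2 * k + 1) <= 192 * k]. In [L], [J * (J * e)] counts the exposed rows and
    [53 * (J * e)] is the room left for all the other phases. *)
Let A := (192 * 2 ^ (2 * J))%N.
Let L := (J * (J + 53))%N.
(* With [e] of order [n / L], the [J * (J * e)] exposed rows are all but [O(n / J)] of them, and
   with [w1 = A * k] a row fails with probability at most [2 ^ - (2 * J)]; [density] is such that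
   a successful row multiplies the mass by at least [n / density]. *)
Definition density : nat := (512 * 256 * A ^ 2 * L ^ 2)%N.
Definition threshold : nat := (24 + L + 64 * A ^ 2 + (4 * density) ^ J + J)%N.
Hypothesis J_gt0 : (0 < J)%N.
Hypothesis u_big : (threshold <= u)%N.
Hypothesis n_big : (2 ^ (64 * u) <= n)%N.

Lemma threshold_bounds :
  [/\ (24 <= u)%N, (L <= u)%N, (64 * A ^ 2 <= u)%N, ((4 * density) ^ J <= u)%N & (J <= u)%N].
Proof. by move: u_big; rewrite /threshold; clear; split; lia. Qed.

Lemma power_le_n a : (a <= 64)%N -> ((2 ^ u) ^ a <= n)%N.
Proof.
move=> a64; apply: leq_trans n_big; rewrite -expnM leq_exp2l // mulnC.
by rewrite leq_mul2r a64 orbT.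
Qed.

Lemma density_le_n : ((4 * density) ^ J <= n)%N.
Proof.
have [_ _ _ h _] := threshold_bounds.
by apply: leq_trans (power_le_n (a := 1) _) => //; apply: leq_trans h (ltnW (ltn_expl _ _)).
Qed.

Lemma log_le_n : (12 * u * J <= n)%N.
Proof.
have [u24 _ _ _ Ju] := threshold_bounds.
apply: leq_trans (power_le_n (a := 3) _) => //; rewrite expnS -mulnn mulnA.
have h : (u < 2 ^ u)%N by exact: ltn_expl.
by apply: leq_mul; [apply: leq_mul|]; move: u24 Ju h; clear; lia.
Qed.

(** [e] is [n] divided by [L], and [k] is the integer square root of [e / (32 * A ^ 2)], the largest
    for which [w1 = A * k] satisfies [32 * w1 ^ 2 <= e]. *)
Lemma block_size : exists e k : nat,
  [/\ (0 < k)%N, (32 * (A * k) ^ 2 <= e)%N, (k ^ 2 <= e)%N, (L * e <= n)%N &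
   [/\ (128 * n ^ 2 <= density * (k ^ 2 * e))%N, (2 ^ (49 * u + 24) <= e)%N &
   (J * n <= J * (J * (J * e)) + 54 * n)%N]].
Proof.
have [u24 Lu Au _ Ju] := threshold_bounds.
have uu : (u < 2 ^ u)%N by exact: ltn_expl.
have L_gt0 : (0 < L)%N by rewrite muln_gt0 J_gt0 addn_gt0 orbT.
have A_gt0 : (0 < A)%N by rewrite muln_gt0 expn_gt0.
pose e := (n %/ L)%N; pose q := (e %/ (32 * A ^ 2))%N.
have neL : (n < L * e.+1)%N by rewrite mulnC ltn_ceil.
have Len : (L * e <= n)%N by rewrite mulnC leq_trunc_div.
have e_big : (2 ^ (63 * u) <= e)%N.
  rewrite -ltnS -(ltn_pmul2l L_gt0); apply: leq_ltn_trans neL.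
  apply: leq_trans n_big; rewrite (_ : (64 * u = u + 63 * u)%N) ?expnD; last by clear; lia.
  by rewrite leq_mul2r (leq_trans Lu (ltnW uu)) orbT.
have ue : (u < e)%N.
  apply: leq_trans e_big; apply: leq_trans uu _.
  by rewrite leq_exp2l //; clear; lia.
have A32 : (0 < 32 * A ^ 2)%N by rewrite muln_gt0 expn_gt0 A_gt0.
have qe : (32 * A ^ 2 * q <= e)%N by rewrite mulnC leq_trunc_div.
have eq : (e < 32 * A ^ 2 * q.+1)%N by rewrite mulnC ltn_ceil.
have q_gt0 : (0 < q)%N by rewrite divn_gt0 //; move: Au ue; clear; lia.
have [k /andP[kq qk]] := sqrtn_exists q.
have k_gt0 : (0 < k)%N by case: (k) qk q_gt0 => //; clear; lia.
exists e, k; split=> //.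
- rewrite expnMn; apply: leq_trans qe; rewrite -mulnA !leq_mul2l kq !orbT //.
- apply: leq_trans kq (leq_trans _ qe); exact: leq_pmull.
have ek : (e <= 256 * A ^ 2 * k ^ 2)%N.
  have q4 : (q.+1 <= 4 * k ^ 2)%N by apply: leq_trans qk _; rewrite -!mulnn; move: k_gt0; clear; nia.
  have q8 : (q.+1 <= 8 * k ^ 2)%N by move: q4; clear; lia.
  apply: leq_trans (ltnW eq) _; apply: leq_trans (leq_mul (leqnn _) q8) _.
  by rewrite (_ : (32 * A ^ 2 * (8 * k ^ 2) = 256 * A ^ 2 * k ^ 2)%N) //; ring.
have n2 : (n <= 2 * (L * e))%N by move: neL ue; clear; nia.
split.
- apply: (@leq_trans (128 * (2 * (L * e)) ^ 2)); first by rewrite leq_mul2l leq_sqr n2 orbT.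
  rewrite (_ : (128 * (2 * (L * e)) ^ 2 = 512 * L ^ 2 * e * e)%N); last by ring.
  apply: leq_trans (leq_mul (leqnn _) ek) _.
  by rewrite /density (_ : (512 * L ^ 2 * e * (256 * A ^ 2 * k ^ 2) = (512 * 256) * A ^ 2 * L ^ 2 * (k ^ 2 * e))%N) //; ring.
- apply: leq_trans e_big; rewrite leq_exp2l //; move: u24; clear; lia.
have JL : (J * L <= n)%N.
  apply: leq_trans (power_le_n (a := 2) _) => //; rewrite -mulnn.
  by apply: leq_mul; [move: Ju uu|move: Lu uu]; clear; lia.
by move: JL neL Len; rewrite /L; clear; nia.
Qed.

End Choice.

(** * Sum of the failure probabilities *)

Section Decay.
Context (R : archiRealFieldType).

Lemma quadratic_growth (x : R) k : 0 <= x -> x ^+ 2 * (k%:R * (k%:R - 1) / 2) <= (1 + x) ^+ k.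
Proof.
move=> x0; elim: k => [|k IH]; first by rewrite !mul0r mulr0 expr0 ler01.
have lin : 1 + k%:R * x <= (1 + x) ^+ k.
  elim: k {IH} => [|k IH]; first by rewrite mul0r addr0 expr0.
  have k0 : 0 <= k%:R :> R by rewrite ler0n.
  rewrite exprS -natr1; nra.
have h : 0 <= x * ((1 + x) ^+ k - (1 + k%:R * x)) by rewrite mulr_ge0 // subr_ge0.
rewrite [(1 + x) ^+ _]exprS -natr1; lra.
Qed.

(** Since [15 / 16 = (30 / 31) * (31 / 32)], the factor [(30 / 31) ^ u] pays for the linear
    prefactor and [(31 / 32) ^ u] remains. *)
Lemma decay_eventually : exists u0 : nat, forall u, (u0 <= u)%N ->
  216 * u%:R * (30 / 31 : R) ^+ u <= 1.
Proof.
exists (Num.bound (1800 * 216 : R)).+1 => u hu.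
have h : 1800 * 216 < u%:R - 1 :> R.
  rewrite ltrBrDr; apply: (lt_le_trans _ (_ : (Num.bound (1800 * 216 : R)).+1%:R <= u%:R)).
    by rewrite -[ltRHS]natr1 ltrD2r archi_boundP // mulr_ge0.
  by rewrite ler_nat.
have g := @quadratic_growth (1 / 30) u ltac:(lra).
have e : (1 + 1 / 30 : R) ^+ u * (30 / 31) ^+ u = 1.
  by rewrite -exprMn (_ : (_ * _) = 1 :> R) ?expr1n //; lra.
have p0 : 0 <= (30 / 31 : R) ^+ u by apply: exprn_ge0; lra.
rewrite -[leRHS]e ler_wpM2r //; apply: le_trans g.
have u0 : 0 <= u%:R :> R by rewrite ler0n.
nra.
Qed.

Lemma failure_bound J e u n f : (0 < J)%N -> (24 <= u)%N ->
    216 * u%:R * (30 / 31 : R) ^+ u <= 1 ->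
    (n < 2 ^ (64 * u.+1))%N -> (u <= n)%N -> (J * (J * e) <= n)%N -> (n <= J * f)%N ->
    (2 ^ (49 * u + 24) <= e)%N ->
  2 ^+ (J * (J * e)) * (2 ^- (2 * J)) ^+ f + (J * (J * e))%:R * (2 / 2 ^+ e) +
  (2 ^+ (J * e + J * e + 3) * (7 / 8) ^+ (12 * (J * e + J * e + 3)) +
   (200 * u%:R * (15 / 16) ^+ u + (2 * u)%:R * (3 / 2 ^+ u))) <= (31 / 32 : R) ^+ u.+1.
Proof.
move=> J0 u24 dec nu un rn nf eu.
have e_big : (65 * u + 65 <= e)%N.
  apply: leq_trans eu; apply: (@leq_trans (2 ^ (u + 8))); last by rewrite leq_exp2l //; lia.
  by rewrite expnD (_ : (2 ^ 8 = 256)%N) //; have := ltn_expl u (ltnSn 1); lia.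
have mono a : (u <= a)%N -> (2 ^- a : R) <= 2 ^- u.
  by move=> h; rewrite lef_pV2 ?posrE ?exprn_gt0 // ler_weXn2l // ler1n.
(* There are at most [n] rows and [J * f >= n], so the product is at most
   [2 ^ n * 2 ^ - (2 * n)]. *)
have t1 : 2 ^+ (J * (J * e)) * (2 ^- (2 * J)) ^+ f <= 2 ^- u :> R.
  apply: le_trans (mono _ un).
  rewrite -[2 ^- (2 * J)]exprVn -exprM exprVn ler_pdivrMr ?exprn_gt0 //.
  rewrite ler_pdivlMl ?exprn_gt0 // -exprD ler_weXn2l ?ler1n //.
  by rewrite -mulnA; move: rn nf; clear; lia.
have t2 : (J * (J * e))%:R * (2 / 2 ^+ e) <= 2 ^- u :> R.
  rewrite mulrA ler_pdivrMr ?exprn_gt0 //.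
  apply: (@le_trans _ _ (2 ^+ (64 * u.+1) * 2)).
    by rewrite ler_wpM2r // -natrX ler_nat (leq_trans rn) // ltnW.
  rewrite -exprSr ler_pdivlMl ?exprn_gt0 // -exprD ler_weXn2l ?ler1n //.
  by move: e_big; clear; lia.
(* Twelve vertices per unit of the conversion budget suffice, as [2 * (7 / 8) ^ 12 <= 1 / 2]. *)
have t3 : 2 ^+ (J * e + J * e + 3) * (7 / 8) ^+ (12 * (J * e + J * e + 3)) <= 2 ^- u :> R.
  have Jeu : (u <= J * e + J * e + 3)%N by move: e_big J0; clear; nia.
  apply: le_trans (mono _ Jeu).
  rewrite exprM -exprMn -exprVn; apply: lerXn2r; rewrite ?nnegrE; lra.
have t4 : 2 ^- u <= (15 / 16) ^+ u :> R.
  by rewrite -exprVn; apply: lerXn2r; rewrite ?nnegrE; lra.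
have u1 : 24 <= u%:R :> R by rewrite (ler_nat R 24).
have p0 : 0 <= (15 / 16) ^+ u :> R by apply: exprn_ge0; lra.
(* 209 is [3 + 200 + 6], from the three terms [2 ^ - u] and the two endgame terms. It lies below
   [216 * (31 / 32)], which gives the exponent [u.+1]. *)
apply: (@le_trans _ _ (209 * u%:R * (15 / 16) ^+ u)).
  rewrite natrM; nra.
have -> : (15 / 16 : R) = (30 / 31) * (31 / 32) by lra.
have q0 : 0 <= (31 / 32) ^+ u :> R by apply: exprn_ge0; lra.
have r0 : 0 <= (30 / 31) ^+ u :> R by apply: exprn_ge0; lra.
rewrite exprMn exprS mulrA ler_wpM2r //; nra.
Qed.
End Decay.

(** * Transfer to independent random variables *)

Require Import Defs.
From mathcomp Require Import all_classical all_reals all_analysis.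

Import Order.TTheory GRing.Theory Num.Theory.
Import numFieldNormedType.Exports.

Local Open Scope classical_set_scope.
Local Open Scope ring_scope.

Section Transfer.
Context (d : measure_display) (T : measurableType d) (R : realType).
Variable P : probability T R.

Lemma measure_le_sum (I : choiceType) (r : seq I) (F : I -> set T) (E : set T) :
  uniq r -> (forall i, measurable (F i)) -> measurable E ->
  E `<=` \bigcup_(i in [set` r]) F i -> (P E <= \sum_(i <- r) P (F i))%E.
Proof.
move=> ur mF mE sub; rewrite fsbig_seq //.
by apply: content_sub_fsum => //; exact: finite_seq.
Qed.

Lemma measurable_fiber (X : {RV P >-> R}) (a : R) : measurable (X @^-1` [set a]).
Proof. by rewrite -[X @^-1` _]setTI; exact: measurable_funP. Qed.

Lemma sign_fiber (X : {RV P >-> R}) (b : bool) :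
  rademacher X -> P (X @^-1` [set (-1) ^+ b]) = (2^-1)%:E.
Proof. by case=> h1 h2; case: b; [exact: h2|exact: h1]. Qed.

(** Only the masses of the two fibres are prescribed; as they add up to 1, other values have
    probability 0, which has to be discarded explicitly. *)
Lemma rademacher_support (X : {RV P >-> R}) : rademacher X ->
  P (~` (X @^-1` [set 1] `|` X @^-1` [set -1])) = 0%E.
Proof.
case=> h1 h2; have m1 := measurable_fiber X 1; have m2 := measurable_fiber X (-1).
rewrite probability_setC; last exact: measurableU.
rewrite measureU //; first last.
  apply/seteqP; split=> // w [/= -> /eqP]; rewrite -subr_eq0 opprK.
  by rewrite -mulr2n pnatr_eq0.
transitivity (1 - ((2^-1)%:E + (2^-1)%:E) : \bar R)%E.
  by congr (_ - (_ + _))%E; [exact: h1|exact: h2].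
by rewrite -EFinD; congr EFin; lra.
Qed.

Local Notation pr := (@pr R _).

Context (I : finType) (D : {set I}) (X : I -> {RV P >-> R}).
Hypothesis radX : forall i, i \in D -> rademacher (X i).
Hypothesis indX : mutually_independent D X.
Local Notation bits := {ffun I -> bool}.

Let cyl (x : bits) : set T := \bigcap_(i in [set` D]) X i @^-1` [set (-1) ^+ x i].

Lemma measurable_cylinder x : measurable (cyl x).
Proof.
apply: fin_bigcap_measurable => [|i _]; last exact: measurable_fiber.
exact: finite_finset.
Qed.

Lemma probability_cylinder x : P (cyl x) = (2 ^- #|D|)%:E.
Proof.
rewrite indX //.
rewrite (eq_bigr (fun=> (2^-1)%:E)); last by move=> i iD; apply: sign_fiber; exact: radX.
by rewrite prodEFin prodr_const exprVn.
Qed.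

(* The union of cylinders is indexed by sign patterns that are frozen to [y]
   outside [D], so that each cylinder occurs once; averaging over [y] turns the
   count of these patterns into a probability over all sign patterns. *)
Lemma probability_le_pr (E : set T) (bad : pred bits) : measurable E ->
  (forall w (x : bits), E w -> (forall i, i \in D -> X i w = (-1) ^+ x i) -> bad x) ->
  (P E <= (pr bad)%:E)%E.
Proof.
move=> mE badE.
have fE : (P E = (fine (P E))%:E)%E by rewrite fineK // fin_num_measure.
pose agree (y x : bits) := [forall i in ~: D, y i == x i].
have bound (y : bits) :
    fine (P E) <= \sum_(x | bad x) 2 ^- #|D| * (agree y x)%:R.
  rewrite -lee_fin -fE.
  pose F (s : I + bits) : set T := match s with
    | inl i => if i \in D then ~` (X i @^-1` [set 1] `|` X i @^-1` [set -1]) else set0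
    | inr x => if bad x && agree y x then cyl x else set0 end.
  have mF s : measurable (F s).
    case: s => [i|x] /=; case: ifP => // _.
    - by apply: measurableC; apply: measurableU; exact: measurable_fiber.
    - exact: measurable_cylinder.
  apply: (le_trans (measure_le_sum (F := F) (enum_uniq {: I + bits}) mF mE _)).
    (* The sign pattern of [w]. Either it reproduces all the values and [w] is in its cylinder, or
       some [X i w] is not a sign and [w] is in a null set. *)
    move=> w Ew; pose x : bits := [ffun i => if i \in D then X i w == -1 else y i].
    case: (pselect (forall i, i \in D -> X i w = (-1) ^+ x i)) => [h|/existsNP[i /not_implyP[iD h]]].
    - exists (inr x); first by rewrite -[_ (inr x)]/(is_true (inr x \in enum {: I + bits})) mem_enum.
      rewrite /= (badE _ _ Ew h) /=.
      have -> : agree y x.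
        rewrite /agree. apply/fintype.forall_inP => i; rewrite inE ffunE => /negbTE ->.
        by [].
      by move=> i iD; apply: h.
    - exists (inl i); first by rewrite -[_ (inl i)]/(is_true (inl i \in enum {: I + bits})) mem_enum.
      rewrite /= iD => -[/= e|/= e]; apply: h; rewrite ffunE iD e ?eqxx ?expr1 //.
      by rewrite -subr_eq0 opprK -mulr2n pnatr_eq0.
  rewrite big_enum /= big_sumType /= big1 ?add0e => [|i _]; last first.
    by case: ifP => [iD|_]; [rewrite rademacher_support //; exact: radX|rewrite measure0].
  rewrite -sumEFin [leRHS]big_mkcond /=; apply: lee_sum => x _.
  case: (bad x) => /=; last by rewrite measure0.
  case: (agree y x); rewrite ?measure0 ?mulr0 ?mulr1 //.
  by rewrite probability_cylinder.
rewrite fE lee_fin -(Ex_cst _ (fine (P E)) : @Ex R I _ = _).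
apply: le_trans (Ex_le bound) _; rewrite Ex_sum.
have cI : 2 ^- #|D| * 2 ^- #|~: D| = (#|{: bits}|%:R)^-1 :> R.
  by rewrite -invfM -exprD cardsC card_ffun card_bool natrX.
rewrite /pr /Ex mulr_suml big_mkcond /=; apply: ler_sum => x _.
case: (bad x); last by rewrite mulr0n mul0r.
rewrite (_ : true%:R / _ = 2 ^- #|D| * pr (agree^~ x)); first by rewrite -ExZ.
by rewrite pr_agree cI mul1r.
Qed.

End Transfer.

Section Permanent.
Context (d : measure_display) (T : measurableType d) (R : realType).
Context (P : probability T R) (n : nat) (M : 'I_n -> 'I_n -> {RV P >-> R}).

Lemma measurable_permanent_le (c : R) :
  measurable [set w | `|permanent (\matrix_(i < n, j < n) M i j w)| <= c].
Proof.
rewrite -[X in measurable X]setTI.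
apply: (@measurable_fun_le _ T R setT) => //.
apply: measurableT_comp => //.
rewrite /permanent; apply: measurable_sum => s; apply: measurable_prod => i _.
by under eq_fun do rewrite mxE; exact: measurable_funP.
Qed.

Lemma permanent_transfer (c : R) : rademacher_symmetric M ->
  (P [set w | (`|permanent (\matrix_(i < n, j < n) M i j w)| <= c)%R] <=
   (@pr R ('I_n * 'I_n)%type (fun x => `|pm (ent R x) [set: 'I_n]%SET [set: 'I_n]%SET| <= c)%R)%:E)%E.
Proof.
case=> symM radM indM.
apply: (probability_le_pr (X := fun p => M p.1 p.2) _ indM).
- by move=> p; rewrite inE => /radM.
- exact: measurable_permanent_le.
- move=> w x /= hw hx; rewrite pm_setT; move: hw; rewrite /permanent.
  congr (`|_| <= _); apply: eq_bigr => s _; apply: eq_bigr => i _.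
  rewrite mxE /ent /sg /edge; case: leqP => ij.
  + by rewrite -(hx (i, s i)) // inE.
  + by rewrite symM -(hx (s i, i)) // inE ltnW.
Qed.
End Permanent.

(** * Size of the final bound and proof of the theorem *)

Lemma ln_exp (R : realType) k (x : R) : 0 < x -> ln (x ^+ k) = k%:R * ln x.
Proof. by move=> x0; rewrite lnXn // mulr_natl. Qed.

Lemma permanent_scale (R : realType) (J C u n e f : nat) (beta delta : R)
    (rows := (J * (J * e))%N) (gap := (J * e + J * e)%N) :
    (0 < J)%N -> (0 < C)%N -> (16 <= n)%N -> (2 * J <= n)%N ->
    ((4 * C) ^ J <= n)%N -> (12 * u * J <= n)%N -> (J * f <= n + J)%N ->
    (rows <= n)%N -> (J * n <= J * rows + 54 * n)%N -> (2 * gap + 6 <= n)%N ->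
    n%:R / C%:R <= beta -> n%:R ^- 2 <= delta ->
  n%:R `^ (n%:R / 2 - 30 / J%:R * n%:R) <
  Num.sqrt (beta ^+ rows * delta ^+ f / 2 ^+ n) / 2 ^+ (gap + 3) / (16 * n%:R ^+ 2) ^+ (2 * u).
Proof.
move=> J_gt0 C_gt0 n16 Jn Cn un fn rows_le rows_ge gap_le beta_ge delta_ge.
have n0 : 0 < n%:R :> R by rewrite ltr0n; apply: leq_trans n16.
have C0 : 0 < C%:R :> R by rewrite ltr0n.
have J0 : 0 < J%:R :> R by rewrite ltr0n.
have b0 : 0 < beta by apply: lt_le_trans beta_ge; rewrite divr_gt0.
have d0 : 0 < delta by apply: lt_le_trans delta_ge; rewrite invr_gt0 exprn_gt0.
have pos2 i : 0 < 2 ^+ i :> R by rewrite exprn_gt0.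
have th0 : 0 < beta ^+ rows * delta ^+ f / 2 ^+ n by rewrite divr_gt0 // mulr_gt0 // exprn_gt0.
have s0 : 0 < 16 * n%:R ^+ 2 :> R by rewrite mulr_gt0 // exprn_gt0.
have sq0 : 0 < Num.sqrt (beta ^+ rows * delta ^+ f / 2 ^+ n) by rewrite sqrtr_gt0.
rewrite -ltr_ln ?posrE ?powR_gt0 ?divr_gt0 ?exprn_gt0 //.
set X := ln (n%:R : R); set l2 := ln (2 : R); set c := ln (C%:R : R).
have lnsq : ln (Num.sqrt (beta ^+ rows * delta ^+ f / 2 ^+ n)) * 2 =
    rows%:R * ln beta + f%:R * ln delta - n%:R * l2.
  rewrite mulrC -(ln_exp 2 sq0) sqr_sqrtr ?(ltW th0) // ln_div ?posrE ?mulr_gt0 ?exprn_gt0 //.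
  by rewrite lnM ?posrE ?exprn_gt0 // !ln_exp.
rewrite ln_powR !ln_div ?posrE ?divr_gt0 ?exprn_gt0 // !ln_exp // lnM ?posrE ?exprn_gt0 // ln_exp // -/X -/l2.
have ln16 : ln 16 <= X by rewrite /X ler_ln ?posrE // ler_nat.
have X0 : 0 < X by apply: lt_le_trans ln16; apply: ln_gt0; rewrite ltr1n.
have l20 : 0 <= l2 by apply: ln_ge0; rewrite ler1n.
have c0 : 0 <= c by apply: ln_ge0; rewrite ler1n.
have lb : X - c <= ln beta by rewrite -ln_div ?posrE // ler_ln ?posrE ?divr_gt0.
have ld : - (2 * X) <= ln delta.
  rewrite (_ : - (2 * X) = ln (n%:R ^- 2)) ?ler_ln ?posrE ?invr_gt0 ?exprn_gt0 //.
  by rewrite lnV ?posrE ?exprn_gt0 // ln_exp.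
have lc : J%:R * (c + 2 * l2) <= X.
  have -> : J%:R * (c + 2 * l2) = ln ((4 * C) ^ J)%N%:R.
    rewrite natrX ln_exp ?ltr0n ?muln_gt0 // natrM lnM ?posrE // (_ : 4 = 2 ^+ 2 :> R); last by lra.
    by rewrite ln_exp // -/l2 -/c; congr (_ * _); lra.
  by rewrite /X ler_ln ?posrE ?ler_nat // ltr0n expn_gt0 muln_gt0 C_gt0.
rewrite natrM natrD.
apply: (@log_scale_arith _ _ _ _ rows%:R f%:R u%:R gap%:R c l2 (ln beta) (ln delta)) => //.
- by rewrite ler_nat.
- by rewrite -natrM -natrD ler_nat.
- by rewrite -!natrM -natrD ler_nat.
- by rewrite -!natrM ler_nat; move: fn Jn; clear; nia.
- by rewrite -!natrM ler_nat.
- by rewrite mulrC lnsq.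
Qed.

Lemma permanent_pr (R : realType) (J u n : nat) :
    (0 < J)%N -> (threshold J <= u)%N -> 216 * u%:R * (30 / 31 : R) ^+ u <= 1 ->
    (2 ^ (64 * u) <= n)%N -> (n < 2 ^ (64 * u.+1))%N ->
  @pr R ('I_n * 'I_n)%type (fun x => `|pm (ent R x) [set: 'I_n]%SET [set: 'I_n]%SET| <=
    n%:R `^ (n%:R / 2 - 30 / J%:R * n%:R)) <= (31 / 32) ^+ u.+1.
Proof.
move=> J_gt0 u_big dec n_big n_lt.
have [u24 Lu _ _ Ju] := threshold_bounds u_big.
have Cn := density_le_n u_big n_big; have un := log_le_n u_big n_big.
have [e [k [k_gt0 Ake ke Len [density_ge eu rows_ge]]]] := block_size J_gt0 u_big n_big.
set C := density J in Cn density_ge.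
pose A := (192 * 2 ^ (2 * J))%N; pose f := (n %/ J).+1.
have A_gt0 : (0 < A)%N by rewrite muln_gt0 expn_gt0.
have C_gt0 : (0 < C)%N by rewrite /C /density !(muln_gt0, expn_gt0, addn_gt0) J_gt0 ?orbT.
have uu : (u < 2 ^ u)%N by exact: ltn_expl.
have un1 : (u < n)%N.
  by apply: leq_trans uu (leq_trans _ n_big); rewrite leq_exp2l // leq_pmull.
have e_big : (2 ^ 9 * 2 ^ (49 * u + 15) <= e)%N.
  by rewrite -expnD; apply: leq_trans eu; rewrite leq_exp2l //; clear; lia.
have ue : (u <= e)%N.
  by apply: leq_trans (ltnW uu) (leq_trans _ eu); rewrite leq_exp2l //; clear; lia.
have e72 : (72 <= e)%N.
  apply: leq_trans e_big; rewrite (_ : (2 ^ 9 = 512)%N) //.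
  by have := expn_gt0 2 (49 * u + 15); clear; lia.
have e0 : (0 < e)%N by apply: leq_trans e72.
have l_gt0 : (0 < J * e)%N by rewrite muln_gt0 J_gt0.
have n_gt0 : (0 < n)%N by apply: leq_ltn_trans un1.
have room : (J * (J * e) + 53 * (J * e) <= n)%N by rewrite -mulnDl mulnA (mulnC _ J).
have Je72 : (72 <= J * e)%N by apply: leq_trans e72 _; rewrite leq_pmull.
have fn1 : (n <= J * f)%N by rewrite mulnC ltnW // ltn_ceil.
have fn2 : (J * f <= n + J)%N by rewrite mulnS addnC leq_add2r mulnC leq_trunc_div.
have n0 : 0 < n%:R :> R by rewrite ltr0n.
have C0 : 0 < C%:R :> R by rewrite ltr0n.
have k0 : 0 < k%:R :> R by rewrite ltr0n.
have e0R : 0 < e%:R :> R by rewrite ltr0n.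
pose beta : R := k%:R ^+ 2 * e%:R / (128 * n%:R).
pose delta : R := (2 * n%:R * beta)^-1.
have beta_gt0 : 0 < beta by rewrite divr_gt0 ?mulr_gt0 ?exprn_gt0.
have beta_ge : n%:R / C%:R <= beta.
  rewrite ler_pdivlMr ?mulr_gt0 // mulrAC ler_pdivrMr //.
  rewrite -!natrX -!natrM ler_nat; move: density_ge; clear.
  by rewrite [(k ^ 2 * e * C)%N]mulnC -mulnn; apply: leq_trans; rewrite mulnCA.
have delta_gt0 : 0 < delta by rewrite invr_gt0 mulr_gt0 // mulr_gt0.
have nbeta : 2 * n%:R * beta = k%:R ^+ 2 * e%:R / 64.
  by rewrite /beta; field; rewrite gt_eqF.
have delta_ge : n%:R ^- 2 <= delta.
  rewrite /delta nbeta lef_pV2 ?posrE ?divr_gt0 ?mulr_gt0 ?exprn_gt0 // ler_pdivrMr // -!natrX -!natrM ler_nat.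
  rewrite -mulnn; apply: (@leq_trans (n * n)); last exact: leq_pmulr.
  have en : (e <= n)%N by apply: leq_trans room; apply: leq_trans (leq_pmull e J_gt0) _; move: Je72; clear; lia.
  by apply: leq_mul => //; apply: leq_trans en.
have delta_le1 : delta <= 1.
  rewrite /delta nbeta invf_le1 ?divr_gt0 ?mulr_gt0 ?exprn_gt0 // ler_pdivlMr // mul1r -natrX -natrM ler_nat.
  by apply: leq_trans (leq_pmull _ _); rewrite ?expn_gt0 ?k_gt0 //; move: e72; clear; lia.
have w1_gt0 : (0 < A * k)%N by rewrite muln_gt0 A_gt0.
have kw1 : 64 * (k.*2.+1)%:R / (A * k)%:R <= 2 ^- (2 * J) :> R.
  rewrite ler_pdivrMr ?ltr0n // natrM /A natrM natrX (mulrC 192%:R) -[_ * 192%:R * _]mulrA.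
  rewrite mulKf ?gt_eqF ?exprn_gt0 // -!natrM ler_nat -muln2; move: k_gt0; clear; lia.
have betaE : beta = k%:R ^+ 2 * e%:R / (128 * n%:R) by [].
have beta_delta : beta * delta = (2 * n%:R)^-1.
  by rewrite /delta invfM mulrCA mulfV ?mulr1 // gt_eqF.
pose N := (12 * (J * e + J * e + 3))%N.
have roomN : (2 * (J * e + J * (J * e + e) + N) <= n + J * (J * e))%N.
  by rewrite mulnDr /N; move: room Je72; clear; lia.
have roomM : (2 * (2 ^ (48 * u + 14) * (130 * u)) + J * (J * e) + 2 * (J * e + J * e) + 3 <= n)%N.
  have h : (2 * (2 ^ (48 * u + 14) * (130 * u)) <= e)%N.
    apply: leq_trans e_big; rewrite (_ : (2 ^ 9 = 512)%N) //.
    rewrite (_ : (49 * u + 15 = (48 * u + 14) + u + 1)%N); last by clear; lia.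
    rewrite (expnD 2 (48 * u + 14 + u) 1) (expnD 2 (48 * u + 14) u); move: (2 ^ (48 * u + 14))%N (2 ^ u)%N uu => a b ub.
    rewrite (_ : (2 * (a * (130 * u)) = 260 * (a * u))%N); last by clear; ring.
    rewrite (_ : (512 * (a * b * 2 ^ 1) = 1024 * (a * b))%N); last by clear; ring.
    by apply: leq_mul => //; rewrite leq_mul2l (ltnW ub) orbT.
  have eJ : (e <= J * e)%N by rewrite leq_pmull.
  by move: h eJ room Je72; clear; lia.
(* With [a = 2 ^ (4 * u)], the exponent [28 * u + 13] makes the second term [4352 / 2 ^ 13 / a]. The
   sum is below [17 / a], and [(3 / 2 ^ u) ^ 4 = 81 / a]. *)
have p2E : 16 / (2 ^ (4 * u))%N%:R + 4352 * (2 ^ (4 * u))%N%:R ^+ 6 / (2 ^ (28 * u + 13))%N%:R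
    <= (3 / 2 ^+ u) ^+ 4 :> R.
  pose a : R := 2 ^+ (4 * u); have a0 : 0 < a by rewrite exprn_gt0.
  have aE : (2 ^ (4 * u))%N%:R = a by rewrite natrX.
  have mE : (2 ^ (28 * u + 13))%N%:R = a ^+ 6 * (a * 2 ^+ 13).
    by rewrite natrX /a -exprM -!exprD; congr (_ ^+ _); clear; lia.
  have pE : (3 / 2 ^+ u) ^+ 4 = 81 / a.
    rewrite exprMn exprVn -exprM (mulnC u); congr (_ / _).
    by rewrite -natrX.
  rewrite aE mE pE; move: a0; clear; move: (a) => {}a a0.
  have a6 : 0 < a ^+ 6 by rewrite exprn_gt0.
  rewrite (_ : 4352 * a ^+ 6 / _ = 4352 / 2 ^+ 13 / a).
    rewrite -mulrDl ler_pM2r ?invr_gt0 // -[13%N]/(10 + 3)%N exprD; lra.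
  by field; rewrite !gt_eqF ?exprn_gt0.
apply: le_trans (failure_bound J_gt0 u24 dec n_lt (ltnW un1) _ fn1 eu); last first.
  by apply: leq_trans room; rewrite leq_addr.
have u_gt0 : (0 < u)%N by apply: leq_trans u24.
have w2_gt1 : (2 <= 2 ^ (4 * u))%N by rewrite -[2%N in leqLHS]expn1 leq_exp2l //; move: u_gt0; clear; lia.
have M_gt1 : (2 <= 2 ^ (48 * u + 14))%N by rewrite -[2%N in leqLHS]expn1 leq_exp2l //; clear; lia.
(* The number of blocks is exactly this product, [1 + 20 * u + 28 * u + 13] being the exponent. That
   so many blocks fit into [n] vertices is why [u] is only [log2 n / 64]. *)
have Mm : (2 * (1024 ^ (2 * u) * 2 ^ (28 * u + 13)) <= 2 ^ (48 * u + 14))%N.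
  rewrite -{1}[1024%N]/(2 ^ 10)%N -expnM -expnD -expnS leq_exp2l //; clear; lia.
have p2_ge0 : 0 <= 3 / 2 ^+ u :> R by rewrite divr_ge0 // exprn_ge0.
have m_gt0 : (0 < 2 ^ (28 * u + 13))%N by rewrite expn_gt0.
apply: le_trans (permanent_lower f l_gt0 n_gt0 w1_gt0 Ake kw1 beta_gt0 betaE delta_gt0 delta_le1
  beta_delta roomN roomM w2_gt1 m_gt0 p2_ge0 p2E u_gt0 M_gt1 Mm).
apply: pr_le => x /le_lt_trans; apply.
apply: (permanent_scale (C := C)) => //.
- by apply: leq_trans (ltnW un1); apply: leq_trans u24.
- apply: leq_trans un; move: u24 J_gt0; clear; nia.
- by apply: leq_trans room; rewrite leq_addr.
- by move: room Je72; clear; lia.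
Qed.

Theorem theorem1p3 (R : realType) :
  exists2 c : R, 0 < c &
    forall eps : R, 0 < eps ->
    exists n0 : nat, forall n : nat, (n0 <= n)%N ->
    forall (d : measure_display) (T : measurableType d) (P : probability T R)
      (M : 'I_n -> 'I_n -> {RV P >-> R}),
    rademacher_symmetric M ->
    (P [set w | (`| permanent (\matrix_(i < n, j < n) M i j w) |
                <= n%:R `^ (n%:R / 2 - eps * n%:R))%R ]
       <= (n%:R `^ (- c))%:E)%E.
Proof.
have ln2 : 0 < ln (2 : R) by apply: ln_gt0; rewrite ltr1n.
(* Chosen so that [(31 / 32) ^ u.+1 = (2 ^ (64 * u.+1)) ^ - c], while [n < 2 ^ (64 * u.+1)]. *)
pose c : R := - ln (31 / 32) / (64 * ln 2).
exists c; first by rewrite divr_gt0 ?mulr_gt0 // oppr_gt0; apply: ln_lt0; lra.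
move=> eps eps0; have [u0 dec] := decay_eventually R.
pose J := (Num.bound (30 / eps)).+1.
have Jeps : 30 / J%:R <= eps.
  rewrite ler_pdivrMr ?ltr0n // mulrC -ler_pdivrMr // ltW //.
  apply: lt_le_trans (archi_boundP _) _; first by rewrite divr_ge0 // ltW.
  by rewrite ler_nat.
exists (2 ^ (64 * (threshold J + u0)))%N => n n_ge d T P M radM.
have n_gt0 : (0 < n)%N by apply: leq_trans n_ge; rewrite expn_gt0.
pose u := (trunc_log 2 n %/ 64)%N.
have /andP[log_le log_gt] := trunc_log_bounds (ltnSn 1) n_gt0.
have n_big : (2 ^ (64 * u) <= n)%N.
  by apply: leq_trans log_le; rewrite leq_exp2l // mulnC leq_trunc_div.
have n_lt : (n < 2 ^ (64 * u.+1))%N.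
  by apply: leq_trans log_gt _; rewrite leq_exp2l // mulnC ltn_ceil.
have u_big : (threshold J + u0 <= u)%N.
  by rewrite leq_divRL // mulnC trunc_log_max.
have uJ : (threshold J <= u)%N by apply: leq_trans u_big; rewrite leq_addr.
have uu0 : (u0 <= u)%N by apply: leq_trans u_big; rewrite leq_addl.
apply: le_trans (permanent_transfer _ radM) _; rewrite lee_fin.
have n1 : 1 <= n%:R :> R by rewrite ler1n.
have n0 : 0 < n%:R :> R by rewrite ltr0n.
apply: (@le_trans _ _ ((31 / 32) ^+ u.+1)).
  apply: le_trans (permanent_pr (ltn0Sn _) uJ (dec _ uu0) n_big n_lt).
  apply: pr_le => x /le_trans; apply; apply: ler_powR => //.
  by rewrite lerD2l lerN2 ler_wpM2r // ltW.
have p0 : 0 < 31 / 32 :> R by lra.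
rewrite -ler_ln ?posrE ?powR_gt0 ?exprn_gt0 // ln_powR ln_exp // mulNr lerNr.
have lnn : ln (n%:R : R) <= 64 * u.+1%:R * ln 2.
  rewrite -natrM -ln_exp // ler_ln ?posrE ?exprn_gt0 // -natrX ler_nat ltnW //.
have c0 : 0 <= c by rewrite divr_ge0 ?mulr_ge0 ?(ltW ln2) // oppr_ge0; apply: ln_le0; lra.
apply: le_trans (ler_wpM2l c0 lnn) _.
by rewrite /c le_eqVlt; apply/orP; left; apply/eqP; field; rewrite gt_eqF.
Qed.
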